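(* Let $A$ be an artin algebra, let $T$ be a tilting (right) $A$-module, let $B=\mathrm{End}_A T$, and let $(\mathcal{T},\mathcal{F})$ and $(\mathcal{X},\mathcal{Y})$ be the torsion pairs induced by $T$ in $\mathrm{mod}\,A$ and $\mathrm{mod}\,B$, respectively. (a) Let $M\in\mathcal{T}$. (i) If $0\subset M_1\subset\cdots\subset M_{n-1}\subset M$ is an $S(\mathcal{T})$-filtration of $M$, then the sequence $0\subset \mathrm{Hom}_A(T,M_1)\subset\cdots\subset \mathrm{Hom}_A(T,M_{n-1})\subset \mathrm{Hom}_A(T,M)$ induced by $\mathrm{Hom}_A(T,-)$ is a $Q(\mathcal{Y})$-filtration of $\mathrm{Hom}_A(T,M)$. (ii) If $M\to M_{n-1}\to\cdots\to M_1\to 0$ is an $S(\mathcal{T})$-cofiltration of $M$, then the sequence $\mathrm{Hom}_A(T,M)\to \mathrm{Hom}_A(T,M_{n-1})\to\cdots\to \mathrm{Hom}_A(T,M_1)\to 0$ induced by $\mathrm{Hom}_A(T,-)$ is a $Q(\mathcal{Y})$-cofiltration of $\mathrm{Hom}_A(T,M)$. (b) Let $M\in\mathcal{Y}$. (i) If $0\subset M_1\subset\cdots\subset M_{n-1}\subset M$ is a $Q(\mathcal{Y})$-filtration of $M$, then the sequence $0\subset M_1\otimes_B T\subset\cdots\subset M_{n-1}\otimes_B T\subset M\otimes_B T$ induced by $-\otimes_B T$ is an $S(\mathcal{T})$-filtration of $M\otimes_B T$. (ii) If $M\to M_{n-1}\to\cdots\to M_1\to 0$ is a $Q(\mathcal{Y})$-cofiltration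 of $M$, then the sequence $M\otimes_B T\to M_{n-1}\otimes_B T\to\cdots\to M_1\otimes_B T\to 0$ induced by $-\otimes_B T$ is an $S(\mathcal{T})$-cofiltration of $M\otimes_B T$. (c) Let $M\in\mathcal{F}$. (i) If $0\subset M_1\subset\cdots\subset M_{n-1}\subset M$ is a $Q(\mathcal{F})$-filtration of $M$, then the sequence $0\subset \mathrm{Ext}^1_A(T,M_1)\subset\cdots\subset \mathrm{Ext}^1_A(T,M_{n-1})\subset \mathrm{Ext}^1_A(T,M)$ induced by $\mathrm{Ext}^1_A(T,-)$ is an $S(\mathcal{X})$-filtration of $\mathrm{Ext}^1_A(T,M)$. (ii) If $M\to M_{n-1}\to\cdots\to M_1\to 0$ is a $Q(\mathcal{F})$-cofiltration of $M$, then the sequence $\mathrm{Ext}^1_A(T,M)\to \mathrm{Ext}^1_A(T,M_{n-1})\to\cdots\to \mathrm{Ext}^1_A(T,M_1)\to 0$ induced by $\mathrm{Ext}^1_A(T,-)$ is an $S(\mathcal{X})$-cofiltration of $\mathrm{Ext}^1_A(T,M)$. (d) Let $M\in\mathcal{X}$. (i) If $0\subset M_1\subset\cdots\subset M_{n-1}\subset M$ is an $S(\mathcal{X})$-filtration of $M$, then the sequence $0\subset \mathrm{Tor}^B_1(M_1,T)\subset\cdots\subset \mathrm{Tor}^B_1(M_{n-1},T)\subset \mathrm{Tor}^B_1(M,T)$ induced by $\mathrm{Tor}^B_1(-,T)$ is a $Q(\mathcal{F})$-filtration of $\mathrm{Tor}^B_1(M,T)$. (ii) If $M\to M_{n-1}\to\cdots\to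 M_1\to 0$ is an $S(\mathcal{X})$-cofiltration of $M$, then the sequence $\mathrm{Tor}^B_1(M,T)\to \mathrm{Tor}^B_1(M_{n-1},T)\to\cdots\to \mathrm{Tor}^B_1(M_1,T)\to 0$ induced by $\mathrm{Tor}^B_1(-,T)$ is a $Q(\mathcal{F})$-cofiltration of $\mathrm{Tor}^B_1(M,T)$.
   Context: $\mathrm{mod}\,A$, $\mathrm{mod}\,B$ are the categories of finitely generated right modules. $T\in\mathrm{mod}\,A$ is a tilting module if $\mathrm{pd}\,T\leq 1$, $\mathrm{Ext}^1_A(T,T)=0$, and there is a short exact sequence $0\to A\to T'\to T''\to 0$ with $T',T''$ (finite) direct sums of direct summands of $T$. With $B=\mathrm{End}_AT$, $T$ is a left $B$-module, and $\mathcal{T}=\{M\in\mathrm{mod}\,A\mid \mathrm{Ext}^1_A(T,M)=0\}$, $\mathcal{F}=\{M\in\mathrm{mod}\,A\mid \mathrm{Hom}_A(T,M)=0\}$, $\mathcal{X}=\{X\in\mathrm{mod}\,B\mid X\otimes_BT=0\}$, $\mathcal{Y}=\{Y\in\mathrm{mod}\,B\mid \mathrm{Tor}^B_1(Y,T)=0\}$. The symbol $\subset$ denotes strict inclusion. For a subcategory $\mathcal{C}$ of a module category, $S(\mathcal{C})$ is the class of nonzero $M\in\mathcal{C}$ such that $0\neq L\subset M$ implies $L\notin\mathcal{C}$, and $Q(\mathcal{C})$ is the class of nonzero $M\in\mathcal{C}$ such that $0\neq L\subset M$ implies $M/L\notin\mathcal{C}$. For a class $\mathcal{Z}$ of modules,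 a $\mathcal{Z}$-filtration of $M$ is a sequence of strict inclusions of submodules $0=M_0\subset M_1\subset\cdots\subset M_n=M$ with $M_i/M_{i-1}\in\mathcal{Z}$ for $1\le i\le n$. A $\mathcal{Z}$-cofiltration of $M$ is a sequence of proper (non-invertible) epimorphisms $M=M_n\xrightarrow{f_n}M_{n-1}\to\cdots\to M_1\xrightarrow{f_1}M_0=0$ with $\mathrm{Ker} f_i\in\mathcal{Z}$ for $1\le i\le n$. In the induced filtrations, the image under the functor of each inclusion is asserted to be injective and the modules are viewed as submodules via these induced maps. *)

(* Defs.v *)
From HB Require Import structures.
From mathcomp Require Import all_boot all_order all_algebra generic_quotient.
From mathcomp Require Import mathcomp_extra boolp classical_sets functions cardinality fsbigop.

Set Implicit Arguments.
Unset Strict Implicit.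
Unset Printing Implicit Defensive.
Import GRing.Theory.
Local Open Scope ring_scope.
Local Open Scope quotient_scope.

(* A right module over R is an lmodType R^c: the scalar product a *: m stands
   for m a. *)

Section Submodules.
Variables (R : pzRingType) (M : lmodType R).

Record subm (S : submodClosed M) := Subm {subm_val :> M; _ : subm_val \in S}.

Variable S : submodClosed M.
HB.instance Definition _ := [isSub for @subm_val S].
HB.instance Definition _ := [Choice of subm S by <:].
HB.instance Definition _ := [SubChoice_isSubLmodule of subm S by <:].

Definition incl (x : subm S) : M := val x.
HB.instance Definition _ :=
  GRing.isLinear.Build R (subm S) M _ incl (fun a x y => linearP val a x y).

Lemma inclP (x : subm S) : incl x \in S. Proof. exact: valP. Qed.
Lemma incl_inj : injective incl. Proof. exact: val_inj. Qed.
End Submodules.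

Section KernelImage.
Variables (R : pzRingType) (M N : lmodType R) (f : {linear M -> N}).

Definition ker_pred : {pred M} := fun x => f x == 0.
Lemma ker_predE x : (x \in ker_pred) = (f x == 0). Proof. by []. Qed.
Lemma ker_closed : submod_closed ker_pred.
Proof.
split=> [|a x y]; rewrite !ker_predE; first by rewrite linear0.
by move=> /eqP fx /eqP fy; rewrite linearP fx fy scaler0 addr0.
Qed.
HB.instance Definition _ := GRing.isSubmodClosed.Build R M ker_pred ker_closed.
Definition kerm : submodClosed M := ker_pred.

Definition im_pred : {pred N} := fun y => `[< exists x, f x = y >].
Lemma im_closed : submod_closed im_pred.
Proof.
split; first by apply/asboolP; exists 0; rewrite linear0.
move=> a _ _ /asboolP[x <-] /asboolP[y <-].
by apply/asboolP; exists (a *: x + y); rewrite linearP.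
Qed.
HB.instance Definition _ := GRing.isSubmodClosed.Build R N im_pred im_closed.
Definition imm : submodClosed N := im_pred.

Definition preim_pred (S : submodClosed N) : {pred M} := fun x => f x \in S.
Lemma preim_predE S x : (x \in preim_pred S) = (f x \in S). Proof. by []. Qed.
Lemma preim_closed S : submod_closed (preim_pred S).
Proof.
split=> [|a x y]; rewrite !preim_predE; first by rewrite linear0 rpred0.
by move=> fx fy; rewrite linearP rpredD // rpredZ.
Qed.
HB.instance Definition _ S :=
  GRing.isSubmodClosed.Build R M (preim_pred S) (preim_closed S).
Definition preimm S : submodClosed M := preim_pred S.

Variables (S : submodClosed M) (S' : submodClosed N).
Hypothesis fS : forall x, x \in S -> f x \in S'.
Definition restr_fun (x : subm S) : subm S' := Subm (fS (inclP x)).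
Lemma restr_linear : linear restr_fun.
Proof. by move=> a x y; apply: val_inj; rewrite /= [LHS]linearP. Qed.
HB.instance Definition _ :=
  GRing.isLinear.Build R (subm S) (subm S') _ restr_fun restr_linear.
Definition restr : {linear subm S -> subm S'} := restr_fun.
End KernelImage.

Section AdditiveQuotient.
Variables (V : zmodType) (I : zmodClosed V).
Definition zquot := Quotient.quot I.
HB.instance Definition _ := GRing.Zmodule.on zquot.
Definition zpi (x : V) : zquot := \pi_(Quotient.quot I) x.

Lemma zpi_eq x y : (zpi x = zpi y) <-> (x - y \in I).
Proof.
rewrite /zpi; split=> [/eqP|xy]; first by rewrite -Quotient.idealrBE.
by apply/eqP; rewrite -Quotient.idealrBE.
Qed.

Lemma zpi_surj (q : zquot) : exists x, zpi x = q.
Proof. by exists (repr (q : Quotient.quot I)); rewrite /zpi reprK. Qed.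

Lemma zpiB : zmod_morphism zpi.
Proof. by move=> x y; rewrite /zpi raddfB. Qed.
HB.instance Definition _ := GRing.isZmodMorphism.Build V zquot zpi zpiB.

Lemma zpi_eq0 x : (zpi x = 0) <-> (x \in I).
Proof. by rewrite -(raddf0 zpi) zpi_eq subr0. Qed.
End AdditiveQuotient.

Section AdditiveQuotientMap.
Variables (V W : zmodType) (I : zmodClosed V) (J : zmodClosed W).
Variables (g : {additive V -> W}).
Definition zquot_map (q : zquot I) : zquot J :=
  zpi J (g (repr (q : Quotient.quot I))).

Hypothesis gIJ : forall x, x \in I -> g x \in J.
Lemma zquot_mapE x : zquot_map (zpi I x) = zpi J (g x).
Proof.
apply/zpi_eq; rewrite -raddfB; apply: gIJ; apply/zpi_eq.
by rewrite {1}/zpi reprK.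
Qed.
End AdditiveQuotientMap.

Section QuotientModule.
Variables (R : pzRingType) (M : lmodType R) (L : submodClosed M).

Definition submodZ_pred : {pred M} := L.
Lemma submodZ_closed : zmod_closed submodZ_pred.
Proof. exact: GRing.submod_closedB (GRing.submodClosedP L). Qed.
HB.instance Definition _ :=
  GRing.isZmodClosed.Build M submodZ_pred submodZ_closed.

Definition quotm := zquot submodZ_pred.
HB.instance Definition _ := GRing.Zmodule.on quotm.
Definition quotm_pi : M -> quotm := zpi submodZ_pred.

Definition quotm_scale (a : R) : quotm -> quotm :=
  zquot_map submodZ_pred (GRing.scale a : {additive M -> M}).

Lemma quotm_scaleE a x : quotm_scale a (quotm_pi x) = quotm_pi (a *: x).
Proof. by apply: zquot_mapE => y; apply: rpredZ. Qed.

Lemma quotm_pi_surj (q : quotm) : exists x, quotm_pi x = q.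
Proof. exact: zpi_surj. Qed.
Lemma quotm_piB : zmod_morphism quotm_pi.
Proof. exact: zpiB. Qed.
HB.instance Definition _ := GRing.isZmodMorphism.Build M quotm quotm_pi quotm_piB.
Lemma quotm_pi_eq0 x : (quotm_pi x = 0) <-> (x \in L).
Proof. exact: zpi_eq0. Qed.

Lemma quotm_scaleA a b v :
  quotm_scale a (quotm_scale b v) = quotm_scale (a * b) v.
Proof. by have [x <-] := quotm_pi_surj v; rewrite !quotm_scaleE scalerA. Qed.
Lemma quotm_scale1 : left_id 1 quotm_scale.
Proof. by move=> v; have [x <-] := quotm_pi_surj v; rewrite quotm_scaleE scale1r. Qed.
Lemma quotm_scaleDr : right_distributive quotm_scale +%R.
Proof.
move=> a u v; have [x <-] := quotm_pi_surj u; have [y <-] := quotm_pi_surj v.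
by rewrite -raddfD !quotm_scaleE scalerDr raddfD.
Qed.
Lemma quotm_scaleDl v : {morph quotm_scale^~ v : a b / a + b}.
Proof.
by move=> a b; have [x <-] := quotm_pi_surj v; rewrite !quotm_scaleE scalerDl raddfD.
Qed.
HB.instance Definition _ := GRing.Zmodule_isLmodule.Build R quotm
  quotm_scaleA quotm_scale1 quotm_scaleDr quotm_scaleDl.

Lemma quotm_piZ : scalable quotm_pi.
Proof. by move=> a x; rewrite -quotm_scaleE. Qed.
HB.instance Definition _ :=
  GRing.isScalable.Build R M quotm *:%R quotm_pi quotm_piZ.
End QuotientModule.

Section FreeModule.
Variables (R : pzRingType) (X : choiceType).

Definition fsupp_pred : {pred X -> R^o} :=
  fun f => `[< exists s : seq X, forall x, x \notin s -> f x = 0 >].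
Lemma fsupp_closed : submod_closed fsupp_pred.
Proof.
split; first by apply/asboolP; exists [::].
move=> a f g /asboolP[s fs] /asboolP[t gt]; apply/asboolP; exists (s ++ t) => x.
rewrite mem_cat negb_or => /andP[xs xt].
by rewrite !fctE fs // gt // scaler0 addr0.
Qed.
HB.instance Definition _ :=
  GRing.isSubmodClosed.Build R (X -> R^o) fsupp_pred fsupp_closed.

Definition freem := subm fsupp_pred.
HB.instance Definition _ := GRing.Lmodule.on freem.

Definition fcoef (f : freem) (x : X) : R := incl f x.

Lemma fdelta_supp (x : X) : (fun y => (y == x)%:R : R^o) \in fsupp_pred.
Proof.
by apply/asboolP; exists [:: x] => y; rewrite inE => /negbTE ->.
Qed.
Definition fdelta (x : X) : freem := Subm (fdelta_supp x).

Lemma fcoef_supp (f : freem) :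
  exists2 s : seq X, uniq s & forall x, x \notin s -> fcoef f x = 0.
Proof.
have /asboolP[s fs] := inclP f; exists (undup s); first exact: undup_uniq.
by move=> x; rewrite mem_undup => /fs.
Qed.

Variable N : lmodType R.
Definition flift (g : X -> N) (f : freem) : N :=
  \sum_(x \in [set: X]) fcoef f x *: g x.

Lemma fliftE g f (s : seq X) : uniq s ->
  (forall x, x \notin s -> fcoef f x = 0) ->
  flift g f = \sum_(x <- s) fcoef f x *: g x.
Proof.
move=> us fs; rewrite /flift (fsbigE s) // => [|x _ /fs ->]; last first.
  by rewrite scale0r.
by apply: eq_bigl => x; rewrite in_setT.
Qed.

Lemma flift_linear g : linear (flift g).
Proof.
move=> a f h; have [s us fs] := fcoef_supp f; have [t ut ht] := fcoef_supp h.
pose r := undup (s ++ t).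
have ur : uniq r := undup_uniq _.
have fr x : x \notin r -> fcoef f x = 0.
  by rewrite mem_undup mem_cat negb_or => /andP[/fs].
have hr x : x \notin r -> fcoef h x = 0.
  by rewrite mem_undup mem_cat negb_or => /andP[_ /ht].
have E x : fcoef (a *: f + h) x = a * fcoef f x + fcoef h x.
  by rewrite /fcoef linearP.
rewrite !(fliftE g ur) // => [|x xr]; last by rewrite E fr // hr // mulr0 addr0.
rewrite scaler_sumr -big_split; apply: eq_bigr => x _ /=.
by rewrite E scalerDl scalerA.
Qed.
HB.instance Definition _ g :=
  GRing.isLinear.Build R freem N _ (flift g) (flift_linear g).

Lemma flift_delta g x : flift g (fdelta x) = g x.
Proof.
rewrite (@fliftE _ _ [:: x]) // => [|y]; last first.
  by rewrite inE /fcoef /incl /= => /negbTE ->.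
by rewrite big_seq1 /fcoef /incl /= eqxx scale1r.
Qed.

Lemma fdelta_sum (f : freem) (s : seq X) : uniq s ->
  (forall x, x \notin s -> fcoef f x = 0) ->
  f = \sum_(x <- s) fcoef f x *: fdelta x.
Proof.
move=> us fs; apply: val_inj; apply/funext => y.
rewrite [in RHS]linear_sum /= fct_sumE.
have [ys|ys] := boolP (y \in s).
  rewrite (big_rem y ys) /= big_seq big1 => [|x].
    by rewrite addr0 /= fctE /= eqxx [RHS]mulr1.
  rewrite mem_rem_uniq // => /andP[/= xy _]; rewrite fctE /=.
  by rewrite eq_sym (negbTE xy) scaler0.
rewrite [LHS](fs y ys) big_seq big1 // => x xs; rewrite fctE /=.
by case: eqP => [yx|_]; [rewrite yx xs in ys | rewrite scaler0].
Qed.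

Lemma freem_ext (g h : {linear freem -> N}) :
  (forall x, g (fdelta x) = h (fdelta x)) -> g =1 h.
Proof.
move=> gh f; have [s us fs] := fcoef_supp f.
rewrite (fdelta_sum us fs) !linear_sum; apply: eq_bigr => x _.
by rewrite !linearZ /= gh.
Qed.
End FreeModule.

Section FreeFunctor.
Variable R : pzRingType.

Definition fmap (X Y : choiceType) (g : X -> Y) : {linear freem R X -> freem R Y} :=
  flift (fun x => fdelta R (g x)).

Lemma fmap_delta (X Y : choiceType) (g : X -> Y) x :
  fmap g (fdelta R x) = fdelta R (g x).
Proof. exact: flift_delta. Qed.

Lemma fmap_id (X : choiceType) (f : freem R X) : fmap id f = f.
Proof. by apply: (freem_ext (h := idfun)) f => x; rewrite fmap_delta. Qed.

Lemma fmap_comp (X Y Z : choiceType) (g : Y -> Z) (h : X -> Y) f :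
  fmap g (fmap h f) = fmap (g \o h) f.
Proof.
by apply: (freem_ext (g := fmap g \o fmap h)) f => x /=; rewrite !fmap_delta.
Qed.

Variables (M N : lmodType R).

(* The canonical free presentation 0 -> syz M -> freem R M -> M -> 0. *)
Definition feval (M' : lmodType R) : {linear freem R M' -> M'} := flift id.
Definition syz (M' : lmodType R) := subm (kerm (feval M')).
HB.instance Definition _ M' := GRing.Lmodule.on (syz M').

Lemma feval_fmap (g : {linear M -> N}) f : feval N (fmap g f) = g (feval M f).
Proof.
apply: (freem_ext (g := feval N \o fmap g) (h := g \o feval M)) f => x /=.
by rewrite fmap_delta !flift_delta.
Qed.

Lemma syz_map_subproof (g : {linear M -> N}) f :
  f \in kerm (feval M) -> fmap g f \in kerm (feval N).
Proof. by rewrite !ker_predE feval_fmap => /eqP ->; rewrite linear0. Qed.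
Definition syz_map (g : {linear M -> N}) : {linear syz M -> syz N} :=
  restr (@syz_map_subproof g).
End FreeFunctor.

Section Hom.
Variables (R : pzRingType) (M N : lmodType R).
Definition Hom := {linear M -> N}.

Lemma Hom_ext (f g : Hom) : f =1 g -> f = g.
Proof.
case: f g => [f [[f1] [f2]]] [g [[g1] [g2]]] /= /funext fg; subst g.
by rewrite (Prop_irrelevance f1 g1) (Prop_irrelevance f2 g2).
Qed.

HB.instance Definition _ := gen_eqMixin Hom.
HB.instance Definition _ := gen_choiceMixin Hom.

Definition Hom_zero : Hom := \0.
Definition Hom_opp (f : Hom) : Hom := \- f.
Definition Hom_add (f g : Hom) : Hom := f \+ g.

Lemma Hom_addA : associative Hom_add.
Proof. by move=> f g h; apply: Hom_ext => x /=; rewrite addrA. Qed.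
Lemma Hom_addC : commutative Hom_add.
Proof. by move=> f g; apply: Hom_ext => x /=; rewrite addrC. Qed.
Lemma Hom_add0 : left_id Hom_zero Hom_add.
Proof. by move=> f; apply: Hom_ext => x /=; rewrite add0r. Qed.
Lemma Hom_addN : left_inverse Hom_zero Hom_opp Hom_add.
Proof. by move=> f; apply: Hom_ext => x /=; rewrite addNr. Qed.
HB.instance Definition _ :=
  GRing.isZmodule.Build Hom Hom_addA Hom_addC Hom_add0 Hom_addN.
End Hom.

Section HomComp.
Variables (R : pzRingType) (L M N : lmodType R).
Definition Hom_comp (g : Hom M N) (f : Hom L M) : Hom L N := g \o f.
Lemma Hom_compB_r g : zmod_morphism (Hom_comp g).
Proof. by move=> f h; apply: Hom_ext => x /=; rewrite linearB. Qed.
Definition Hom_precomp (f : Hom L M) (g : Hom M N) : Hom L N := Hom_comp g f.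
Lemma Hom_compB_l f : zmod_morphism (Hom_precomp f).
Proof. by move=> g h; apply: Hom_ext. Qed.
HB.instance Definition _ g :=
  GRing.isZmodMorphism.Build (Hom L M) (Hom L N) (Hom_comp g) (Hom_compB_r g).
HB.instance Definition _ f :=
  GRing.isZmodMorphism.Build (Hom M N) (Hom L N) (Hom_precomp f) (Hom_compB_l f).
End HomComp.

Section End.
Variables (R : pzRingType) (T : lmodType R).
Definition End := Hom T T.
HB.instance Definition _ := GRing.Zmodule.on End.
Definition End_one : End := idfun.
Definition End_mul (f g : End) : End := Hom_comp f g.

Lemma End_mulA : associative End_mul.
Proof. by move=> f g h; apply: Hom_ext. Qed.
Lemma End_mul1l : left_id End_one End_mul.
Proof. by move=> f; apply: Hom_ext. Qed.
Lemma End_mul1r : right_id End_one End_mul.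
Proof. by move=> f; apply: Hom_ext. Qed.
Lemma End_mulDl : left_distributive End_mul +%R.
Proof. by move=> f g h; apply: Hom_ext. Qed.
Lemma End_mulDr : right_distributive End_mul +%R.
Proof. by move=> f g h; apply: Hom_ext => x /=; rewrite linearD. Qed.
HB.instance Definition _ := GRing.Zmodule_isPzRing.Build End
  End_mulA End_mul1l End_mul1r End_mulDl End_mulDr.
End End.

Section HomModule.
Variables (R : pzRingType) (T M : lmodType R).
Definition Hom_scale (b : (End T)^c) (f : Hom T M) : Hom T M :=
  Hom_comp f (b : End T).

Lemma Hom_scaleA a b f : Hom_scale a (Hom_scale b f) = Hom_scale (a * b) f.
Proof. by apply: Hom_ext. Qed.
Lemma Hom_scale1 : left_id 1 Hom_scale.
Proof. by move=> f; apply: Hom_ext. Qed.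
Lemma Hom_scaleDr : right_distributive Hom_scale +%R.
Proof. by move=> b f g; apply: Hom_ext. Qed.
Lemma Hom_scaleDl f : {morph Hom_scale^~ f : a b / a + b}.
Proof. by move=> a b; apply: Hom_ext => x /=; rewrite linearD. Qed.
HB.instance Definition _ := GRing.Zmodule_isLmodule.Build (End T)^c (Hom T M)
  Hom_scaleA Hom_scale1 Hom_scaleDr Hom_scaleDl.
End HomModule.

Section HomFunctor.
Variables (R : pzRingType) (T M N : lmodType R) (f : {linear M -> N}).
Definition Hom_fun (g : Hom T M) : Hom T N := f \o g.
Lemma Hom_fun_linear : linear Hom_fun.
Proof. by move=> b g h; apply: Hom_ext => x /=; rewrite linearD. Qed.
HB.instance Definition _ :=
  GRing.isLinear.Build (End T)^c (Hom T M) (Hom T N) _ Hom_fun Hom_fun_linear.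
Definition Hom_map : {linear Hom T M -> Hom T N} := Hom_fun.
End HomFunctor.

Definition syz_incl (R : pzRingType) (M : lmodType R) :
  {linear syz M -> freem R M} := @incl R (freem R M) (kerm (feval M)).

Lemma syz_mapE (R : pzRingType) (M N : lmodType R) (g : {linear M -> N}) k :
  syz_incl N (syz_map g k) = fmap R g (syz_incl M k).
Proof. by []. Qed.

Lemma syz_incl_inj (R : pzRingType) (M : lmodType R) : injective (@syz_incl R M).
Proof. exact: incl_inj. Qed.

Lemma syz_map_id (R : pzRingType) (M : lmodType R) k : syz_map (@idfun M) k = k.
Proof. by apply: syz_incl_inj; rewrite syz_mapE fmap_id. Qed.

Lemma syz_map_comp (R : pzRingType) (L M N : lmodType R)
    (g : {linear M -> N}) (f : {linear L -> M}) k :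
  syz_map g (syz_map f k) = syz_map (g \o f) k.
Proof. by apply: syz_incl_inj; rewrite !syz_mapE fmap_comp. Qed.

(* Ext^1_R(T, M) = coker (Hom_R(freem T, M) -> Hom_R(syz T, M)); End T acts on
   the right through the lifts syz_map b of b : T -> T. *)
Section Ext1.
Variables (R : pzRingType) (T M : lmodType R).

Definition extends_pred : {pred Hom (syz T) M} :=
  fun h => `[< exists g : Hom (freem R T) M, forall k, h k = g (syz_incl T k) >].
Lemma extends_closed : zmod_closed extends_pred.
Proof.
split; first by apply/asboolP; exists 0.
move=> h1 h2 /asboolP[g1 e1] /asboolP[g2 e2]; apply/asboolP; exists (g1 - g2).
by move=> k; rewrite /= e1 e2.
Qed.
HB.instance Definition _ :=
  GRing.isZmodClosed.Build (Hom (syz T) M) extends_pred extends_closed.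

Definition Ext1 := zquot extends_pred.
HB.instance Definition _ := GRing.Zmodule.on Ext1.
Definition Ext1_pi : Hom (syz T) M -> Ext1 := zpi extends_pred.
HB.instance Definition _ := GRing.Additive.on Ext1_pi.

Definition Ext1_scale (b : (End T)^c) : Ext1 -> Ext1 :=
  zquot_map extends_pred (Hom_precomp (syz_map (b : End T))).

Lemma Ext1_pi_surj q : exists h, Ext1_pi h = q.
Proof. exact: zpi_surj. Qed.

Lemma Ext1_pi_eq h1 h2 : (Ext1_pi h1 = Ext1_pi h2) <->
  (exists g : Hom (freem R T) M, forall k, h1 k - h2 k = g (syz_incl T k)).
Proof. by rewrite /Ext1_pi zpi_eq; split => [/asboolP|?]; last apply/asboolP. Qed.

Lemma Ext1_scaleE b h :
  Ext1_scale b (Ext1_pi h) = Ext1_pi (Hom_comp h (syz_map (b : End T))).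
Proof.
apply: zquot_mapE => {}h /asboolP[g hg]; apply/asboolP.
by exists (Hom_comp g (fmap R (b : End T))) => k /=; rewrite hg syz_mapE.
Qed.

Lemma Ext1_scaleA a b v : Ext1_scale a (Ext1_scale b v) = Ext1_scale (a * b) v.
Proof.
have [h <-] := Ext1_pi_surj v; rewrite !Ext1_scaleE; congr Ext1_pi.
by apply: Hom_ext => k /=; rewrite syz_map_comp.
Qed.

Lemma Ext1_scale1 : left_id 1 Ext1_scale.
Proof.
move=> v; have [h <-] := Ext1_pi_surj v; rewrite Ext1_scaleE; congr Ext1_pi.
by apply: Hom_ext => k /=; rewrite syz_map_id.
Qed.

Lemma Ext1_scaleDr : right_distributive Ext1_scale +%R.
Proof.
move=> b u v; have [h <-] := Ext1_pi_surj u; have [h' <-] := Ext1_pi_surj v.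
rewrite -raddfD !Ext1_scaleE -raddfD; congr Ext1_pi.
by apply: Hom_ext.
Qed.

Lemma Ext1_scaleDl v : {morph Ext1_scale^~ v : a b / a + b}.
Proof.
move=> a b; have [h <-] := Ext1_pi_surj v; rewrite !Ext1_scaleE -raddfD.
apply/Ext1_pi_eq.
pose fm (c : End T) : Hom (freem R T) (freem R T) := fmap R c.
pose ab : End T := (a : End T) + (b : End T).
have abE : a + b = ab :> End T by [].
rewrite {}abE.
pose d := fm ab - (fm a + fm b).
have dE f : d f = fmap R ab f - (fmap R (a : End T) f + fmap R (b : End T) f).
  by [].
have dK f : d f \in kerm (feval T).
  by rewrite ker_predE dE (linearB (feval T)) (linearD (feval T)) !feval_fmap subrr.
have d_lin : linear (fun f => Subm (dK f) : syz T).
  by move=> c x y; apply: val_inj; exact: (linearP d).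
pose dm := GRing.isLinear.Build R _ (syz T) _ _ d_lin.
pose D : {linear freem R T -> syz T} := HB.pack (fun f => Subm (dK f) : syz T) dm.
exists (Hom_comp h D) => k.
rewrite /= -linearD -linearB; congr (h _).
by apply: syz_incl_inj; rewrite (linearB (syz_incl T)) (linearD (syz_incl T)).
Qed.
HB.instance Definition _ := GRing.Zmodule_isLmodule.Build (End T)^c Ext1
  Ext1_scaleA Ext1_scale1 Ext1_scaleDr Ext1_scaleDl.
End Ext1.

Section Ext1Functor.
Variables (R : pzRingType) (T M N : lmodType R) (f : {linear M -> N}).
Definition Ext1_fun : Ext1 T M -> Ext1 T N :=
  zquot_map (@extends_pred R T N) (Hom_comp f).

Lemma Ext1_funE h : Ext1_fun (Ext1_pi h) = Ext1_pi (Hom_comp f h).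
Proof.
apply: zquot_mapE => {}h /asboolP[g hg]; apply/asboolP.
by exists (Hom_comp f g) => k /=; rewrite hg.
Qed.

Lemma Ext1_fun_linear : linear Ext1_fun.
Proof.
move=> b u v; have [h <-] := Ext1_pi_surj u; have [h' <-] := Ext1_pi_surj v.
rewrite [b *: _]Ext1_scaleE -raddfD !Ext1_funE [b *: _]Ext1_scaleE -raddfD.
by congr Ext1_pi; apply: Hom_ext => k /=; rewrite linearD.
Qed.
HB.instance Definition _ :=
  GRing.isLinear.Build (End T)^c (Ext1 T M) (Ext1 T N) _ Ext1_fun Ext1_fun_linear.
Definition Ext1_map : {linear Ext1 T M -> Ext1 T N} := Ext1_fun.
End Ext1Functor.

(* X (x)_B T for B = End T acting on T from the left by evaluation: the free
   abelian group on X * T modulo the subgroup generated by the usual relators. *)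
Section Tensor.
Variables (R : pzRingType) (T : lmodType R) (X : lmodType (End T)^c).

Definition pairs := (X * T)%type.
HB.instance Definition _ := Choice.on pairs.
Local Notation "x ## t" := (fdelta int ((x, t) : pairs)) (at level 35).

Inductive tens_relator : freem int pairs -> Prop :=
| TensAddl x x' t : tens_relator ((x + x') ## t - (x ## t + x' ## t))
| TensAddr x t t' : tens_relator (x ## (t + t') - (x ## t + x ## t'))
| TensBal x (b : End T) t : tens_relator (((b : (End T)^c) *: x) ## t - x ## b t).

Definition tens_rel : {pred freem int pairs} := fun v =>
  `[< forall I : zmodClosed (freem int pairs),
        (forall r, tens_relator r -> r \in I) -> v \in I >].
Lemma tens_rel_closed : zmod_closed tens_rel.
Proof.
split; first by apply/asboolP => I _; rewrite rpred0.
move=> u v /asboolP uI /asboolP vI; apply/asboolP => I rI.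
by rewrite rpredB ?uI ?vI.
Qed.
HB.instance Definition _ :=
  GRing.isZmodClosed.Build (freem int pairs) tens_rel tens_rel_closed.

Lemma tens_relatorP r : tens_relator r -> r \in tens_rel.
Proof. by move=> rr; apply/asboolP => I; apply. Qed.

Definition tens := zquot tens_rel.
HB.instance Definition _ := GRing.Zmodule.on tens.
Definition tens_pi : freem int pairs -> tens := zpi tens_rel.
HB.instance Definition _ := GRing.Additive.on tens_pi.
Definition tens_pure (x : X) (t : T) : tens := tens_pi (x ## t).

Lemma tens_pi_surj q : exists v, tens_pi v = q.
Proof. exact: zpi_surj. Qed.

Lemma tens_pureDl x x' t :
  tens_pure (x + x') t = tens_pure x t + tens_pure x' t.
Proof. by rewrite /tens_pure -raddfD; apply/zpi_eq/tens_relatorP/TensAddl. Qed.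
Lemma tens_pureDr x t t' :
  tens_pure x (t + t') = tens_pure x t + tens_pure x t'.
Proof. by rewrite /tens_pure -raddfD; apply/zpi_eq/tens_relatorP/TensAddr. Qed.
Lemma tens_pureA x (b : End T) t :
  tens_pure ((b : (End T)^c) *: x) t = tens_pure x (b t).
Proof. by apply/zpi_eq/tens_relatorP/TensBal. Qed.
End Tensor.

Section AdditivePreimage.
Variables (V W : zmodType) (g : {additive V -> W}) (J : zmodClosed W).
Definition zpreim_pred : {pred V} := fun v => g v \in J.
Lemma zpreim_predE v : (v \in zpreim_pred) = (g v \in J). Proof. by []. Qed.
Lemma zpreim_closed : zmod_closed zpreim_pred.
Proof.
split=> [|u v]; rewrite !zpreim_predE; first by rewrite raddf0 rpred0.
by move=> gu gv; rewrite raddfB rpredB.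
Qed.
HB.instance Definition _ := GRing.isZmodClosed.Build V zpreim_pred zpreim_closed.
End AdditivePreimage.

Section TensorMap.
Variables (R : pzRingType) (T : lmodType R) (X Y : lmodType (End T)^c).

Lemma tens_ext (V : zmodType) (g h : {additive tens X -> V}) :
  (forall x t, g (tens_pure x t) = h (tens_pure x t)) -> g =1 h.
Proof.
move=> gh q; have [v <-] := tens_pi_surj q.
have [s us vs] := fcoef_supp v.
rewrite (fdelta_sum us vs) !raddf_sum; apply: eq_bigr => -[x t] _.
by rewrite -[fcoef v (x, t)]intz scaler_int !raddfMz; congr (_ *~ _); exact: gh.
Qed.

Variables (f : {linear X -> Y}) (u : {additive T -> T}).
Definition pair_map (p : pairs X) : pairs Y := (f p.1, u p.2).
Definition tens_bimap : tens X -> tens Y :=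
  zquot_map (@tens_rel R T Y) (fmap int pair_map).

Hypothesis uB : forall (b : End T) t, u (b t) = b (u t).

Lemma tens_bimap_rel v : v \in @tens_rel R T X -> fmap int pair_map v \in @tens_rel R T Y.
Proof.
have H r : tens_relator r -> fmap int pair_map r \in @tens_rel R T Y.
  case=> [x x' t|x t t'|x b t]; rewrite linearB ?linearD !fmap_delta /pair_map /=.
  - by rewrite (linearD f) -opprD; apply: tens_relatorP (TensAddl _ _ _).
  - by rewrite (raddfD u) -opprD; apply: tens_relatorP (TensAddr _ _ _).
  - by rewrite (linearZ_LR f) uB; apply: tens_relatorP (TensBal _ _ _).
move=> /asboolP/(_ (zpreim_pred (fmap int pair_map) (@tens_rel R T Y))); apply.
exact: H.
Qed.

Lemma tens_bimap_pi v : tens_bimap (tens_pi v) = tens_pi (fmap int pair_map v).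
Proof. exact/zquot_mapE/tens_bimap_rel. Qed.

Lemma tens_bimap_pure x t : tens_bimap (tens_pure x t) = tens_pure (f x) (u t).
Proof. by rewrite tens_bimap_pi fmap_delta. Qed.

Lemma tens_bimapB : zmod_morphism tens_bimap.
Proof.
move=> p q; have [v <-] := tens_pi_surj p; have [w <-] := tens_pi_surj q.
by rewrite -raddfB !tens_bimap_pi (linearB (fmap int pair_map)) raddfB.
Qed.
Definition tens_bimap_additive : {additive tens X -> tens Y} :=
  HB.pack tens_bimap
    (GRing.isZmodMorphism.Build (tens X) (tens Y) tens_bimap tens_bimapB).
End TensorMap.

Section TensorModule.
Variables (R : pzRingType) (T : lmodType R) (X : lmodType (End T)^c).

Definition tens_scale (a : R) : tens X -> tens X :=
  tens_bimap (@idfun X) (GRing.scale a : {additive T -> T}).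

Let scaleB a (b : End T) t : a *: b t = b (a *: t).
Proof. by rewrite linearZ. Qed.

Lemma tens_scale_pure a x t : tens_scale a (tens_pure x t) = tens_pure x (a *: t).
Proof. exact: (tens_bimap_pure idfun (scaleB a)). Qed.

Let sc a := tens_bimap_additive idfun (scaleB a) : {additive tens X -> tens X}.

Lemma tens_scaleDr : right_distributive tens_scale +%R.
Proof. by move=> a p q; exact: (raddfD (sc a)). Qed.
Lemma tens_scaleA a b p : tens_scale a (tens_scale b p) = tens_scale (a * b) p.
Proof.
apply: (@tens_ext _ _ _ _ (sc a \o sc b) (sc (a * b))) => x t.
change (tens_scale a (tens_scale b (tens_pure x t)) =
  tens_scale (a * b) (tens_pure x t)).
by rewrite !tens_scale_pure scalerA.
Qed.
Lemma tens_scale1 : left_id 1 tens_scale.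
Proof.
apply: (@tens_ext _ _ _ _ (sc 1) idfun) => x t.
change (tens_scale 1 (tens_pure x t) = tens_pure x t).
by rewrite tens_scale_pure scale1r.
Qed.
Lemma tens_scaleDl p : {morph tens_scale^~ p : a b / a + b}.
Proof.
move=> a b; apply: (@tens_ext _ _ _ _ (sc (a + b)) (sc a \+ sc b)) => x t.
change (tens_scale (a + b) (tens_pure x t) =
  tens_scale a (tens_pure x t) + tens_scale b (tens_pure x t)).
by rewrite !tens_scale_pure scalerDl tens_pureDr.
Qed.
HB.instance Definition _ := GRing.Zmodule_isLmodule.Build R (tens X)
  tens_scaleA tens_scale1 tens_scaleDr tens_scaleDl.
End TensorModule.

Section TensorFunctor.
Variables (R : pzRingType) (T : lmodType R) (X Y : lmodType (End T)^c).
Variable f : {linear X -> Y}.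
Definition tens_fun : tens X -> tens Y := tens_bimap f (@idfun T).

Lemma tens_fun_pure x t : tens_fun (tens_pure x t) = tens_pure (f x) t.
Proof. exact: (@tens_bimap_pure _ _ _ _ f idfun). Qed.

Lemma tens_funB : zmod_morphism tens_fun.
Proof. exact: (@tens_bimapB _ _ _ _ f idfun). Qed.
HB.instance Definition _ :=
  GRing.isZmodMorphism.Build (tens X) (tens Y) tens_fun tens_funB.

Lemma tens_funZ : scalable tens_fun.
Proof.
move=> a; apply: (@tens_ext _ _ _ _ (tens_fun \o ( *:%R a)) ( *:%R a \o tens_fun)).
by move=> x t /=; rewrite [a *: tens_pure x t]tens_scale_pure !tens_fun_pure
  [RHS]tens_scale_pure.
Qed.
HB.instance Definition _ :=
  GRing.isScalable.Build R (tens X) (tens Y) *:%R tens_fun tens_funZ.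
Definition tens_map : {linear tens X -> tens Y} := tens_fun.
End TensorFunctor.

(* Tor_1^B(X, T) = ker (syz X (x)_B T -> freem X (x)_B T). *)
Section Tor1.
Variables (R : pzRingType) (T : lmodType R).

Definition Tor1 (X : lmodType (End T)^c) := subm (kerm (tens_map (syz_incl X))).
HB.instance Definition _ X := GRing.Lmodule.on (Tor1 X).

Variables (X Y : lmodType (End T)^c) (f : {linear X -> Y}).
Lemma Tor1_map_subproof z : z \in kerm (tens_map (syz_incl X)) ->
  tens_map (syz_map f) z \in kerm (tens_map (syz_incl Y)).
Proof.
rewrite !ker_predE => /eqP z0; apply/eqP.
transitivity (tens_map (fmap _ f : {linear freem _ X -> freem _ Y})
  (tens_map (syz_incl X) z)); last by rewrite z0 linear0.
apply: (@tens_ext _ _ _ _ (tens_map (syz_incl Y) \o tens_map (syz_map f))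
  (tens_map (fmap _ f : {linear freem _ X -> freem _ Y})
   \o tens_map (syz_incl X))) => x t /=.
by rewrite !tens_fun_pure.
Qed.
Definition Tor1_map : {linear Tor1 X -> Tor1 Y} := restr Tor1_map_subproof.
End Tor1.

Record modFunctor (R S : pzRingType) := ModFunctor {
  fobj :> lmodType R -> lmodType S;
  fmor : forall M N : lmodType R, {linear M -> N} -> {linear fobj M -> fobj N};
  fmor_id : forall M : lmodType R, fmor (@idfun M : {linear M -> M}) =1 id;
  fmor_comp : forall (L M N : lmodType R)
    (g : {linear M -> N}) (f : {linear L -> M}),
    fmor (g \o f) =1 fmor g \o fmor f
}.

Section TiltingFunctors.
Variables (R : pzRingType) (T : lmodType R).

Lemma Hom_map_id (M : lmodType R) : Hom_map T (@idfun M) =1 id.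
Proof. by move=> h; apply: Hom_ext. Qed.
Lemma Hom_map_comp (L M N : lmodType R)
    (g : {linear M -> N}) (f : {linear L -> M}) :
  Hom_map T (g \o f) =1 Hom_map T g \o Hom_map T f.
Proof. by move=> h; apply: Hom_ext. Qed.
Definition HomF : modFunctor R (End T)^c :=
  @ModFunctor _ _ (fun M => Hom T M) (@Hom_map R T) Hom_map_id Hom_map_comp.

Lemma Ext1_map_id (M : lmodType R) : Ext1_map T (@idfun M) =1 id.
Proof.
move=> q; have [h <-] := Ext1_pi_surj q.
by rewrite /= Ext1_funE; congr Ext1_pi; apply: Hom_ext.
Qed.
Lemma Ext1_map_comp (L M N : lmodType R)
    (g : {linear M -> N}) (f : {linear L -> M}) :
  Ext1_map T (g \o f) =1 Ext1_map T g \o Ext1_map T f.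
Proof.
move=> q; have [h <-] := Ext1_pi_surj q.
by rewrite /= !Ext1_funE; congr Ext1_pi; apply: Hom_ext.
Qed.
Definition Ext1F : modFunctor R (End T)^c :=
  @ModFunctor _ _ (fun M => Ext1 T M) (@Ext1_map R T) Ext1_map_id Ext1_map_comp.

Lemma tens_map_id (X : lmodType (End T)^c) : tens_map (@idfun X) =1 id.
Proof.
apply: (@tens_ext _ _ _ _ (tens_map (@idfun X)) idfun) => x t.
exact: tens_fun_pure.
Qed.
Lemma tens_map_comp (X Y Z : lmodType (End T)^c)
    (g : {linear Y -> Z}) (f : {linear X -> Y}) :
  tens_map (g \o f) =1 tens_map g \o tens_map f.
Proof.
apply: (@tens_ext _ _ _ _ (tens_map (g \o f)) (tens_map g \o tens_map f)) => x t.
by rewrite /= !tens_fun_pure.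
Qed.
Definition tensF : modFunctor (End T)^c R :=
  @ModFunctor _ _ (fun X => tens X) (@tens_map R T) tens_map_id tens_map_comp.

Lemma tens_map_eq (X Y : lmodType (End T)^c) (f g : {linear X -> Y}) :
  f =1 g -> tens_map f =1 tens_map g.
Proof.
move=> fg; apply: (@tens_ext _ _ _ _ (tens_map f) (tens_map g)) => x t.
by rewrite /= !tens_fun_pure fg.
Qed.

Lemma Tor1_map_id (X : lmodType (End T)^c) : Tor1_map (@idfun X) =1 id.
Proof.
move=> z; apply: val_inj; rewrite /= -[RHS]tens_map_id.
by apply: tens_map_eq => k; rewrite syz_map_id.
Qed.
Lemma Tor1_map_comp (X Y Z : lmodType (End T)^c)
    (g : {linear Y -> Z}) (f : {linear X -> Y}) :
  Tor1_map (g \o f) =1 Tor1_map g \o Tor1_map f.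
Proof.
move=> z; apply: val_inj => /=.
rewrite -[RHS](tens_map_comp (syz_map g) (syz_map f)).
by apply: tens_map_eq => k /=; rewrite syz_map_comp.
Qed.
Definition Tor1F : modFunctor (End T)^c R :=
  @ModFunctor _ _ (fun X => Tor1 X) (@Tor1_map R T) Tor1_map_id Tor1_map_comp.
End TiltingFunctors.

(* No nontriviality of A is assumed, and the R-algebra structure is a ring
   morphism from R to the centre of A: algType would force 1 != 0 in A. *)
Definition artinian_ring (R : comPzRingType) : Prop :=
  forall I : nat -> submodClosed R^o,
    (forall n, {subset I n.+1 <= I n}) ->
    exists m, forall n, (m <= n)%N -> I n =i I m.

Definition artin_algebra (A : pzRingType) : Prop :=
  exists (R : comPzRingType) (phi : {rmorphism R -> A}),
    [/\ artinian_ring R,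
        forall r a, phi r * a = a * phi r
      & exists n (v : 'I_n -> A), forall a, exists c : 'I_n -> R,
          a = \sum_(i < n) phi (c i) * v i].

Section ModuleNotions.
Variable R : pzRingType.

Definition fin_gen (M : lmodType R) : Prop :=
  exists n (v : 'I_n -> M), forall x, exists c : 'I_n -> R,
    x = \sum_(i < n) c i *: v i.

Definition zero_module (M : lmodType R) : Prop := forall x : M, x = 0.

Definition short_exact (L M N : lmodType R)
    (f : {linear L -> M}) (g : {linear M -> N}) : Prop :=
  [/\ injective f, forall y, g y = 0 <-> exists x, f x = y
    & forall z, exists y, g y = z].

Definition projective (P : lmodType R) : Prop :=
  forall (M N : lmodType R) (g : {linear M -> N}) (h : {linear P -> N}),
    (forall z, exists y, g y = z) ->
    exists k : {linear P -> M}, forall x, g (k x) = h x.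

Definition pd_le1 (M : lmodType R) : Prop :=
  exists (P1 P0 : lmodType R) (d : {linear P1 -> P0}) (e : {linear P0 -> M}),
    [/\ fin_gen P1 /\ projective P1, fin_gen P0 /\ projective P0
      & short_exact d e].

Definition direct_summand (N M : lmodType R) : Prop :=
  exists (N' : lmodType R) (f : {linear (N * N')%type -> M}), bijective f.

Definition direct_sum n (S : 'I_n -> lmodType R) (M : lmodType R) : Prop :=
  exists j : forall i, {linear S i -> M},
    forall x, exists! s : forall i, S i, x = \sum_(i < n) j i (s i).

Definition in_add (T M : lmodType R) : Prop :=
  exists n (S : 'I_n -> lmodType R),
    (forall i, direct_summand (S i) T) /\ direct_sum S M.
End ModuleNotions.

(* (A^c)^o is A as a right module over itself. *)
Definition tilting (A : pzRingType) (T : lmodType A^c) : Prop :=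
  [/\ fin_gen T, pd_le1 T, zero_module (Ext1 T T)
    & exists (T' T'' : lmodType A^c)
        (f : {linear (A^c)^o -> T'}) (g : {linear T' -> T''}),
        [/\ short_exact f g, in_add T T' & in_add T T'']].

Section TorsionPairs.
Variables (R : pzRingType) (T : lmodType R).
Definition class_T (M : lmodType R) : Prop := fin_gen M /\ zero_module (Ext1 T M).
Definition class_F (M : lmodType R) : Prop := fin_gen M /\ zero_module (Hom T M).
Definition class_X (X : lmodType (End T)^c) : Prop :=
  fin_gen X /\ zero_module (tens X).
Definition class_Y (Y : lmodType (End T)^c) : Prop :=
  fin_gen Y /\ zero_module (Tor1 Y).
End TorsionPairs.

Section Filtrations.
Variables (R : pzRingType) (C : lmodType R -> Prop).

Definition nonzero_sub (M : lmodType R) (L : submodClosed M) : Prop :=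
  exists2 x, x \in L & x != 0.
Definition proper_sub (M : lmodType R) (L : submodClosed M) : Prop :=
  exists x, x \notin L.

Definition S_class (M : lmodType R) : Prop :=
  [/\ C M, ~ zero_module M
    & forall L : submodClosed M, nonzero_sub L -> proper_sub L -> ~ C (subm L)].

Definition Q_class (M : lmodType R) : Prop :=
  [/\ C M, ~ zero_module M
    & forall L : submodClosed M, nonzero_sub L -> proper_sub L -> ~ C (quotm L)].

Definition incl_map (M : lmodType R) (S : submodClosed M) :
  {linear subm S -> M} := @incl R M S.

Definition subquot (M : lmodType R) (L' L : submodClosed M) : lmodType R :=
  quotm (preimm (incl_map L') L).

(* Only the values of F at 0, ..., n are relevant. *)
Definition filtration (M : lmodType R) (n : nat) (F : nat -> submodClosed M) : Prop :=
  [/\ forall x, x \in F 0%N <-> x = 0,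
      forall x, x \in F n
    & forall i, (i < n)%N ->
        [/\ {subset F i <= F i.+1}, exists2 x, x \in F i.+1 & x \notin F i
          & C (subquot (F i.+1) (F i))]].

(* A cofiltration N n -> ... -> N 1 -> N 0 = 0 of N n; f i : N i.+1 -> N i
   is the map usually written f_(i+1). *)
Definition cofiltration (n : nat) (N : nat -> lmodType R)
    (f : forall i, {linear N i.+1 -> N i}) : Prop :=
  zero_module (N 0%N) /\
  forall i, (i < n)%N ->
    [/\ forall y, exists x, f i x = y, ~ injective (f i) & C (subm (kerm (f i)))].
End Filtrations.

(* G takes the inclusions of F i into M to injective maps (hence, being a
   functor, also the inclusions of F i into F j), and the images of the G (F i)
   form a filtration of G M. *)
Definition induces_filtration (R S : pzRingType) (G : modFunctor R S)
    (C : lmodType S -> Prop) (M : lmodType R) (n : nat)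
    (F : nat -> submodClosed M) : Prop :=
  (forall i, (i <= n)%N -> injective (fmor G (incl_map (F i)))) /\
  filtration C n (fun i => imm (fmor G (incl_map (F i)))).

Definition induces_cofiltration (R S : pzRingType) (G : modFunctor R S)
    (C : lmodType S -> Prop) (n : nat) (N : nat -> lmodType R)
    (f : forall i, {linear N i.+1 -> N i}) : Prop :=
  cofiltration C n (N := fun i => G (N i)) (fun i => fmor G (f i)).

(* Main.v *)
(** Brenner-Butler correspondence, made elementwise.  Writing e = f(1) for the
   coresolution 0 -> A -f-> T' -g-> T'' -> 0 and choosing maps u_i, v_i
   (resp. u''_j, v''_j) that exhibit T' (resp. T'') as a summand of a power of
   T, every right B-module X has a two-term complex X^q -> X^p with kernel
   Tor_1(X, T) and cokernel the tensor product of X with T, naturally in X.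
   This gives all the long exact sequences of Tor, its left exactness, the
   vanishing of Tor_1(Hom(T, M), T) and the injectivity of the evaluation
   Hom(T, M) (x) T -> M.  On the other side pd T <= 1 makes the first syzygy of
   T projective, so Ext^1(T, -) is right exact.

   Presenting a finitely generated B-module by Hom(T, T^m), and a torsion-free
   A-module by a universal extension 0 -> M -> E -> T^m -> 0 with
   Ext^1(T, E) = 0, one recovers the two equivalences, under which the simple
   objects of the exact categories T and Y (resp. F and X) correspond.  Each
   functor is exact on the relevant extension-closed class, so filtrations and
   cofiltrations are carried along. *)

From HB Require Import structures.
From mathcomp Require Import all_boot all_order all_algebra.
From mathcomp Require Import boolp classical_sets functions ring.
Require Import Defs.

Set Implicit Arguments.
Unset Strict Implicit.
Unset Printing Implicit Defensive.
Import GRing.Theory.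
Local Open Scope ring_scope.

(** * Linear maps and free modules *)

(** [Tor1] resolves X, by its canonical free presentation, whereas the tilting coresolution resolves
    T: Hom(-, T) turns it into 0 -> Hom(T'', T) -> Hom(T', T) -> T -> 0, a resolution of T by
    projective left B-modules, exact on the right because Ext^1(T'', T) = 0. Tensoring with X gives
    the two-term complex; the tensor product of X with Hom(T', T) is a summand of X^p, cut out by an
    idempotent matrix. The obstacle is thus the balance of Tor, settled by a relation between the
    cycles of the two resolutions. Afterwards the statements about Tor become chases with tuples in
    X.

    The artin hypothesis serves finiteness. The torsion classes demand finite generation and the
    arguments pass to kernels, so A and B have to be right noetherian, and Hom(T, -) and Ext^1(T, -)
    have to preserve finite generation. All this comes from finiteness over R, once the artinian
    ring R is known to be noetherian. The canonical syzygy of T is too large for this purpose, hence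
    a comparison with a finitely generated resolution. *)

Definition surj (M N : Type) (g : M -> N) := forall z, exists y, g y = z.

Section LinearConstructions.
Variable R : pzRingType.

(** Choice gives a function; it is linear because the difference between two candidate values is
    related to 0. Maps whose value depends on auxiliary choices, such as connecting morphisms, are
    all built this way. *)
Lemma lin_of_rel (M N : lmodType R) (P : M -> N -> Prop) :
  (forall a x y x' y', P x y -> P x' y' -> P (a *: x + x') (a *: y + y')) ->
  (forall x, exists y, P x y) -> (forall y, P 0 y -> y = 0) ->
  exists h : {linear M -> N}, forall x, P x (h x).
Proof.
move=> Plin /choice[h hP] P0.
have hl : linear h.
  move=> a x y; apply/eqP; rewrite -subr_eq0; apply/eqP; apply: P0.
  have := Plin (-1) _ _ _ _ (Plin a _ _ _ _ (hP x) (hP y)) (hP (a *: x + y)).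
  by rewrite !scaleN1r addNr [- _ + _]addrC.
pose dm := GRing.isLinear.Build R M N _ h hl.
by exists (HB.pack_for {linear M -> N} h dm).
Qed.

Lemma lin_inj (M N : lmodType R) (f : {linear M -> N}) :
  (forall x, f x = 0 -> x = 0) -> injective f.
Proof.
move=> f0 x y fxy; apply/eqP; rewrite -subr_eq0; apply/eqP; apply: f0.
by rewrite linearB fxy subrr.
Qed.

Lemma factor_surj (M N L : lmodType R) (f : {linear M -> N}) (h : {linear M -> L}) :
  surj f -> (forall x, f x = 0 -> h x = 0) ->
  exists k : {linear N -> L}, forall x, k (f x) = h x.
Proof.
move=> fs fh; have [|||k kP] := @lin_of_rel N L (fun y z => exists2 x, f x = y & h x = z).
- by move=> a _ _ _ _ [x <- <-] [x' <- <-]; exists (a *: x + x'); rewrite linearP.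
- by move=> y; have [x <-] := fs y; exists (h x), x.
- by move=> _ [x fx <-]; apply: fh.
exists k => x; have [x' fx' <-] := kP (f x).
apply/eqP; rewrite -subr_eq0 -linearB; apply/eqP/fh.
by rewrite linearB fx' subrr.
Qed.

Lemma factor_inj (M N L : lmodType R) (f : {linear M -> N}) (h : {linear L -> N}) :
  injective f -> (forall x, exists y, f y = h x) ->
  exists k : {linear L -> M}, forall x, f (k x) = h x.
Proof.
move=> fi fh; apply: (@lin_of_rel L M (fun x y => f y = h x)) => //.
- by move=> a x y x' y' xy xy'; rewrite !linearP xy xy'.
- by move=> y; rewrite linear0 => fy; apply: fi; rewrite linear0.
Qed.

Lemma lin_inv (M N : lmodType R) (f : {linear M -> N}) :
  injective f -> surj f ->
  exists k : {linear N -> M}, (forall x, k (f x) = x) /\ (forall y, f (k y) = y).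
Proof.
move=> fi fs; have [k kP] := factor_inj (h := idfun) fi fs.
by exists k; split=> // x; apply: fi; rewrite kP.
Qed.

Lemma iso_of_same_ker (M N L : lmodType R) (f : {linear M -> N}) (h : {linear M -> L}) :
  surj f -> surj h -> (forall x, f x = 0 <-> h x = 0) ->
  exists k : {linear N -> L}, injective k /\ surj k.
Proof.
move=> fs hs fh; have [k kP] := factor_surj fs (fun x => (fh x).1).
exists k; split=> [|z]; last by have [x <-] := hs z; exists (f x).
by apply: lin_inj => y; have [x <-] := fs y; rewrite kP => /(fh x).2.
Qed.

Lemma flift_lift (X : choiceType) (M N : lmodType R) (g : {linear M -> N})
    (h : {linear freem R X -> N}) : surj g ->
  exists k : {linear freem R X -> M}, forall x, g (k x) = h x.
Proof.
move=> gs; have /choice[s sP] : forall x, exists y, g y = h (fdelta R x) by [].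
exists (flift s); apply: (@freem_ext R X N (g \o flift s) h) => x /=.
by rewrite flift_delta.
Qed.

Lemma feval_delta (M : lmodType R) (m : M) : feval M (fdelta R m) = m.
Proof. exact: flift_delta. Qed.

Lemma feval_surj (M : lmodType R) : surj (feval M).
Proof. by move=> m; exists (fdelta R m); rewrite feval_delta. Qed.

Lemma feval_syz (M : lmodType R) (k : syz M) : feval M (syz_incl M k) = 0.
Proof. by have := inclP k; rewrite ker_predE => /eqP. Qed.

Lemma syz_of (M : lmodType R) (x : freem R M) : feval M x = 0 ->
  exists k, syz_incl M k = x.
Proof.
by move=> x0; have xk : x \in kerm (feval M) by [rewrite ker_predE x0]; exists (Subm xk).
Qed.

Lemma short_exact_ker (M N : lmodType R) (g : {linear M -> N}) : surj g ->
  short_exact (incl_map (kerm g)) g.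
Proof.
move=> gs; split=> [||//]; first exact: val_inj.
move=> y; split=> [y0|[x <-]]; last by have := inclP x; rewrite ker_predE => /eqP.
by have yk : y \in kerm g by [rewrite ker_predE y0]; exists (Subm yk).
Qed.

Lemma short_exact_coker (M N : lmodType R) (f : {linear M -> N}) : injective f ->
  short_exact f (@quotm_pi R N (imm f)).
Proof.
move=> fi; split=> //; last exact: quotm_pi_surj.
by move=> y; split=> [/quotm_pi_eq0/asboolP//|yf]; apply/quotm_pi_eq0/asboolP.
Qed.

End LinearConstructions.

Section HomExtra.
Variables (R : pzRingType) (M N : lmodType R).
Lemma Hom_sumE I (r : seq I) (P : pred I) (F : I -> Hom M N) x :
  (\sum_(i <- r | P i) F i) x = \sum_(i <- r | P i) F i x.
Proof. by elim/big_rec2: _ => // i y z _ <-. Qed.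
End HomExtra.

(** * Finite generation *)

Section MakeSubmodule.
Variables (R : pzRingType) (M : lmodType R) (P : M -> Prop).
Hypotheses (P0 : P 0) (PD : forall a x y, P x -> P y -> P (a *: x + y)).

Definition submod_pred : {pred M} := fun x => `[< P x >].
Lemma submod_pred_closed : submod_closed submod_pred.
Proof.
split=> [|a x y]; first exact/asboolP.
by move=> /asboolP Px /asboolP Py; apply/asboolP/PD.
Qed.
Definition mksub : submodClosed M := HB.pack_for (submodClosed M) submod_pred
  (GRing.isSubmodClosed.Build R M submod_pred submod_pred_closed).
Lemma mksubP x : (x \in mksub) <-> P x.
Proof. by split=> [/asboolP|Px] //; apply/asboolP. Qed.
End MakeSubmodule.

Lemma submodB (R : pzRingType) (M : lmodType R) (K : submodClosed M) x y :
  x \in K -> y \in K -> x - y \in K.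
Proof. by move=> xK yK; rewrite -scaleN1r rpredD ?rpredZ. Qed.

Section LinearSpan.
Variable R : pzRingType.

(** Spans are indexed by sequences rather than by ordinals, so that generating families can be
    concatenated and treated by induction; [fin_genP] makes the link with [fin_gen]. *)
Fixpoint lin (M : lmodType R) (s : seq M) (x : M) : Prop :=
  if s is v :: s' then exists a, exists2 y, lin s' y & x = a *: v + y else x = 0.

Definition fg_pred (M : lmodType R) (K : M -> Prop) : Prop :=
  exists s : seq M, (forall v, v \in s -> K v) /\ forall x, K x -> lin s x.

Variable M : lmodType R.
Implicit Types (s t : seq M) (K : submodClosed M).

Lemma lin0 s : lin s 0.
Proof. by elim: s => //= v s IH; exists 0, 0; rewrite // scale0r addr0. Qed.

Lemma linP s a x y : lin s x -> lin s y -> lin s (a *: x + y).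
Proof.
elim: s x y => [|v s IH] x y /=; first by move=> -> ->; rewrite scaler0 addr0.
move=> [b [x' x's ->]] [c [y' y's ->]]; exists (a * b + c), (a *: x' + y').
  exact: IH.
by rewrite scalerDr scalerA scalerDl addrACA.
Qed.

Lemma lin_cons s v x : lin s x -> lin (v :: s) x.
Proof. by move=> sx; exists 0, x; rewrite // scale0r add0r. Qed.

Lemma lin_mem s v : v \in s -> lin s v.
Proof.
elim: s => //= w s IH; rewrite inE => /orP[/eqP ->|/IH sv].
  by exists 1, 0; rewrite ?scale1r ?addr0 //; exact: lin0.
exact: (lin_cons w sv).
Qed.

Lemma lin_trans s t x : (forall v, v \in s -> lin t v) -> lin s x -> lin t x.
Proof.
elim: s x => [|v s IH] x st /=; first by move=> ->; exact: lin0.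
move=> [a [y sy ->]]; apply: linP; first by apply: st; rewrite mem_head.
by apply: IH sy => w ws; apply: st; rewrite inE ws orbT.
Qed.

Lemma lin_sub K s x : (forall v, v \in s -> v \in K) -> lin s x -> x \in K.
Proof.
elim: s x => [|v s IH] x sK /=; first by move=> ->; rewrite rpred0.
move=> [a [y sy ->]]; rewrite rpredD ?rpredZ //; first by rewrite sK ?mem_head.
by apply: IH sy => w ws; apply: sK; rewrite inE ws orbT.
Qed.

Lemma lin_cat s t x y : lin s x -> lin t y -> lin (s ++ t) (x + y).
Proof.
move=> sx ty; rewrite -[x]scale1r; apply: linP.
  by apply: lin_trans sx => v vs; apply: lin_mem; rewrite mem_cat vs.
by apply: lin_trans ty => v vs; apply: lin_mem; rewrite mem_cat vs orbT.
Qed.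

Lemma fin_genP : fin_gen M <-> exists s, forall x, lin s x.
Proof.
split=> [[n [v vP]]|[s sP]].
  exists [seq v i | i <- enum 'I_n] => x; have [c ->] := vP x.
  elim/big_ind: _ => [|y z ys zs|i _]; first exact: lin0.
    by rewrite -[y]scale1r; apply: linP.
  rewrite -[_ *: _]addr0; apply: linP (lin0 _).
  by apply/lin_mem/map_f; rewrite mem_enum.
exists (size s), (fun i => nth 0 s i) => x; move: (sP x) => {sP}.
elim: s x => [|v s IH] x /=; first by move=> ->; exists (fun=> 0); rewrite big_ord0.
move=> [a [y /IH[c ->] ->]].
exists (fun i => if unlift ord0 i is Some j then c j else a).
rewrite big_ord_recl unlift_none; congr (_ + _).
by apply: eq_bigr => i _; rewrite liftK.
Qed.

Lemma lin_lift (N : lmodType R) (f : {linear N -> M}) (I : N -> Prop) s :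
  (forall v, v \in s -> exists2 w, I w & f w = v) ->
  exists t : seq N, (forall w, w \in t -> I w) /\
    forall z, lin s z -> exists2 y, lin t y & f y = z.
Proof.
elim: s => [|v s IH] sf.
  by exists [::]; split=> // z -> /=; exists 0; rewrite ?linear0.
have [|t [tI tP]] := IH; first by move=> w ws; apply: sf; rewrite inE ws orbT.
have [w wI fw] := sf v (mem_head _ _); exists (w :: t); split.
  by move=> x; rewrite inE => /orP[/eqP ->|/tI].
move=> _ /= [a [y /tP[y' ty' <-] ->]]; exists (a *: w + y'); first by exists a, y'.
by rewrite linearP fw.
Qed.

End LinearSpan.

Lemma lin_map (R : pzRingType) (M N : lmodType R) (f : {linear M -> N}) s x :
  lin s x -> lin (map f s) (f x).
Proof.
elim: s x => [|v s IH] x /=; first by move=> ->; rewrite linear0.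
by move=> [a [y sy ->]]; exists a, (f y); [exact: IH | rewrite linearP].
Qed.

Section FinGen.
Variable R : pzRingType.

Lemma fin_gen_surj (M N : lmodType R) (f : {linear M -> N}) :
  surj f -> fin_gen M -> fin_gen N.
Proof.
move=> fs /fin_genP[s sP]; apply/fin_genP; exists (map f s) => y.
by have [x <-] := fs y; apply: lin_map.
Qed.

(** Subtracting from an element of I a combination of lifted generators of J with the same image
    leaves an element of the kernel. With predicates instead of module types, the lemma also applies
    to ideals. *)
Lemma fg_ext (M N : lmodType R) (f : {linear M -> N}) (I : M -> Prop) (J : N -> Prop) :
  (forall a x y, I x -> I y -> I (a *: x + y)) ->
  (forall x, I x -> J (f x)) -> (forall y, J y -> exists2 x, I x & f x = y) ->
  fg_pred J -> fg_pred (fun x => I x /\ f x = 0) -> fg_pred I.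
Proof.
move=> ID IJ JI [s [sJ sP]] [t [tI tP]].
have [|r [rI rP]] := @lin_lift R N M f I s; first by move=> v /sJ; exact: JI.
exists (r ++ t); split=> [v|x Ix].
  by rewrite mem_cat => /orP[/rI|/tI[]].
have [y ry fy] := rP _ (sP _ (IJ _ Ix)).
rewrite -[x](subrK y) addrC; apply: (lin_cat ry); apply: tP; split; last first.
  by rewrite linearB fy subrr.
have I0 : I 0 by have := ID (-1) _ _ Ix Ix; rewrite scaleN1r addNr.
rewrite addrC -scaleN1r; apply/ID => //.
by apply/(mksubP I0 ID)/(lin_sub _ ry) => v /rI ?; apply/mksubP.
Qed.

Lemma fin_genE (M : lmodType R) : fin_gen M <-> fg_pred (fun _ : M => True).
Proof.
split=> [/fin_genP[s sP]|[s [_ sP]]]; first by exists s; split.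
by apply/fin_genP; exists s => x; apply: sP.
Qed.

Lemma fin_gen_subm (M : lmodType R) (K : submodClosed M) :
  fin_gen (subm K) <-> fg_pred (fun x => x \in K).
Proof.
split=> [/fin_genP[s sP]|[s [sK sP]]].
  exists (map (incl_map K) s); split=> [_ /mapP[v _ ->]|x xK]; first exact: inclP.
  exact: (lin_map (incl_map K) (sP (Subm xK))).
apply/fin_genP; have [|t [_ tP]] := @lin_lift R M (subm K) (incl_map K) (fun=> True) s.
  by move=> v /sK vK; exists (Subm vK).
exists t => x; have [y ty yx] := tP _ (sP _ (inclP x)).
by rewrite -(val_inj yx).
Qed.

Lemma fin_gen_ext (L M N : lmodType R) (f : {linear L -> M}) (g : {linear M -> N}) :
  short_exact f g -> fin_gen L -> fin_gen N -> fin_gen M.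
Proof.
move=> [_ fg gs] /fin_genP[s sP] /fin_genE Nf; apply/fin_genE.
apply: (fg_ext (f := g) _ _ _ Nf) => // [y _|]; first by have [x] := gs y; exists x.
exists (map f s); split=> [_ /mapP[v _ ->]|x [_ /fg[y <-]]]; last exact: lin_map.
by split=> //; apply/fg; exists v.
Qed.

Definition noetherian : Prop :=
  forall (M : lmodType R) (K : submodClosed M), fin_gen M -> fin_gen (subm K).

(** Induction on the generators of the ambient module. The coefficients that v takes in K, modulo
    the span of the other generators s, form an ideal; lifts to K of its generators, together with
    generators of the part of K inside the span of s, generate K. *)
Lemma noetherian_of_ideals :
  (forall I : submodClosed R^o, fg_pred (fun x => x \in I)) -> noetherian.
Proof.
move=> Rfg M K /fin_genP[s sP]; apply/fin_gen_subm.
(* Only K has to lie in the span of s: the induction shrinks s while M stays fixed. *)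
have {sP}: forall x, x \in K -> lin s x by [].
elim: s K => [|v s IH] K sK; first by exists [::].
pose I (x : R) := exists2 y, lin s y & x *: v + y \in K.
have I0 : I 0.
  by exists 0; [exact: lin0 | rewrite scale0r addr0 rpred0].
have ID a x x' : I x -> I x' -> I (a * x + x').
  move=> [y sy xK] [y' sy' x'K]; exists (a *: y + y'); first exact: linP.
  by rewrite scalerDl addrACA -scalerA -scalerDr rpredD ?rpredZ.
have [r [rI rP]] := Rfg (@mksub R R^o I I0 ID).
have /choice[k kP] : forall a : R, exists z : M, a \in r ->
    z \in K /\ exists2 y, lin s y & z = a *: v + y.
  move=> a; case: (boolP (a \in r)) => [/rI/(mksubP (M := R^o) I0 ID)[y sy aK]|]; last by exists 0.
  by exists (a *: v + y) => _; split=> //; exists y.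
have S0 : (0 : M) \in K /\ lin s 0 by split; [exact: rpred0 | exact: lin0].
have SD a (x y : M) : x \in K /\ lin s x -> y \in K /\ lin s y ->
    a *: x + y \in K /\ lin s (a *: x + y).
  by move=> [? ?] [? ?]; split; [rewrite rpredD ?rpredZ | exact: linP].
have [|t [tK tP]] := IH (mksub S0 SD); first by move=> x /mksubP[].
exists (map k r ++ t); split=> [z|x xK].
  by rewrite mem_cat => /orP[/mapP[a /kP[? _] ->]|/tK/mksubP[]].
have [a [y sy xE]] := sK _ xK.
have aI : a \in @mksub R R^o I I0 ID.
  by apply/(mksubP (M := R^o) I0 ID); exists y => //; rewrite -xE.
(* A combination of the lifts with the same v-coefficient a as x, so that x - z lies in the span of
   s. *)
have [z rz [w sw zE]] : exists2 z, lin (map k r) z & exists2 w, lin s w & z = a *: v + w.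
  have {}kP (c : R) : c \in r -> exists2 y, lin s y & k c = c *: v + y by move=> /kP[].
  move: (rP _ aI) kP; elim: (r) (a) => [|c r' IHr] b /=.
    by move=> -> _; exists 0 => //; exists 0; rewrite ?scale0r ?addr0 //; exact: lin0.
  move=> [d [b' r'b' ->]] kP.
  have [|z rz [w sw zE]] := IHr b' r'b'; first by move=> e er; apply: kP; rewrite inE er orbT.
  have [y' sy' kc] := kP c (mem_head _ _).
  exists (d *: k c + z); first by exists d, z.
  exists (d *: y' + w); first exact: linP.
  by rewrite kc zE !scalerDr scalerDl !scalerA addrACA.
rewrite -[x](subrK z) addrC; apply: (lin_cat rz); apply: tP; apply/mksubP; split.
  by rewrite submodB //; apply: lin_sub rz => _ /mapP[c /kP[cK _] ->].
by rewrite xE zE [a *: v + y]addrC addrKA -scaleN1r addrC; apply: linP.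
Qed.
End FinGen.

(** * Artinian commutative rings are noetherian *)

Section Akizuki.
Variable R : comPzRingType.
Hypothesis Rart : artinian_ring R.
Implicit Types I J : submodClosed R^o.

(** Without a minimal member, choice iterates to a strictly descending chain, which cannot
    stabilise. *)
Lemma artinian_min (P : submodClosed R^o -> Prop) I : P I ->
  exists J, P J /\ forall J', P J' -> {subset J' <= J} -> {subset J <= J'}.
Proof.
move=> PI; apply: contrapT => /forallNP noJ.
have /choice[next nextP] : forall J : {J | P J}, exists J' : {J | P J},
    {subset sval J' <= sval J} /\ ~ {subset sval J <= sval J'}.
  move=> [J PJ]; have /not_andP[//|/existsNP[J' /not_implyP[PJ' /not_implyP[? ?]]]] := noJ J.
  by exists (exist _ J' PJ').
pose chain n := sval (iter n next (exist _ I PI)).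
have [n x|m mP] := Rart (I := chain); first by apply: (nextP _).1.
by apply: (nextP (iter m next (exist _ I PI))).2 => x; rewrite -(mP m.+1).
Qed.

Let fg I := fg_pred (fun x : R^o => x \in I).

(* A minimal non-finitely generated ideal I is contradictory: each x either kills
   I or satisfies x I = I, hence acts invertibly on I by the descending chain
   condition, so I is a vector space over R / Ann I; a hyperplane missing some
   v <> 0 is a smaller ideal, hence finitely generated. *)
Section MinimalNotFG.
Variable I : submodClosed R^o.
Hypotheses (nfgI : ~ fg I) (minI : forall J, {subset J <= I} -> ~ {subset I <= J} -> fg J).

(** Multiplication by x presents I as an extension of its image by its kernel. Were both strictly
    smaller than I, both would be finitely generated by minimality, and so would I. *)
Lemma min_not_fg_mul (x : R) : (forall i : R, i \in I -> x * i = 0) \/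
  (forall i : R, i \in I -> exists2 j : R, j \in I & i = x * j).
Proof.
pose mulx : {linear R^o -> R^o} := HB.pack_for {linear R^o -> R^o} (fun y : R^o => x * y : R^o)
  (GRing.isLinear.Build R R^o R^o _ (fun y : R^o => x * y : R^o)
    (fun a y z => etrans (mulrDr _ _ _) (congr1 (+%R^~ _) (mulrCA _ _ _)))).
have J0 : exists2 j : R^o, j \in I & mulx j = 0 by exists 0; rewrite ?rpred0 ?linear0.
have JD (a : R) (y z : R^o) : (exists2 j : R^o, j \in I & mulx j = y) ->
    (exists2 j : R^o, j \in I & mulx j = z) -> exists2 j : R^o, j \in I & mulx j = a *: y + z.
  by move=> [j jI <-] [k kI <-]; exists (a *: j + k); rewrite ?rpredD ?rpredZ ?linearP.
have K0 : (0 : R^o) \in I /\ mulx 0 = 0 by rewrite rpred0 linear0.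
have KD (a : R) (y z : R^o) : y \in I /\ mulx y = 0 -> z \in I /\ mulx z = 0 ->
    a *: y + z \in I /\ mulx (a *: y + z) = 0.
  by move=> [? y0] [? z0]; rewrite rpredD ?rpredZ // linearP y0 z0 scaler0 addr0.
have [IJ|IJ] := pselect {subset I <= mksub J0 JD}.
  by right=> i /IJ/mksubP[j jI <-]; exists j.
have [IK|IK] := pselect {subset I <= mksub K0 KD}.
  by left=> i /IK/mksubP[].
have [|s [sJ sP]] := minI _ IJ.
  by move=> y /mksubP[j jI <-]; rewrite -[mulx j]/(x *: j) rpredZ.
have [|t [tK tP]] := minI _ IK; first by move=> y /mksubP[].
case: nfgI; apply: (fg_ext (f := mulx) (J := fun y => y \in mksub J0 JD)).
- by move=> a y z yI zI; rewrite rpredD ?rpredZ.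
- by move=> y yI; apply/mksubP; exists y.
- by move=> y /mksubP.
- by exists s.
by exists t; split=> [y /tK/mksubP|y yK] //; apply/tP/mksubP.
Qed.

(** The chain of ideals x^n R stabilises, so x^m = x^(m+1) y for some m and y. Since x I = I, each i
    is x^m j with j in I, and then y x i = x^(m+1) y j = i. *)
Lemma min_not_fg_inv (x : R) : (exists2 i : R, i \in I & x * i != 0) ->
  exists y : R, forall i : R, i \in I -> y * (x * i) = i.
Proof.
move=> [i0 i0I xi0]; have xI (i : R) : i \in I -> exists2 j : R, j \in I & i = x * j.
  by case: (min_not_fg_mul x) => [x0|]; [rewrite x0 ?eqxx in xi0 | apply].
pose pw n (z : R^o) := exists y : R, z = x ^+ n * y.
have pw0 n : pw n 0 by exists 0; rewrite mulr0.
have pwD n a (y z : R^o) : pw n y -> pw n z -> pw n (a *: y + z).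
  by move=> [u ->] [v ->]; exists (a * u + v); rewrite mulrDr mulrCA.
have [n z /mksubP[y ->]|m mP] := Rart (I := fun n => mksub (pw0 n) (@pwD n)).
  by apply/mksubP; exists (x * y); rewrite exprSr mulrA.
have /mksubP[y yE] : (x ^+ m : R^o) \in mksub (pw0 m.+1) (@pwD m.+1).
  by rewrite mP //; apply/mksubP; exists 1; rewrite mulr1.
exists y => i iI.
have [j jI ->] : exists2 j : R, j \in I & i = x ^+ m * j.
  elim: (m) i iI => [|k IH] i iI; first by exists i; rewrite // expr0 mul1r.
  have [j /IH[l lI ->] ->] := xI i iI.
  by exists l; rewrite // exprS mulrA.
by rewrite [in RHS]yE exprS; ring.
Qed.

Lemma min_not_fg_false : False.
Proof.
have [v vI v0] : exists2 v : R, v \in I & v != 0.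
  apply: contrapT => Inil; apply: nfgI; exists [::]; split=> // x xI /=.
  by apply/eqP; apply/negP => /negP x0; apply: Inil; exists x.
pose good (A : set R) := [/\ forall x, A x -> (x : R^o) \in I, ~ A v
  & forall a x y, A x -> A y -> A (a * x + y)].
have [F Fgood Ftot|A [[AI Av AD] Amax]] := @Zorn_bigcup R good.
  split=> [x [B FB Bx]|[B FB Bv]|a x y [B FB Bx] [C FC Cy]].
  - by have [BI _ _] := Fgood _ FB; apply: BI.
  - by have [_ nBv _] := Fgood _ FB.
  have [BC|CB] := Ftot _ _ FB FC.
    by exists C => //; have [_ _] := Fgood _ FC; apply=> //; apply: BC.
  by exists B => //; have [_ _] := Fgood _ FB; apply=> //; apply: CB.
(* [good] holds for the empty set, as Zorn also unites the empty chain. If A lacked 0 it would be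
   empty, and {0} would be a larger good set because v is nonzero. *)
have A0 : A 0.
  apply: contrapT => nA0; apply: (Amax [set (0 : R)]%classic); last first.
    split=> [x -> | /eqP | a x y -> ->]; rewrite ?rpred0 //; first exact/negP.
    by rewrite mulr0 addr0.
  split=> [|A0]; last exact/nA0/A0.
  move=> x Ax; case: nA0; rewrite -(addNr x) -mulN1r.
  exact: AD.
pose J := @mksub R R^o A A0 AD.
have JI : {subset J <= I} by move=> x /mksubP; apply: AI.
have [|s [sJ sP]] := minI JI; first by move=> /(_ v vI) /mksubP.
(* For u outside A, maximality puts v in A + R u, say v = a + r u. Here r u is nonzero, so r acts
   invertibly on I and u can be solved for in terms of v. *)
have IJ (u : R) : u \in I -> exists a r : R, A a /\ u = a + r * v.
  move=> uI; have [Au|nAu] := pselect (A u).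
    by exists u, 0; rewrite mul0r addr0.
  have : exists a r : R, A a /\ v = a + r * u.
    apply: contrapT => nv; apply: (Amax [set x : R | exists a r : R, A a /\ x = a + r * u]%classic).
      split=> [x Ax|Au]; first by exists x, 0; rewrite mul0r addr0.
      by apply/nAu/Au; exists 0, 1; rewrite add0r mul1r.
    split=> [x [a [r [Aa ->]]]|//|b x y [a [r [Aa ->]]] [c [d [Ac ->]]]].
      by rewrite rpredD ?(AI _ Aa) // -[r * u]/(r *: (u : R^o)) rpredZ.
    by exists (b * a + c), (b * r + d); split; [exact: (AD) | ring].
  move=> [a [r [Aa vE]]].
  have [|y yP] := @min_not_fg_inv r.
    by exists u => //; apply/eqP => ru; apply: Av; rewrite vE ru addr0.
  exists (- y * a), y; split; first by rewrite -[_ * _]addr0; apply: (AD).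
  by rewrite vE mulrDr yP //; ring.
apply: nfgI; exists ((v : R^o) :: s); split=> [x|x xI].
  by rewrite inE => /orP[/eqP ->|/sJ/JI].
have [a [r [Aa ->]]] := IJ x xI.
by exists r, a; [apply/sP/mksubP | rewrite addrC].
Qed.
End MinimalNotFG.

Lemma artinian_noetherian : noetherian R.
Proof.
apply: noetherian_of_ideals => I; apply: contrapT => nI.
have [J [nJ minJ]] := artinian_min (P := fun J => ~ fg J) nI.
apply: (min_not_fg_false nJ) => K KJ JK.
by apply: contrapT => nK; apply/JK/minJ.
Qed.
End Akizuki.

(** * Restriction of scalars along a ring morphism *)

Definition resc (R S : pzRingType) (psi : {rmorphism R -> S}) (M : lmodType S) : Type := M.

Section RestrictScalars.
Variables (R S : pzRingType) (psi : {rmorphism R -> S}).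
Local Notation resc := (resc psi).

Section Module.
Variable M : lmodType S.
HB.instance Definition _ := GRing.Zmodule.on (resc M).
Definition resc_scale (a : R) (x : resc M) : resc M := psi a *: (x : M).
Lemma resc_scaleA a b v : resc_scale a (resc_scale b v) = resc_scale (a * b) v.
Proof. by rewrite /resc_scale rmorphM scalerA. Qed.
Lemma resc_scale1 : left_id 1 resc_scale.
Proof. by move=> v; rewrite /resc_scale rmorph1 scale1r. Qed.
Lemma resc_scaleDr : right_distributive resc_scale +%R.
Proof. by move=> a u v; rewrite /resc_scale scalerDr. Qed.
Lemma resc_scaleDl v : {morph resc_scale^~ v : a b / a + b}.
Proof. by move=> a b; rewrite /resc_scale rmorphD scalerDl. Qed.
HB.instance Definition _ := GRing.Zmodule_isLmodule.Build R (resc M)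
  resc_scaleA resc_scale1 resc_scaleDr resc_scaleDl.

Lemma lin_resc (s : seq M) x : lin (s : seq (resc M)) x -> lin s x.
Proof.
elim: s x => [|v s IH] x //= [a [y /IH sy ->]].
by exists (psi a), y.
Qed.
End Module.

Hypothesis Sfin : fin_gen (resc S^o).

Lemma fin_gen_resc (M : lmodType S) : fin_gen M -> fin_gen (resc M).
Proof.
move=> /fin_genP[s sP]; have /fin_genP[t tP] := Sfin.
pose act v := (fun a : resc S^o => (a : S) *: (v : M) : resc M).
have act_lin v : linear (act v).
  by move=> a x y; rewrite /act [LHS]scalerDl -scalerA.
pose act' v : {linear resc S^o -> resc M} := HB.pack_for {linear resc S^o -> resc M} (act v)
  (GRing.isLinear.Build R (resc S^o) (resc M) _ _ (act_lin v)).
apply/fin_genP; exists (flatten [seq map (act' v) t | v <- s]) => x.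
move: (sP x) => {sP}; elim: s x => //= v s IH x [a [y /IH sy ->]].
exact: (lin_cat (lin_map (act' v) (tP a)) sy).
Qed.

Lemma noetherian_resc : noetherian R -> noetherian S.
Proof.
move=> Rn M K Mfg; have Mfg' := fin_gen_resc Mfg.
pose KR (x : resc M) := (x : M) \in K.
have KR0 : KR 0 by exact: rpred0.
have KRD a x y : KR x -> KR y -> KR (a *: x + y).
  by move=> Kx Ky; rewrite /KR rpredD ?rpredZ.
have /fin_gen_subm[s [sK sP]] := Rn _ (mksub KR0 KRD) Mfg'.
apply/fin_gen_subm; exists s; split=> [v /sK/mksubP|x xK] //.
by apply/lin_resc/sP/mksubP.
Qed.
End RestrictScalars.

(** * Finiteness over an artin algebra *)

Section SyzygyProjective.
Variables (S : pzRingType) (T : lmodType S).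

(** A form of Schanuel's lemma: comparing the canonical presentation with the given resolution in
    both directions yields b a, which differs from the identity of [syz T] by a map that extends to
    the free module and is therefore invisible in Ext^1. *)
Lemma pd_le1_syz : pd_le1 T ->
  exists P1 : lmodType S, [/\ fin_gen P1, projective P1
    & exists (a : {linear syz T -> P1}) (b : {linear P1 -> syz T})
        (s : {linear freem S T -> syz T}), forall k, k = s (syz_incl T k) + b (a k)].
Proof.
move=> [P1 [P0 [d [e [[fP1 pP1] [fP0 pP0] [di de es]]]]]].
exists P1; split=> //.
have [al alP] := flift_lift (feval T) es.
have [be beP] := pP0 _ _ (feval T) e (@feval_surj _ T).
have [|a aP] := factor_inj (h := al \o syz_incl T) di.
  by move=> k; apply/de; rewrite /= alP feval_syz.
have [|b bP] := factor_inj (h := be \o d) (@syz_incl_inj _ T).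
  by move=> x; apply: syz_of; rewrite /= beP; apply/de; exists x.
(* The composite [be \o al] lifts the identity of T, so its difference from the identity takes
   values in the syzygies. *)
have [|s sP] := factor_inj (h := idfun \- (be \o al)) (@syz_incl_inj _ T).
  by move=> x; apply: syz_of; rewrite /= linearB /= beP alP subrr.
exists a, b, s => k; apply: syz_incl_inj.
by rewrite linearD sP bP /= aP /= subrK.
Qed.

(** The identity of [syz T] factors through the sum of a free module and P1, so lifts on these two
    add up to a lift on [syz T]. *)
Lemma projective_syz : pd_le1 T -> projective (syz T).
Proof.
move=> /pd_le1_syz[P1 [_ pP1 [a [b [s kE]]]]] M N g h gs.
have [p pP] := flift_lift (h \o s) gs.
have [q qP] := pP1 _ _ g (h \o b) gs.
exists ((p \o syz_incl T) \+ (q \o a)) => k.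
by rewrite linearD [in RHS](kE k) linearD /= pP qP.
Qed.
End SyzygyProjective.

Section FiniteHom.
Variable R : pzRingType.
Lemma noetherian_inj (M N : lmodType R) (f : {linear M -> N}) : noetherian R ->
  injective f -> fin_gen N -> fin_gen M.
Proof.
move=> Rn fi Nf; have Kf := Rn _ (imm f) Nf.
have [|k kP] := factor_inj (h := incl_map (imm f)) fi.
  by move=> x; have /asboolP := inclP x.
apply: (fin_gen_surj (f := k) _ Kf) => x.
have fx : f x \in imm f by apply/asboolP; exists x.
by exists (Subm fx); apply: fi; rewrite kP.
Qed.

Lemma lin_sum (M : lmodType R) (s : seq M) (I : Type) (r : seq I) (P : pred I) (F : I -> M) :
  (forall i, P i -> lin s (F i)) -> lin s (\sum_(i <- r | P i) F i).
Proof.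
move=> sF; elim/big_ind: _ => [|x y sx sy|i /sF//]; first exact: lin0.
by rewrite -[x]scale1r; apply: linP.
Qed.

Definition pow_in (M : lmodType R) n (i : 'I_n) (x : M) : 'I_n -> M :=
  fun j => if j == i then x else 0.
Lemma pow_in_linear (M : lmodType R) n (i : 'I_n) : linear (@pow_in M n i).
Proof.
move=> a x y; apply/funext => j; rewrite /pow_in !fctE.
by case: eqP; rewrite ?scaler0 ?addr0.
Qed.
HB.instance Definition _ (M : lmodType R) n (i : 'I_n) := GRing.isLinear.Build R M ('I_n -> M) _
  (@pow_in M n i) (@pow_in_linear M n i).

Lemma pow_sum (M : lmodType R) n (x : 'I_n -> M) : x = \sum_(i < n) pow_in i (x i).
Proof.
apply/funext => j; rewrite fct_sumE (bigD1 j) //= big1 ?addr0 /pow_in ?eqxx //.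
by move=> i; rewrite eq_sym => /negbTE ->.
Qed.

Definition pow_proj (M : lmodType R) n (i : 'I_n) (x : 'I_n -> M) : M := x i.
Lemma pow_proj_linear (M : lmodType R) n (i : 'I_n) : linear (@pow_proj M n i).
Proof. by []. Qed.
HB.instance Definition _ (M : lmodType R) n (i : 'I_n) := GRing.isLinear.Build R ('I_n -> M) M _
  (@pow_proj M n i) (@pow_proj_linear M n i).

Definition pow_pair (M N : lmodType R) n (g : 'I_n -> {linear M -> N}) (x : M) :
  'I_n -> N := fun i => g i x.
Lemma pow_pair_linear (M N : lmodType R) n (g : 'I_n -> {linear M -> N}) :
  linear (pow_pair g).
Proof. by move=> a x y; apply/funext => i; rewrite /pow_pair linearP. Qed.
HB.instance Definition _ (M N : lmodType R) n (g : 'I_n -> {linear M -> N}) :=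
  GRing.isLinear.Build R M ('I_n -> N) _ (pow_pair g) (pow_pair_linear g).

Lemma fin_gen_pow (M : lmodType R) n : fin_gen M -> fin_gen ('I_n -> M).
Proof.
move=> /fin_genP[s sP]; apply/fin_genP.
exists (flatten [seq map (pow_in i) s | i <- enum 'I_n]) => x.
rewrite (pow_sum x); apply: lin_sum => i _.
apply: lin_trans (lin_map (@pow_in M n i) (sP (x i))) => v vs.
by apply/lin_mem/flatten_mapP; exists i; rewrite ?mem_enum.
Qed.
End FiniteHom.

Section CentralScalars.
Variables (R : comPzRingType) (S : pzRingType) (psi : {rmorphism R -> S}).
Hypothesis psiC : forall r a, psi r * a = a * psi r.
Hypotheses (Sfin : fin_gen (resc psi S^o)) (Rn : noetherian R).

Section Action.
Variable T : lmodType S.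
Definition cscale (r : R) (x : T) : T := psi r *: x.
Lemma cscale_linear r : linear (cscale r).
Proof. by move=> a x y; rewrite /cscale scalerDr !scalerA psiC. Qed.
HB.instance Definition _ r := GRing.isLinear.Build S T T _ (cscale r) (cscale_linear r).
(** The structure map through which the endomorphism ring becomes an R-algebra; commutativity of R
    absorbs the reversed product of [(End T)^c]. *)
Definition cend (r : R) : (End T)^c := (cscale r : End T).
Lemma cendB : zmod_morphism cend.
Proof. by move=> r s; apply: Hom_ext => x; rewrite /= /cscale rmorphB scalerBl. Qed.
Lemma cendM : monoid_morphism cend.
Proof.
split=> [|r s]; apply: Hom_ext => x; rewrite /= /cscale ?rmorph1 ?scale1r //.
by rewrite mulrC rmorphM scalerA.
Qed.
HB.instance Definition _ := GRing.isZmodMorphism.Build R (End T)^c cend cendB.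
HB.instance Definition _ := GRing.isMonoidMorphism.Build R (End T)^c cend cendM.
End Action.

Lemma cend_comm (M N : lmodType S) (h : {linear M -> N}) r x :
  h ((cend M r : End M) x) = (cend N r : End N) (h x).
Proof. exact: linearZ. Qed.

(** Evaluation at n generators of T embeds Hom(T, M) R-linearly into M^n, which is finitely
    generated over the noetherian ring R. *)
Lemma fin_gen_Hom_resc (T M : lmodType S) : fin_gen T -> fin_gen M ->
  fin_gen (resc (cend T) (Hom T M)).
Proof.
move=> [n [v vP]] /(fin_gen_resc Sfin)/(@fin_gen_pow _ _ n) Mf.
pose ev (h : resc (cend T) (Hom T M)) : 'I_n -> resc psi M := fun i => (h : Hom T M) (v i).
have ev_lin : linear ev.
  move=> r h k; apply/funext => i; rewrite /ev.
  exact: (congr1 (+%R^~ _) (cend_comm (h : Hom T M) r (v i))).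
pose ev' : {linear resc (cend T) (Hom T M) -> ('I_n -> resc psi M)} :=
  HB.pack_for {linear resc (cend T) (Hom T M) -> ('I_n -> resc psi M)} ev
  (GRing.isLinear.Build R (resc (cend T) (Hom T M)) ('I_n -> resc psi M) _ ev ev_lin).
apply: (noetherian_inj (f := ev')) => //; apply: lin_inj => h h0.
apply: Hom_ext => x; have [c ->] := vP x.
rewrite linear_sum big1 // => i _; rewrite linearZ /=.
by rewrite [X in _ *: X](congr1 (fun u => u i) h0) scaler0.
Qed.

Lemma fin_gen_of_resc (Q : pzRingType) (rho : {rmorphism R -> Q}) (M : lmodType Q) :
  fin_gen (resc rho M) -> fin_gen M.
Proof.
by move=> /fin_genP[s sP]; apply/fin_genP; exists s => x; apply: (lin_resc (psi := rho)).
Qed.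

Lemma fin_gen_Hom (T M : lmodType S) : fin_gen T -> fin_gen M -> fin_gen (Hom T M).
Proof. by move=> Tf Mf; apply/fin_gen_of_resc/fin_gen_Hom_resc. Qed.

Lemma noetherian_End (T : lmodType S) : fin_gen T -> noetherian (End T)^c.
Proof.
move=> Tf; apply: (noetherian_resc (psi := cend T)) => //.
exact: (fin_gen_Hom_resc Tf Tf).
Qed.

(** The scalar r acts on Ext^1 through [fmap], which moves basis elements, whereas [cscale]
    multiplies coefficients. Both lift the same endomorphism of T, so they differ by a map from the
    free module into the syzygies. *)
Lemma Ext1_pi_cend (T M : lmodType S) (h : Hom (syz T) M) r :
  cend T r *: Ext1_pi h = Ext1_pi (Hom_comp h (cscale r)).
Proof.
rewrite [LHS]Ext1_scaleE; apply/Ext1_pi_eq.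
have [|D DP] := factor_inj (h := fmap S (cend T r : End T) \- cscale r)
    (@syz_incl_inj _ T).
  move=> x; apply: syz_of; rewrite /= linearB /= feval_fmap.
  by rewrite (cend_comm (feval T)) subrr.
exists (Hom_comp h D) => k /=; rewrite -linearB; congr (h _); apply: syz_incl_inj.
by rewrite DP linearB.
Qed.

(** Composition with a makes Ext^1(T, M) a quotient of Hom(P1, M): h and h b a have the same class,
    since their difference h s extends to the free module. *)
Lemma fin_gen_Ext1 (T M : lmodType S) : pd_le1 T -> fin_gen M -> fin_gen (Ext1 T M).
Proof.
move=> /pd_le1_syz[P1 [P1f _ [a [b [s kE]]]]] Mf.
apply: (@fin_gen_of_resc _ (cend T)).
pose f (h : resc (cend P1) (Hom P1 M)) : resc (cend T) (Ext1 T M) :=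
  Ext1_pi (Hom_comp (h : Hom P1 M) a).
have f_lin : linear f.
  move=> r h k.
  have -> : r *: f h = Ext1_pi (Hom_comp (Hom_comp (h : Hom P1 M) a) (cscale r)).
    exact: (Ext1_pi_cend (Hom_comp (h : Hom P1 M) a) r).
  rewrite /f -[RHS]raddfD; congr Ext1_pi; apply: Hom_ext => x /=.
  congr (_ + _); exact: (congr1 (h : Hom P1 M) (esym (cend_comm a r x))).
pose f' := HB.pack_for {linear resc (cend P1) (Hom P1 M) -> resc (cend T) (Ext1 T M)} f
  (GRing.isLinear.Build R _ _ _ f f_lin).
apply: (fin_gen_surj (f := f') _ (fin_gen_Hom_resc P1f Mf)) => q.
have [h <-] := Ext1_pi_surj q; exists (Hom_comp h b); apply/Ext1_pi_eq.
exists (- Hom_comp h s) => k /=; rewrite [in X in _ - X](kE k) linearD opprD.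
by rewrite addrCA subrr addr0.
Qed.
End CentralScalars.

(** * The sequences of Hom and Ext *)

Section ArtinFiniteness.
Variables (A : pzRingType) (T : lmodType A^c).
Hypotheses (Aart : artin_algebra A) (Tf : fin_gen T) (Tpd : pd_le1 T).

Lemma artin_scalars : exists (R : comPzRingType) (psi : {rmorphism R -> A^c}),
  [/\ forall r a, psi r * a = a * psi r, fin_gen (resc psi (A^c)^o) & noetherian R].
Proof.
have [R [phi [Rart phiC [n [v vP]]]]] := Aart.
pose p : R -> A^c := phi.
have pB : zmod_morphism p := raddfB phi.
have pM : monoid_morphism p.
  split=> [|r s]; first exact: (rmorph1 phi).
  by rewrite /p mulrC rmorphM.
pose psi : {rmorphism R -> A^c} := HB.pack_for {rmorphism R -> A^c} p
  (GRing.isZmodMorphism.Build R A^c p pB) (GRing.isMonoidMorphism.Build R A^c p pM).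
exists R, psi; split; last exact: artinian_noetherian.
  by move=> r a; exact: (esym (phiC r (a : A))).
exists n, v => a; have [c cE] := vP a; exists c.
rewrite {1}cE; apply: eq_bigr => i _; exact: phiC.
Qed.

Lemma artin_finiteness :
  [/\ noetherian A^c, noetherian (End T)^c,
      forall M : lmodType A^c, fin_gen M -> fin_gen (Hom T M)
    & forall M : lmodType A^c, fin_gen M -> fin_gen (Ext1 T M)].
Proof.
have [R [psi [psiC Af Rn]]] := artin_scalars; split.
- exact: (noetherian_resc Af).
- exact: (noetherian_End psiC Af).
- by move=> M; apply: (fin_gen_Hom psiC Af).
- by move=> M; apply: (fin_gen_Ext1 psiC Af).
Qed.
End ArtinFiniteness.

Section HomExt.
Variables (S : pzRingType) (T : lmodType S).

Lemma Ext1_pi_eq0 (M : lmodType S) (h : Hom (syz T) M) : (Ext1_pi h = 0) <->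
  (exists g : Hom (freem S T) M, forall k, h k = g (syz_incl T k)).
Proof.
rewrite -[0](raddf0 (@Ext1_pi S T M)) Ext1_pi_eq.
by split=> -[g gP]; exists g => k; move: (gP k); rewrite /= subr0.
Qed.

Lemma Ext1_zeroP (M : lmodType S) : zero_module (Ext1 T M) <->
  forall h : {linear syz T -> M}, exists g : {linear freem S T -> M},
    forall k, g (syz_incl T k) = h k.
Proof.
split=> [E0 h|E0 q].
  by have /Ext1_pi_eq0[g gP] := E0 (Ext1_pi h); exists g => k; rewrite gP.
have [h <-] := Ext1_pi_surj q; apply/Ext1_pi_eq0.
by have [g gP] := E0 h; exists g => k; rewrite gP.
Qed.

Lemma Hom_map_inj (M N : lmodType S) (f : {linear M -> N}) :
  injective f -> injective (Hom_map T f).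
Proof.
move=> fi h k hk; apply: Hom_ext => x; apply: fi.
exact: (congr1 (fun u : Hom T N => u x) hk).
Qed.

Lemma Ext1_mapE (M N : lmodType S) (f : {linear M -> N}) h :
  Ext1_map T f (Ext1_pi h) = Ext1_pi (Hom_comp f h).
Proof. exact: Ext1_funE. Qed.

Section Sequence.
Variables (L M N : lmodType S) (f : {linear L -> M}) (g : {linear M -> N}).
Hypothesis fg : short_exact f g.

Lemma short_exact_comp0 x : g (f x) = 0.
Proof. by have [_ ker _] := fg; apply/ker; exists x. Qed.

Lemma short_factor (P : lmodType S) (h : {linear P -> M}) : (forall x, g (h x) = 0) ->
  exists k : {linear P -> L}, forall x, f (k x) = h x.
Proof.
have [fi ker _] := fg => gh; apply: (factor_inj fi) => x.
by have [y] := (ker (h x)).1 (gh x); exists y.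
Qed.

Lemma Hom_map_exact h : Hom_map T g h = 0 <-> exists h', Hom_map T f h' = h.
Proof.
split=> [gh|[h' <-]]; last by apply: Hom_ext => x /=; rewrite short_exact_comp0.
have [|k kP] := short_factor (h := h).
  by move=> x; exact: (congr1 (fun u : Hom T N => u x) gh).
by exists k; apply: Hom_ext.
Qed.

Lemma Hom_connect : exists d : {linear Hom T N -> Ext1 T L},
  [/\ forall h, d h = 0 <-> exists h', Hom_map T g h' = h,
      forall q, Ext1_map T f q = 0 <-> exists h, d h = q
    & forall (h : Hom T N) (l : {linear freem S T -> M}) (m : {linear syz T -> L}),
        (forall x, g (l x) = h (feval T x)) -> (forall k, f (m k) = l (syz_incl T k)) ->
        d h = Ext1_pi m].
Proof.
have [fi ker gs] := fg.
pose P (h : Hom T N) (q : Ext1 T L) :=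
  exists (l : {linear freem S T -> M}) (m : {linear syz T -> L}),
  [/\ forall x, g (l x) = h (feval T x), forall k, f (m k) = l (syz_incl T k)
    & q = Ext1_pi m].
have PD (b : (End T)^c) h q h' q' : P h q -> P h' q' -> P (b *: h + h') (b *: q + q').
  move=> [l [m [lP mP ->]]] [l' [m' [lP' mP' ->]]].
  exists (l \o fmap S (b : End T) \+ l'), (m \o syz_map (b : End T) \+ m'); split.
  - by move=> x; rewrite /= linearD lP lP' feval_fmap.
  - by move=> k; rewrite /= linearD mP mP' syz_mapE.
  - by rewrite [b *: _]Ext1_scaleE -[LHS]raddfD; congr Ext1_pi; apply: Hom_ext.
have P0 q : P 0 q -> q = 0.
  move=> [l [m [lP mP ->]]]; have [|n nP] := short_factor (h := l) _.
    by move=> x; rewrite lP.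
  by apply/Ext1_pi_eq0; exists n => k; apply: fi; rewrite nP mP.
have Pex h : exists q, P h q.
  have [l lP] := flift_lift (h \o feval T) gs.
  have [|m mP] := short_factor (h := l \o syz_incl T).
    by move=> k; rewrite /= lP /= feval_syz linear0.
  by exists (Ext1_pi m), l, m.
have [d dP] := lin_of_rel PD Pex P0.
have dE h q : P h q -> d h = q.
  move=> hq; apply/eqP; rewrite -subr_eq0 addrC; apply/eqP; apply: P0.
  by have := PD (-1) _ _ _ _ hq (dP h); rewrite !scaleN1r addNr.
exists d; split.
- move=> h; split=> [dh|[h' <-]].
    have [l [m [lP mP mE]]] := dP h; rewrite dh in mE.
    have /Ext1_pi_eq0[n nP] := esym mE.
    (* Since n extends m, the map l - f n kills the syzygies and descends to a map T -> M lifting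
       h. *)
    have [|k kP] := factor_surj (h := l \- (f \o n)) (@feval_surj _ T).
      by move=> x /syz_of[k <-] /=; rewrite -nP mP subrr.
    exists k; apply: Hom_ext => t; have [x <-] := feval_surj t.
    by rewrite /= kP /= linearB short_exact_comp0 subr0 lP.
  apply: dE; exists (h' \o feval T), \0; split=> //.
    by move=> k; rewrite /= linear0 feval_syz linear0.
  by apply/esym/Ext1_pi_eq0; exists 0.
- move=> q; split=> [fq|[h <-]]; last first.
    have [l [m [lP mP ->]]] := dP h.
    by rewrite Ext1_mapE; apply/Ext1_pi_eq0; exists l => k /=; rewrite mP.
  have [m qE] := Ext1_pi_surj q; rewrite -qE in fq *.
  rewrite Ext1_mapE in fq; have /Ext1_pi_eq0[l lP] := fq.
  have [|h hP] := factor_surj (h := g \o l) (@feval_surj _ T).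
    by move=> x /syz_of[k <-] /=; rewrite -lP /= short_exact_comp0.
  by exists h; apply: dE; exists l, m; split=> // k; rewrite -lP.
- by move=> h l m lP mP; apply: dE; exists l, m.
Qed.

Lemma Hom_map_surj : zero_module (Ext1 T L) -> surj (Hom_map T g).
Proof. by have [d [dg _ _]] := Hom_connect => L0 h; apply/dg. Qed.

Lemma Ext1_map_inj : zero_module (Hom T N) -> injective (Ext1_map T f).
Proof.
have [d [_ df _]] := Hom_connect => N0; apply: lin_inj => q /df[h <-].
by rewrite (N0 h) linear0.
Qed.

Lemma Ext1_map_exact q : Ext1_map T g q = 0 <-> exists q', Ext1_map T f q' = q.
Proof.
have [fi ker gs] := fg; split=> [|[q' <-]]; last first.
  have [h <-] := Ext1_pi_surj q'; rewrite !Ext1_mapE; apply/Ext1_pi_eq0.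
  by exists 0 => k /=; rewrite short_exact_comp0.
have [h <-] := Ext1_pi_surj q; rewrite Ext1_mapE => /Ext1_pi_eq0[l lP].
have [m mP] := flift_lift l gs.
have [|k kP] := short_factor (h := h \- (m \o syz_incl T)).
  by move=> k; rewrite /= linearB mP -lP subrr.
exists (Ext1_pi k); rewrite Ext1_mapE; apply/Ext1_pi_eq; exists (- (m : Hom _ _)) => x.
by rewrite /= kP /= addrAC subrr add0r.
Qed.

Lemma Ext1_zero_mid : zero_module (Ext1 T L) -> zero_module (Ext1 T N) ->
  zero_module (Ext1 T M).
Proof.
move=> L0 N0 q; have /Ext1_map_exact[q' <-] : Ext1_map T g q = 0 by apply: N0.
by rewrite (L0 q') linear0.
Qed.
End Sequence.

Lemma Ext1_map_surj (M N : lmodType S) (g : {linear M -> N}) :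
  projective (syz T) -> surj g -> surj (Ext1_map T g).
Proof.
move=> Tp gs q; have [h <-] := Ext1_pi_surj q; have [k kP] := Tp _ _ g h gs.
by exists (Ext1_pi k); rewrite Ext1_mapE; congr Ext1_pi; apply: Hom_ext.
Qed.

Lemma Ext1_zero_pow (M : lmodType S) n : zero_module (Ext1 T M) ->
  zero_module (Ext1 T ('I_n -> M)).
Proof.
move=> /Ext1_zeroP M0; apply/Ext1_zeroP => h.
have /choice[g gP] : forall i : 'I_n, exists g : {linear freem S T -> M},
  forall k, g (syz_incl T k) = (@pow_proj S M n i \o h) k by move=> i; apply: M0.
exists (pow_pair g) => k.
by apply/funext => i; exact: (gP i k).
Qed.

(* Equivalently, u and v exhibit N as a direct summand of the q-th power of T. *)
Definition dual_basis (N : lmodType S) q (u : 'I_q -> {linear N -> T})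
    (v : 'I_q -> {linear T -> N}) := forall x, \sum_(j < q) v j (u j x) = x.

(** This is Ext^1(N, M) = 0 for N in add T, in terms of maps. Each x in E is a sum of values of the
    lifts l_j plus some f a; its image is prescribed by n_j and h. The ambiguity consists of
    syzygies, on which n_j agrees with h m_j. *)
Lemma extend_along (L E N M : lmodType S) (f : {linear L -> E}) (g : {linear E -> N})
    q (u : 'I_q -> {linear N -> T}) (v : 'I_q -> {linear T -> N}) (h : {linear L -> M}) :
  short_exact f g -> dual_basis u v -> zero_module (Ext1 T M) ->
  exists k : {linear E -> M}, forall x, k (f x) = h x.
Proof.
move=> fg uv /Ext1_zeroP M0; have [fi ker gs] := fg.
have /choice[l lP] : forall j, exists l : {linear freem S T -> E},
  forall x, g (l x) = (v j \o feval T) x by move=> j; apply: flift_lift.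
have /choice[m mP] : forall j, exists m : {linear syz T -> L},
    forall k, f (m k) = (l j \o syz_incl T) k.
  by move=> j; apply: (short_factor fg) => k; rewrite /= lP /= feval_syz linear0.
have /choice[n nP] : forall j, exists n : {linear freem S T -> M},
  forall k, n (syz_incl T k) = (h \o m j) k by move=> j; apply: M0.
pose P (x : E) (z : M) := exists (p : 'I_q -> freem S T) (a : L),
  [/\ forall j, feval T (p j) = u j (g x), x = \sum_j l j (p j) + f a
    & z = \sum_j n j (p j) + h a].
have PD c x z x' z' : P x z -> P x' z' -> P (c *: x + x') (c *: z + z').
  move=> [p [a [pP xE zE]]] [p' [a' [pP' xE' zE']]].
  exists (fun j => c *: p j + p' j), (c *: a + a'); split.
  - by move=> j; rewrite !linearP pP pP'.
  - rewrite {1}xE {1}xE' scalerDr addrACA scaler_sumr -big_split linearP; congr (_ + _).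
    by apply: eq_bigr => j _; rewrite linearP.
  - rewrite zE zE' scalerDr addrACA scaler_sumr -big_split linearP; congr (_ + _).
    by apply: eq_bigr => j _; rewrite linearP.
have P0 z : P 0 z -> z = 0.
  move=> [p [a [pP xE ->]]].
  have /choice[k kP] : forall j, exists k, syz_incl T k = p j.
    by move=> j; apply: syz_of; rewrite pP !linear0.
  have aE : a = - \sum_j m j (k j).
    apply: fi; apply/eqP; rewrite linearN linear_sum -addr_eq0 addrC.
    by rewrite {2}xE; apply/eqP; congr (_ + _); apply: eq_bigr => j _; rewrite mP /= kP.
  rewrite aE linearN linear_sum /= -sumrB big1 // => j _.
  by rewrite -kP nP subrr.
have Pex x : exists z, P x z.
  pose p j := fdelta S (u j (g x)).
  have [|a aE] := (ker (x - \sum_j l j (p j))).1.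
    rewrite linearB linear_sum; apply/eqP; rewrite subr_eq0 -{1}[g x]uv; apply/eqP.
    by apply: eq_bigr => j _; rewrite lP /= feval_delta.
  exists (\sum_j n j (p j) + h a), p, a; split=> //; last by rewrite aE addrC subrK.
  by move=> j; rewrite feval_delta.
have [k kP] := lin_of_rel PD Pex P0; exists k => x.
apply/eqP; rewrite -subr_eq0 addrC -scaleN1r; apply/eqP; apply: P0.
rewrite -(addNr (f x)) -scaleN1r; apply: PD (kP _).
exists (fun=> 0), x.
by split; rewrite ?(short_exact_comp0 fg) ?big1 ?add0r // => j; rewrite !linear0.
Qed.
End HomExt.

(** * Tensor products *)

Section TensorLift.
Variables (S : pzRingType) (T : lmodType S) (X : lmodType (End T)^c).

Lemma tens_pure0l (t : T) : tens_pure (0 : X) t = 0.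
Proof. by apply: (addrI (tens_pure 0 t)); rewrite -tens_pureDl !addr0. Qed.
Lemma tens_pure0r (x : X) : tens_pure x (0 : T) = 0.
Proof. by apply: (addrI (tens_pure x 0)); rewrite -tens_pureDr !addr0. Qed.
Lemma tens_pureNl (x : X) (t : T) : tens_pure (- x) t = - tens_pure x t.
Proof. by apply: (addrI (tens_pure x t)); rewrite -tens_pureDl !subrr tens_pure0l. Qed.
Lemma tens_pureBl (x y : X) (t : T) :
  tens_pure (x - y) t = tens_pure x t - tens_pure y t.
Proof. by rewrite tens_pureDl tens_pureNl. Qed.
Lemma tens_pure_suml I (r : seq I) (P : pred I) (F : I -> X) (t : T) :
  tens_pure (\sum_(i <- r | P i) F i) t = \sum_(i <- r | P i) tens_pure (F i) t.
Proof.
elim/big_rec2: _ => [|i y z _ <-]; first exact: tens_pure0l.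
by rewrite tens_pureDl.
Qed.
Lemma tens_pure_sumr I (r : seq I) (P : pred I) (F : I -> T) (x : X) :
  tens_pure x (\sum_(i <- r | P i) F i) = \sum_(i <- r | P i) tens_pure x (F i).
Proof.
elim/big_rec2: _ => [|i y z _ <-]; first exact: tens_pure0r.
by rewrite tens_pureDr.
Qed.

Lemma tens_scaleE (a : S) (x : X) t : a *: tens_pure x t = tens_pure x (a *: t).
Proof. exact: tens_scale_pure. Qed.

Lemma tens_ind (P : tens X -> Prop) : P 0 ->
  (forall p q, P p -> P q -> P (p - q)) -> (forall x t, P (tens_pure x t)) -> forall q, P q.
Proof.
move=> P0 PB Pp q.
have PN p : P p -> P (- p) by move=> ?; rewrite -sub0r; apply: PB.
have PD p p' : P p -> P p' -> P (p + p').
  by move=> ? ?; rewrite -[p']opprK; apply: PB => //; apply: PN.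
have PM p n : P p -> P (p *+ n).
  by move=> Pp'; elim: n => [|n IH]; rewrite ?mulr0n // mulrS; apply: PD.
have [v <-] := tens_pi_surj q; have [s us vs] := fcoef_supp v.
rewrite (fdelta_sum us vs) raddf_sum; elim/big_ind: _ => // -[x t] _.
rewrite -[fcoef v (x, t)]intz scaler_int raddfMz.
by case: (fcoef v (x, t)) => n; [apply/PM/Pp | apply/PN/PM/Pp].
Qed.

Lemma tens_lift (V : zmodType) (b : X -> T -> V) :
  (forall x y t, b (x + y) t = b x t + b y t) ->
  (forall x t u, b x (t + u) = b x t + b x u) ->
  (forall x (c : End T) t, b ((c : (End T)^c) *: x) t = b x (c t)) ->
  exists h : {additive tens X -> V}, forall x t, h (tens_pure x t) = b x t.
Proof.
move=> bDl bDr bA.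
(* Viewing V as a module over the integers makes the universal property of the free module
   available. *)
pose h0 : {linear freem int (pairs X) -> zmodule V} :=
  flift (fun p : pairs X => b p.1 p.2 : zmodule V).
have h0E p : h0 (fdelta int p) = b p.1 p.2 by exact: flift_delta.
have hrel v : v \in @tens_rel S T X -> h0 v = 0.
  pose K0 : h0 0 = 0 := linear0 h0.
  have KD (a : int) (x y : freem int (pairs X)) : h0 x = 0 -> h0 y = 0 -> h0 (a *: x + y) = 0.
    by rewrite linearP => -> ->; rewrite scaler0 addr0.
  have KB : zmod_closed (mksub K0 KD : {pred _}).
    by split=> [|x y]; [exact: rpred0 | exact: submodB].
  pose K : zmodClosed (freem int (pairs X)) := HB.pack_for (zmodClosed (freem int (pairs X)))
    (mksub K0 KD : {pred _}) (GRing.isZmodClosed.Build _ _ KB).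
  move=> /asboolP/(_ K) h; apply/(mksubP K0 KD)/h => r rr; apply/mksubP.
  case: rr => [x x' t|x t t'|x c t]; rewrite linearB ?linearD !h0E /=.
  - rewrite bDl -opprD subrr //.
  - rewrite bDr -opprD subrr //.
  - by rewrite bA subrr.
pose h (q : tens X) : V := h0 (repr (q : Quotient.quot (@tens_rel S T X))).
have hE v : h (tens_pi v) = h0 v.
  apply/eqP; rewrite -subr_eq0; apply/eqP; rewrite -[LHS](linearB h0); apply: hrel.
  apply/zpi_eq; rewrite {1}/zpi; exact: (@reprK _ (Quotient.quot (@tens_rel S T X))).
have hB : zmod_morphism h.
  move=> p q; have [v <-] := tens_pi_surj p; have [w <-] := tens_pi_surj q.
  by rewrite -raddfB !hE; exact: (linearB h0).
exists (HB.pack_for {additive tens X -> V} h (GRing.isZmodMorphism.Build _ _ h hB)).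
by move=> x t; rewrite [LHS]hE h0E.
Qed.

Lemma tens_lift_linear (N : lmodType S) (b : X -> T -> N) :
  (forall x y t, b (x + y) t = b x t + b y t) ->
  (forall x a t u, b x (a *: t + u) = a *: b x t + b x u) ->
  (forall x (c : End T) t, b ((c : (End T)^c) *: x) t = b x (c t)) ->
  exists h : {linear tens X -> N}, forall x t, h (tens_pure x t) = b x t.
Proof.
move=> bDl bP bA; have bDr x t u : b x (t + u) = b x t + b x u.
  by rewrite -[t]scale1r bP !scale1r.
have b0 x : b x 0 = 0 by apply: (addrI (b x 0)); rewrite -bDr !addr0.
have bZ x a t : b x (a *: t) = a *: b x t by rewrite -[_ *: t]addr0 bP b0 addr0.
have [h hE] := tens_lift bDl bDr bA.
have hZ : scalable h.
  move=> a q; pose sa : {additive tens X -> tens X} := ( *:%R a).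
  pose sb : {additive N -> N} := ( *:%R a).
  apply: (@tens_ext S T X N (h \o sa) (sb \o h)) => x t /=.
  by rewrite /sa /sb /= tens_scaleE !hE bZ.
pose mh := GRing.isScalable.Build S (tens X) N _ h hZ.
pose ah := GRing.isZmodMorphism.Build (tens X) N h (raddfB h).
by exists (HB.pack_for {linear tens X -> N} (h : tens X -> N) ah mh).
Qed.
End TensorLift.

Lemma tens_mapE (S : pzRingType) (T : lmodType S) (X Y : lmodType (End T)^c)
  (f : {linear X -> Y}) x t : tens_map f (tens_pure x t) = tens_pure (f x) t.
Proof. exact: tens_fun_pure. Qed.

Lemma tens_map_surj (S : pzRingType) (T : lmodType S) (X Y : lmodType (End T)^c)
  (f : {linear X -> Y}) : surj f -> surj (tens_map f).
Proof.
move=> fs; apply: tens_ind => [|_ _ [p <-] [p' <-]|y t].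
- by exists 0; rewrite linear0.
- by exists (p - p'); rewrite linearB.
by have [x <-] := fs y; exists (tens_pure x t); rewrite tens_mapE.
Qed.

(** * Coordinates for the tensor product and Tor *)

(** The module structure written as a right action of [End T] itself, so that successive actions
    compose in reading order. *)
Definition act (S : pzRingType) (T : lmodType S) (X : lmodType (End T)^c)
  (x : X) (b : End T) : X := (b : (End T)^c) *: x.

Section Action.
Variables (S : pzRingType) (T : lmodType S) (X : lmodType (End T)^c).
Implicit Types (x : X) (b c : End T).
Lemma actA x b c : act (act x b) c = act x (b \o c).
Proof. by rewrite /act scalerA. Qed.
Lemma act_sumr I (r : seq I) (P : pred I) (F : I -> End T) x :
  act x (\sum_(i <- r | P i) F i) = \sum_(i <- r | P i) act x (F i).
Proof. exact: (@scaler_suml _ X x I r P F). Qed.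
Lemma act_suml I (r : seq I) (P : pred I) (F : I -> X) b :
  act (\sum_(i <- r | P i) F i) b = \sum_(i <- r | P i) act (F i) b.
Proof. exact: scaler_sumr. Qed.
Lemma actDl x x' b : act (x + x') b = act x b + act x' b. Proof. exact: scalerDr. Qed.
Lemma actBl x x' b : act (x - x') b = act x b - act x' b. Proof. exact: scalerBr. Qed.
Lemma actBr x b c : act x (b - c) = act x b - act x c. Proof. exact: (@scalerBl _ X). Qed.
Lemma tens_act x b t : tens_pure (act x b) t = tens_pure x (b t).
Proof. exact: tens_pureA. Qed.
Lemma act_map (Y : lmodType (End T)^c) (h : {linear X -> Y}) x b : h (act x b) = act (h x) b.
Proof. exact: linearZ. Qed.
End Action.

Section Coordinates.
Variables (S : pzRingType) (T T1 T2 : lmodType S).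
Variables (f : {linear S^o -> T1}) (g : {linear T1 -> T2}).
Variables (p : nat) (u : 'I_p -> {linear T1 -> T}) (v : 'I_p -> {linear T -> T1}).
Variables (q : nat) (u2 : 'I_q -> {linear T2 -> T}) (v2 : 'I_q -> {linear T -> T2}).
Hypotheses (fg : short_exact f g) (uv : dual_basis u v) (uv2 : dual_basis u2 v2).
Hypothesis TT : zero_module (Ext1 T T).

Let e : T1 := f 1.
(** These points generate T over [End T]: any t is h(e) for some h : T1 -> T, hence the sum of the
    (h v_i)(u_i e). *)
Definition gen (i : 'I_p) : T := u i e.

(** The map 1 |-> m from the regular module extends along f, because T2 lies in add T and Ext^1(T,
    M) = 0. *)
Lemma extend_point (M : lmodType S) (m : M) : zero_module (Ext1 T M) ->
  exists h : {linear T1 -> M}, h e = m.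
Proof.
move=> M0; pose a (x : S^o) : M := (x : S) *: m.
have a_lin : linear a by move=> c x y; rewrite /a scalerDl -scalerA.
pose a' : {linear S^o -> M} :=
  HB.pack_for {linear S^o -> M} a (GRing.isLinear.Build S S^o M _ a a_lin).
have [h hP] := extend_along a' fg uv2 M0; exists h.
by rewrite hP; exact: scale1r.
Qed.

Lemma g_point0 : g e = 0. Proof. exact: (short_exact_comp0 fg). Qed.

(** The kernel of g is the image of f, which is generated by the single element e. *)
Lemma factor_point (M : lmodType S) (h : {linear T1 -> M}) : h e = 0 ->
  exists k : {linear T2 -> M}, forall x, k (g x) = h x.
Proof.
have [fi ker gs] := fg => he; apply: (factor_surj gs) => x /ker[a <-].
have -> : f a = (a : S) *: e.
  by rewrite /e -(linearZ_LR f); congr (f _); exact: (esym (mulr1 (a : S))).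
by rewrite linearZ_LR he scaler0.
Qed.

Section OneModule.
Variable X : lmodType (End T)^c.
Implicit Types (x : 'I_p -> X) (y : 'I_q -> X).

(* X (x)_B T is the cokernel, and Tor_1^B(X, T) the kernel, of dmap from the
   image of proj2 to the image of proj1. *)
Definition dmap y : 'I_p -> X := fun i => \sum_j act (y j) (u2 j \o g \o v i).
Definition proj1 x : 'I_p -> X := fun i => \sum_k act (x k) (u k \o v i).
Definition proj2 y : 'I_q -> X := fun j => \sum_l act (y l) (u2 l \o v2 j).

Lemma dmap_proj2 y : dmap (proj2 y) = dmap y.
Proof.
apply/funext => i; rewrite /dmap /proj2.
under eq_bigr do rewrite act_suml.
rewrite exchange_big; apply: eq_bigr => l _.
under eq_bigr do rewrite actA.
rewrite -act_sumr; congr act; apply: Hom_ext => t; rewrite Hom_sumE /=.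
by rewrite -[in RHS](uv2 (g (v i t))) linear_sum.
Qed.

Lemma proj1_dmap y : proj1 (dmap y) = dmap y.
Proof.
apply/funext => i; rewrite /dmap /proj1.
under eq_bigr do rewrite act_suml.
rewrite exchange_big; apply: eq_bigr => l _.
under eq_bigr do rewrite actA.
rewrite -act_sumr; congr act; apply: Hom_ext => t; rewrite Hom_sumE /=.
by rewrite -[in RHS](uv (v i t)) !linear_sum.
Qed.

Lemma proj1K x : proj1 (proj1 x) = proj1 x.
Proof.
apply/funext => i; rewrite {1 3}/proj1.
under eq_bigr do rewrite /proj1 act_suml.
rewrite exchange_big; apply: eq_bigr => l _.
under eq_bigr do rewrite actA.
rewrite -act_sumr; congr act; apply: Hom_ext => t; rewrite Hom_sumE /=.
by rewrite -[in RHS](uv (v i t)) linear_sum.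
Qed.

Lemma proj2K y : proj2 (proj2 y) = proj2 y.
Proof.
apply/funext => i; rewrite {1 3}/proj2.
under eq_bigr do rewrite /proj2 act_suml.
rewrite exchange_big; apply: eq_bigr => l _.
under eq_bigr do rewrite actA.
rewrite -act_sumr; congr act; apply: Hom_ext => t; rewrite Hom_sumE /=.
by rewrite -[in RHS](uv2 (v2 i t)) linear_sum.
Qed.

Lemma dmapB y y' : dmap (y - y') = dmap y - dmap y'.
Proof.
apply/funext => i; rewrite /dmap !fctE -sumrB.
by apply: eq_bigr => j _; rewrite fctE actBl.
Qed.
Lemma dmap0 : dmap 0 = 0. Proof. by rewrite -(subrr 0) dmapB subrr. Qed.
Lemma proj2B y y' : proj2 (y - y') = proj2 y - proj2 y'.
Proof.
apply/funext => i; rewrite /proj2 !fctE -sumrB.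
by apply: eq_bigr => j _; rewrite fctE actBl.
Qed.

(** The augmentation of the two-term complex: in coordinates, X tensored with the evaluation Hom(T1,
    T) -> T at e. *)
Definition wsum x : tens X := \sum_i tens_pure (x i) (gen i).

Lemma wsumB x x' : wsum (x - x') = wsum x - wsum x'.
Proof. by rewrite /wsum -sumrB; apply: eq_bigr => i _; rewrite -tens_pureBl. Qed.

Lemma wsum0 : wsum 0 = 0. Proof. by rewrite -(subrr 0) wsumB subrr. Qed.

Lemma wsum_proj1 x : wsum (proj1 x) = wsum x.
Proof.
rewrite /wsum /proj1.
under eq_bigr do rewrite tens_pure_suml.
rewrite exchange_big; apply: eq_bigr => k _.
under eq_bigr do rewrite tens_act.
rewrite -tens_pure_sumr; congr tens_pure.
by rewrite /gen -[in RHS](uv e) linear_sum.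
Qed.

Lemma wsum_dmap y : wsum (dmap y) = 0.
Proof.
rewrite /wsum /dmap.
under eq_bigr do rewrite tens_pure_suml.
rewrite exchange_big big1 // => k _.
under eq_bigr do rewrite tens_act.
rewrite -tens_pure_sumr -[RHS](tens_pure0r (y k)); congr tens_pure.
transitivity (u2 k (g (\sum_i v i (u i e)))); first by rewrite !linear_sum.
by rewrite uv g_point0 linear0.
Qed.

Lemma wsum_surj z : exists2 x, proj1 x = x & wsum x = z.
Proof.
suff [x <-] : exists x, wsum x = z by exists (proj1 x); rewrite ?proj1K ?wsum_proj1.
elim/tens_ind: z => [|_ _ [x <-] [x' <-]|x t].
- by exists 0; rewrite wsum0.
- by exists (x - x'); rewrite wsumB.
have [h hP] := extend_point t TT.
exists (fun i => act x (h \o v i)); rewrite /wsum.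
under eq_bigr do rewrite tens_act.
rewrite -tens_pure_sumr; congr tens_pure.
by rewrite -[RHS]hP -[in RHS](uv e) linear_sum.
Qed.

(** An inverse on the cokernel of [dmap] sends x (x) t to the tuple of the x (h v_i), for any h : T1
    -> T with h(e) = t. By [factor_point], two choices of h differ by a map through g, that is, by a
    boundary. Following [wsum] with this inverse gives the class of [proj1 x]. *)
Lemma wsum_eq0 x : wsum x = 0 -> exists2 y, proj2 y = y & proj1 x = dmap y.
Proof.
pose J : {pred ('I_p -> X)} := fun x => `[< exists y, x = dmap y >].
have JB : zmod_closed J.
  split; first by apply/asboolP; exists 0; rewrite dmap0.
  by move=> _ _ /asboolP[y ->] /asboolP[y' ->]; apply/asboolP; exists (y - y'); rewrite dmapB.
pose Jc : zmodClosed ('I_p -> X) := HB.pack_for (zmodClosed ('I_p -> X)) J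
  (GRing.isZmodClosed.Build _ _ JB).
pose al (x : X) (h : {linear T1 -> T}) : 'I_p -> X := fun i => act x (h \o v i).
have alE (x0 : X) (h h' : {linear T1 -> T}) : h e = h' e -> zpi Jc (al x0 h) = zpi Jc (al x0 h').
  move=> hh'; apply/zpi_eq/asboolP.
  have [|k kP] := factor_point (h := h \- h'); first by rewrite /= hh' subrr.
  exists (fun j => act x0 (k \o v2 j)); apply/funext => i; rewrite /al /dmap !fctE -actBr.
  under eq_bigr do rewrite actA.
  rewrite -act_sumr; congr act; apply: Hom_ext => t.
  rewrite Hom_sumE -[LHS](kP (v i t)) -[in LHS](uv2 (g (v i t))) linear_sum.
  by [].
have /choice[phi phiP] : forall t, exists h : {linear T1 -> T}, h e = t.
  by move=> t; exact: extend_point.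
pose b (x0 : X) t := zpi Jc (al x0 (phi t)).
have [||| th thP] := tens_lift (b := b).
- move=> x1 x2 t; rewrite /b -raddfD; congr (zpi Jc _); apply/funext => i.
  by rewrite /al actDl.
- move=> x1 t t'; rewrite {1}/b (alE _ _ (phi t \+ phi t')); last by rewrite /= !phiP.
  rewrite /b -raddfD; congr (zpi Jc _); apply/funext => i.
  rewrite /al !fctE -(@scalerDl _ X); congr (_ *: _); exact: Hom_ext.
- move=> x1 c t; rewrite [RHS](alE _ _ ((c : {linear T -> T}) \o phi t)); last first.
    by rewrite /= !phiP.
  congr (zpi Jc _); apply/funext => i; rewrite /al -[(c : (End T)^c) *: x1]/(act x1 c) actA.
  by congr act; exact: Hom_ext.
have thw (x1 : 'I_p -> X) : th (wsum x1) = zpi Jc (proj1 x1).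
  rewrite /wsum raddf_sum.
  transitivity (\sum_i zpi Jc (al (x1 i) (u i))).
    by apply: eq_bigr => i _; rewrite thP; apply: alE; rewrite phiP.
  rewrite -raddf_sum; congr (zpi Jc _); apply/funext => i.
  by rewrite fct_sumE.
move=> w0; have /zpi_eq0/asboolP[y yE] : zpi Jc (proj1 x) = 0 by rewrite -thw w0 raddf0.
by exists (proj2 y); rewrite ?proj2K // dmap_proj2.
Qed.

Definition dker y : Prop := proj2 y = y /\ dmap y = 0.
End OneModule.

Section Naturality.
Variables (X Y : lmodType (End T)^c) (h : {linear X -> Y}).
Lemma dmap_nat y : dmap (h \o y) = h \o dmap y.
Proof.
by apply/funext => i; rewrite /dmap /= linear_sum; apply: eq_bigr => j _; rewrite act_map.
Qed.
Lemma proj1_nat y : proj1 (h \o y) = h \o proj1 y.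
Proof.
by apply/funext => i; rewrite /proj1 /= linear_sum; apply: eq_bigr => j _; rewrite act_map.
Qed.
Lemma proj2_nat y : proj2 (h \o y) = h \o proj2 y.
Proof.
by apply/funext => i; rewrite /proj2 /= linear_sum; apply: eq_bigr => j _; rewrite act_map.
Qed.
Lemma wsum_nat x : tens_map h (wsum x) = wsum (h \o x).
Proof. by rewrite /wsum linear_sum; apply: eq_bigr => i _; rewrite tens_mapE. Qed.
Lemma comp_lin0 (n : nat) : h \o (0 : 'I_n -> X) = 0.
Proof. by apply/funext => i; rewrite /= linear0. Qed.
Lemma comp_linB (n : nat) (y y' : 'I_n -> X) : h \o (y - y') = (h \o y) - (h \o y').
Proof. by apply/funext => i; rewrite /= linearB. Qed.
Lemma dker_nat y : dker y -> dker (h \o y).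
Proof. by move=> [yE dy]; split; rewrite ?proj2_nat ?yE // dmap_nat dy comp_lin0. Qed.
End Naturality.

(** A cycle y defines the map sum_j y_j u2_j from T2 to M. The cycle condition says that it vanishes
    after g, and g is surjective. *)
Lemma dker_Hom (M : lmodType S) (y : 'I_q -> Hom T M) : dker y -> y = 0.
Proof.
move=> [yE dy]; have [_ _ gs] := fg.
have ug x : \sum_j y j (u2 j (g x)) = 0.
  rewrite -(uv x) !linear_sum.
  under eq_bigr do rewrite !linear_sum.
  rewrite exchange_big big1 // => i _.
  have := congr1 (fun z : 'I_p -> Hom T M => z i (u i x)) dy.
  by rewrite /dmap /= Hom_sumE.
rewrite -yE; apply/funext => l; apply: Hom_ext => t; rewrite /proj2 Hom_sumE /=.
by have [x xE] := gs (v2 l t); have := ug x; rewrite xE.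
Qed.

Definition fcoord (X : choiceType) (x0 : X) (a : freem (End T)^c X) : Hom T T := fcoef a x0.
Lemma fcoord_linear (X : choiceType) (x0 : X) : linear (fcoord x0).
Proof. by move=> b a a'; rewrite /fcoord /fcoef linearP. Qed.
HB.instance Definition _ (X : choiceType) (x0 : X) := GRing.isLinear.Build (End T)^c
  (freem (End T)^c X) (Hom T T) _ (fcoord x0) (fcoord_linear x0).

(** Each coefficient is a linear map into Hom(T, T), which reduces the claim to [dker_Hom]. *)
Lemma dker_freem (X : choiceType) (y : 'I_q -> freem (End T)^c X) : dker y -> y = 0.
Proof.
move=> ky; apply/funext => j; apply: val_inj; apply/funext => x0.
have := dker_Hom (dker_nat (fcoord x0) ky).
by move=> /(congr1 (fun z : 'I_q -> Hom T T => z j)).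
Qed.

Section TorCoordinates.
Variable X : lmodType (End T)^c.

(** The zigzag behind the balance of Tor: z is [wsum k] over the syzygies, it dies over the free
    module, so k becomes a boundary [dmap y'] there, and y is the image of y' in X. A relation is
    used because k and y' are choices. *)
Definition tor_coord (z : Tor1 X) (y : 'I_q -> X) : Prop :=
  exists (y' : 'I_q -> freem (End T)^c X) (k : 'I_p -> syz X),
  [/\ proj2 y' = y', syz_incl X \o k = dmap y', incl z = wsum k & y = feval X \o y'].

Lemma tor_coord_total z : exists y, tor_coord z y.
Proof.
have [k kE wk] := wsum_surj (incl z).
have : tens_map (syz_incl X) (incl z) = 0 by have := inclP z; rewrite ker_predE => /eqP.
rewrite -wk wsum_nat => /wsum_eq0[y' y'E]; rewrite proj1_nat kE => dy'.
by exists (feval X \o y'), y', k.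
Qed.

Lemma tor_coord_dker z y : tor_coord z y -> dker y.
Proof.
move=> [y' [k [y'E kE _ ->]]]; split; first by rewrite proj2_nat y'E.
by rewrite dmap_nat -kE; apply/funext => i; rewrite /= feval_syz.
Qed.

Lemma tor_coord_surj y : dker y -> exists z, tor_coord z y.
Proof.
move=> [yE dy]; pose y' := proj2 (fun j => fdelta (End T)^c (y j)).
have fy' : feval X \o y' = y.
  by rewrite /y' -proj2_nat -[RHS]yE; congr proj2; apply/funext => j; exact: feval_delta.
have /choice[k kP] : forall i, exists k, syz_incl X k = dmap y' i.
  move=> i; apply: syz_of; have := dmap_nat (feval X) y'; rewrite fy' dy.
  by move=> /(congr1 (fun r : 'I_p -> X => r i)).
have kE : syz_incl X \o k = dmap y' by apply/funext.
have zK : wsum k \in kerm (tens_map (syz_incl X)).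
  by rewrite ker_predE wsum_nat kE wsum_dmap.
by exists (Subm zK), y', k; split=> //; rewrite /y' proj2K.
Qed.

Lemma tor_coordB z y z1 y1 : tor_coord z y -> tor_coord z1 y1 ->
  tor_coord (z - z1) (y - y1).
Proof.
move=> [y' [k [y'E kE zE ->]]] [y1' [k1 [y1'E k1E z1E ->]]].
exists (y' - y1'), (k - k1); split.
- by rewrite proj2B y'E y1'E.
- by rewrite comp_linB kE k1E dmapB.
- by rewrite wsumB -zE -z1E; exact: (linearB (@incl _ _ _)).
- by rewrite comp_linB.
Qed.

(** If y' maps to 0 in X, it comes from the syzygies, so k is already a boundary there. *)
Lemma tor_coord_inj0 z : tor_coord z 0 -> z = 0.
Proof.
move=> [y' [k [y'E kE zE y0]]]; apply: val_inj; rewrite -[LHS]/(incl z) zE.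
have /choice[y1 y1P] : forall j, exists k, syz_incl X k = y' j.
  move=> j; apply: syz_of.
  exact: (esym (congr1 (fun r : 'I_q -> X => r j) y0)).
have -> : k = dmap y1.
  apply/funext => i; apply: syz_incl_inj; have := dmap_nat (syz_incl X) y1.
  have -> : syz_incl X \o y1 = y' by apply/funext.
  by rewrite -kE => /(congr1 (fun r : 'I_p -> freem _ X => r i)).
by rewrite wsum_dmap.
Qed.

(** If z = 0, then k bounds some y1 in the syzygies; y' and y1 differ by a cycle over a free module,
    which is zero. *)
Lemma tor_coord0 y : tor_coord 0 y -> y = 0.
Proof.
move=> [y' [k [y'E kE /esym]]]; rewrite linear0 => /wsum_eq0[y1 y1E dy1 ->].
have kE' : proj1 k = k.
  apply/funext => i; apply: syz_incl_inj; have := proj1_nat (syz_incl X) k.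
  by rewrite kE proj1_dmap -kE => /(congr1 (fun r : 'I_p -> freem _ X => r i)) /esym.
have : y' - (syz_incl X \o y1) = 0.
  apply: dker_freem; split; first by rewrite proj2B proj2_nat y'E y1E.
  by rewrite dmapB dmap_nat -dy1 kE' kE subrr.
move/eqP; rewrite subr_eq0 => /eqP ->.
by apply/funext => j; rewrite /= feval_syz.
Qed.

Lemma tor_coord_inj z z1 y : tor_coord z y -> tor_coord z1 y -> z = z1.
Proof.
move=> zy z1y; apply/eqP; rewrite -subr_eq0; apply/eqP; apply: tor_coord_inj0.
by have := tor_coordB zy z1y; rewrite subrr.
Qed.

Lemma Tor1_zeroP : zero_module (Tor1 X) <-> forall y : 'I_q -> X, dker y -> y = 0.
Proof.
split=> [T0 y /tor_coord_surj[z]|k0 z].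
  by rewrite (T0 z) => /tor_coord0.
have [y zy] := tor_coord_total z; move: (zy).
by rewrite (k0 _ (tor_coord_dker zy)) => /tor_coord_inj0.
Qed.
End TorCoordinates.

Lemma tor_coord_nat (X Y : lmodType (End T)^c) (h : {linear X -> Y}) z y :
  tor_coord z y -> tor_coord (Tor1_map h z) (h \o y).
Proof.
move=> [y' [k [y'E kE zE ->]]]; exists (fmap _ h \o y'), (syz_map h \o k); split.
- by rewrite proj2_nat y'E.
- by rewrite dmap_nat -kE; apply/funext => i; rewrite /= syz_mapE.
- by rewrite -wsum_nat -zE.
- by apply/funext => j; rewrite /= feval_fmap.
Qed.
End Coordinates.

(** * The sequences of Tor *)

Definition add_coresolved (S : pzRingType) (T : lmodType S) : Prop :=
  exists (T1 T2 : lmodType S) (f : {linear S^o -> T1}) (g : {linear T1 -> T2})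
    (p : nat) (u : 'I_p -> {linear T1 -> T}) (v : 'I_p -> {linear T -> T1})
    (q : nat) (u2 : 'I_q -> {linear T2 -> T}) (v2 : 'I_q -> {linear T -> T2}),
  [/\ short_exact f g, dual_basis u v & dual_basis u2 v2].

(** One pair for each summand P i: project N onto P i and embed it into T, then go back. Projections
    come from the unique decompositions in [direct_sum]. *)
Lemma in_add_dual_basis (S : pzRingType) (T N : lmodType S) : in_add T N ->
  exists (q : nat) (u : 'I_q -> {linear N -> T}) (v : 'I_q -> {linear T -> N}),
    dual_basis u v.
Proof.
move=> [n [P [PT [j jP]]]].
have prP0 i : exists r : {linear N -> P i},
    forall x, exists s : forall i, P i, x = \sum_k j k (s k) /\ r x = s i.
  apply: (@lin_of_rel _ N (P i)
    (fun x y => exists s : forall i, P i, x = \sum_k j k (s k) /\ y = s i)).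
  - move=> a _ _ _ _ [s [-> ->]] [s' [-> ->]].
    exists (fun k => a *: s k + s' k); split=> //.
    by rewrite scaler_sumr -big_split; apply: eq_bigr => k _; rewrite linearP.
  - by move=> x; have [s [sx _]] := jP x; exists (s i), s.
  - move=> y [s [s0 ->]]; have [s' [_ s'U]] := jP 0.
    have e : s' = (fun k => 0).
      by apply: s'U; rewrite big1 // => k _; rewrite linear0.
    by have := s'U _ s0; rewrite e => /(congr1 (fun z => z i)) /= <-.
pose pr i := sval (cid (prP0 i)); have prP i := svalP (cid (prP0 i)).
have sumpr x : \sum_i j i (pr i x) = x.
  have [s [sx sU]] := jP x; rewrite [RHS]sx; apply: eq_bigr => i _.
  by have [s' [s'x prE]] := prP i x; rewrite /pr prE (sU _ s'x).
have uvP0 i : exists uv : {linear P i -> T} * {linear T -> P i},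
    forall x, uv.2 (uv.1 x) = x.
  have [Q' [h' hb]] := PT i.
  have hs : surj h' by move=> y; case: hb => k _ kK; exists (k y).
  have [k [kK _]] := lin_inv (bij_inj hb) hs.
  pose in1 (x : P i) : (P i * Q')%type := (x, 0).
  have in1_lin : linear in1 by move=> a x y; rewrite -[RHS]/(a *: x + y, a *: 0 + 0) scaler0 addr0.
  pose in1' : {linear P i -> (P i * Q')%type} := HB.pack_for {linear P i -> (P i * Q')%type} in1
    (GRing.isLinear.Build S (P i) (P i * Q')%type _ in1 in1_lin).
  have fst_lin : linear (fun x : (P i * Q')%type => x.1) by [].
  pose fst' : {linear (P i * Q')%type -> P i} := HB.pack_for {linear (P i * Q')%type -> P i}
    (fun x : (P i * Q')%type => x.1) (GRing.isLinear.Build S (P i * Q')%type (P i) _ _ fst_lin).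
  by exists ((h' \o in1' : {linear P i -> T}), (fst' \o k : {linear T -> P i})) => x /=; rewrite kK.
pose uv i := sval (cid (uvP0 i)); have uvP i x := svalP (cid (uvP0 i)) x.
exists n, (fun i => (uv i).1 \o pr i), (fun i => j i \o (uv i).2) => x /=.
by under eq_bigr do rewrite uvP; exact: sumpr.
Qed.

Lemma lift_family (I M N : Type) (g : M -> N) (y : I -> N) : surj g ->
  exists y', g \o y' = y.
Proof.
by move=> gs; have /choice[y' yP] : forall i, exists x, g x = y i by []; exists y'; apply/funext.
Qed.

Section TorSequences.
Variables (S : pzRingType) (T : lmodType S).
Hypotheses (Tadd : add_coresolved T) (TT : zero_module (Ext1 T T)).

Lemma Tor1_Hom (M : lmodType S) : zero_module (@Tor1 S T (Hom T M)).
Proof.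
have [T1 [T2 [f [g [p [u [v [q [u2 [v2 [fg uv uv2]]]]]]]]]]] := Tadd.
by apply/(Tor1_zeroP fg uv uv2 TT) => y; apply: (dker_Hom fg uv).
Qed.

Lemma eps_subproof (M : lmodType S) : exists h : {linear @tens S T (Hom T M) -> M},
  forall x t, h (tens_pure x t) = x t.
Proof.
by apply: (@tens_lift_linear S T (Hom T M) M (fun x t => x t)) => // x a t t'; rewrite linearP.
Qed.
Definition eps (M : lmodType S) : {linear @tens S T (Hom T M) -> M} :=
  sval (cid (eps_subproof M)).
Lemma epsE (M : lmodType S) (x : Hom T M) t : eps M (tens_pure x t) = x t.
Proof. exact: (svalP (cid (eps_subproof M))). Qed.

Lemma eps_nat (M N : lmodType S) (h : {linear M -> N}) w :
  eps N (tens_map (Hom_map T h) w) = h (eps M w).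
Proof.
apply: (@tens_ext _ _ _ _ (eps N \o tens_map (Hom_map T h)) (h \o eps M)) => x t /=.
by rewrite tens_mapE !epsE.
Qed.

(** Write w as [wsum x]. If [eps] kills w, the map h = sum_i x_i u_i kills e, hence factors through
    g, and the factor supplies a tuple whose boundary is x. *)
Lemma eps_inj (M : lmodType S) : injective (eps M).
Proof.
have [T1 [T2 [f [g [p [u [v [q [u2 [v2 [fg uv uv2]]]]]]]]]]] := Tadd.
apply: lin_inj => w; have [x xE <-] := wsum_surj fg uv uv2 TT w.
rewrite /wsum linear_sum => w0.
have {}w0 : \sum_i x i (gen f u i) = 0.
  by rewrite -[RHS]w0; apply: eq_bigr => i _; rewrite epsE.
pose h : {linear T1 -> M} := (\sum_i (Hom_comp (x i) (u i) : Hom T1 M)).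
have hE t : h t = \sum_i x i (u i t) by rewrite /h Hom_sumE.
have [|k kP] := factor_point (M := M) fg (h := h); first by rewrite hE.
rewrite -[X in X = 0]/(wsum f u x) -xE.
have -> : proj1 u v x = dmap g v u2 (fun j => (k \o v2 j : Hom T M)).
  apply/funext => i; apply: Hom_ext => t; rewrite /proj1 /dmap !Hom_sumE.
  transitivity (h (v i t)); first by rewrite hE.
  by rewrite -kP -[in LHS](uv2 (g (v i t))) linear_sum.
exact: (wsum_dmap u2 fg uv).
Qed.

(** Extend 1 |-> m to h : T1 -> M; then m = h(e) is the sum of the (h v_i)(u_i e). *)
Lemma eps_surj (M : lmodType S) : zero_module (Ext1 T M) -> surj (eps M).
Proof.
have [T1 [T2 [f [g [p [u [v [q [u2 [v2 [fg uv uv2]]]]]]]]]]] := Tadd.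
move=> M0 m; have [h hP] := extend_point fg uv2 m M0.
exists (\sum_i tens_pure (h \o v i : Hom T M) (u i (f 1))).
rewrite linear_sum -[RHS]hP -[in RHS](uv (f 1)) linear_sum.
by apply: eq_bigr => i _; rewrite epsE.
Qed.

Lemma Ext1_Hom_zero (M : lmodType S) : zero_module (Ext1 T M) -> zero_module (Hom T M) ->
  zero_module M.
Proof.
move=> E0 H0 m; have [w <-] := eps_surj E0 m.
suff -> : w = 0 by rewrite linear0.
elim/tens_ind: w => [|_ _ -> ->|x t] //; first by rewrite subrr.
by rewrite (H0 x) tens_pure0l.
Qed.

(** In coordinates Tor_1 consists of tuples of the module, on which an injection stays injective. *)
Lemma Tor1_map_inj (X Y : lmodType (End T)^c) (h : {linear X -> Y}) :
  injective h -> injective (Tor1_map h).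
Proof.
have [T1 [T2 [f [g [p [u [v [q [u2 [v2 [fg uv uv2]]]]]]]]]]] := Tadd.
move=> hi; apply: lin_inj => z hz.
have [y zy] := tor_coord_total fg uv uv2 TT z.
have := tor_coord_nat h zy; rewrite hz => /(tor_coord0 fg uv uv2 TT) hy.
have y0 : y = 0.
  apply/funext => j; apply: hi; rewrite linear0.
  exact: (congr1 (fun r : 'I_q -> Y => r j) hy).
by move: zy; rewrite y0 => /(tor_coord_inj0 fg uv).
Qed.

Lemma Tor1_zero_sub (X Y : lmodType (End T)^c) (h : {linear X -> Y}) :
  injective h -> zero_module (Tor1 Y) -> zero_module (Tor1 X).
Proof.
by move=> hi Y0 z; apply: (Tor1_map_inj hi); rewrite linear0.
Qed.

Section Sequence.
Variables (L M N : lmodType (End T)^c) (a : {linear L -> M}) (b : {linear M -> N}).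
Hypothesis ab : short_exact a b.

Lemma short_family (I : Type) (y : I -> M) : b \o y = 0 -> exists y', a \o y' = y.
Proof.
have [_ ker _] := ab => by0.
have /choice[y' yP] : forall i, exists x, a x = y i.
  by move=> i; apply/ker; exact: (congr1 (fun r : I -> N => r i) by0).
by exists y'; apply/funext.
Qed.

Lemma ab_comp (I : Type) (y : I -> L) : b \o (a \o y) = 0.
Proof. by apply/funext => i; rewrite /= (short_exact_comp0 ab). Qed.

Lemma a_comp_inj (I : Type) (y y' : I -> L) : a \o y = a \o y' -> y = y'.
Proof.
have [ai _ _] := ab => yy; apply/funext => i; apply: ai.
exact: (congr1 (fun r : I -> M => r i) yy).
Qed.

Lemma tens_exact w : tens_map b w = 0 <-> exists w', tens_map a w' = w.
Proof.
have [T1 [T2 [f [g [p [u [v [q [u2 [v2 [fg uv uv2]]]]]]]]]]] := Tadd.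
have [ai ker bs] := ab; split=> [|[w' <-]]; last first.
  elim/tens_ind: w' => [|p1 p2 p10 p20|x t]; rewrite ?linear0 //.
    by rewrite !linearB p10 p20 subrr.
  by rewrite !tens_mapE (short_exact_comp0 ab) tens_pure0l.
have [x xE <-] := wsum_surj fg uv uv2 TT w.
rewrite wsum_nat => /(wsum_eq0 v fg uv2 TT)[y _].
rewrite proj1_nat xE; have [y' <-] := lift_family y bs; rewrite dmap_nat => bE.
have [|l lE] := @short_family _ (x - dmap g v u2 y').
  by rewrite comp_linB bE subrr.
exists (wsum f u l); rewrite wsum_nat lE wsumB.
by rewrite (wsum_dmap u2 fg uv) subr0.
Qed.

(** If a x bounds y in M, then b y is a cycle in N, hence zero; so y comes from L, where it already
    bounds x. *)
Lemma tens_map_inj : zero_module (Tor1 N) -> injective (tens_map a).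
Proof.
have [T1 [T2 [f [g [p [u [v [q [u2 [v2 [fg uv uv2]]]]]]]]]]] := Tadd.
move=> /(Tor1_zeroP fg uv uv2 TT) N0.
apply: lin_inj => w; have [x xE <-] := wsum_surj fg uv uv2 TT w.
rewrite wsum_nat => /(wsum_eq0 v fg uv2 TT)[y yE].
rewrite proj1_nat xE => aE.
have [|y' y'E] := @short_family _ y.
  by apply: N0; split; rewrite ?proj2_nat ?yE // dmap_nat -aE ab_comp.
have -> : x = dmap g v u2 y' by apply: a_comp_inj; rewrite aE -dmap_nat y'E.
exact: (wsum_dmap u2 fg uv).
Qed.

Lemma Tor1_exact z : Tor1_map b z = 0 <-> exists z', Tor1_map a z' = z.
Proof.
have [T1 [T2 [f [g [p [u [v [q [u2 [v2 [fg uv uv2]]]]]]]]]]] := Tadd.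
split=> [bz|[z' <-]]; last first.
  have [y zy] := tor_coord_total fg uv uv2 TT z'.
  have := tor_coord_nat b (tor_coord_nat a zy); rewrite ab_comp.
  by move=> /(tor_coord_inj0 fg uv).
have [y zy] := tor_coord_total fg uv uv2 TT z.
have := tor_coord_nat b zy; rewrite bz => /(tor_coord0 fg uv uv2 TT).
move=> /short_family[y' y'E].
have [yE dy] := tor_coord_dker zy.
have [|z' z'y'] := tor_coord_surj fg uv uv2 (y := y').
  split; apply: a_comp_inj; first by rewrite -proj2_nat y'E.
  by rewrite -dmap_nat y'E dy comp_lin0.
exists z'; apply: (tor_coord_inj fg uv (y := y) _ zy).
by rewrite -y'E; apply: tor_coord_nat.
Qed.

Lemma Tor1_zero_mid : zero_module (Tor1 L) -> zero_module (Tor1 N) -> zero_module (Tor1 M).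
Proof.
move=> L0 N0 z; have /Tor1_exact[z' <-] : Tor1_map b z = 0 by apply: N0.
by rewrite (L0 z') linear0.
Qed.

(** The boundary of a lift y1 of a cycle lies in L. As L (x) T = 0, it also bounds a tuple y2 of L,
    and subtracting y2 makes y1 a cycle. *)
Lemma Tor1_map_surj : zero_module (tens L) -> surj (Tor1_map b).
Proof.
have [T1 [T2 [f [g [p [u [v [q [u2 [v2 [fg uv uv2]]]]]]]]]]] := Tadd.
have [ai ker bs] := ab => L0 z.
have [y zy] := tor_coord_total fg uv uv2 TT z; have [yE dy] := tor_coord_dker zy.
have [y1 y1E] := lift_family y bs.
have [|l lE] := @short_family _ (dmap g v u2 y1).
  by rewrite -dmap_nat y1E dy.
have [y2 y2E dy2] := wsum_eq0 v fg uv2 TT (L0 (wsum f u l)).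
have {}lE : dmap g v u2 (a \o y2) = dmap g v u2 y1.
  by rewrite dmap_nat -dy2 -proj1_nat lE (proj1_dmap _ _ uv).
have [|z' z'y] := tor_coord_surj fg uv uv2 (y := proj2 u2 v2 y1 - (a \o y2)).
  split; first by rewrite proj2B (proj2K uv2) proj2_nat y2E.
  by rewrite dmapB (dmap_proj2 _ _ uv2) lE subrr.
exists z'; apply: (tor_coord_inj fg uv (y := y) _ zy).
have := tor_coord_nat b z'y.
by rewrite comp_linB ab_comp subr0 -proj2_nat y1E yE.
Qed.

(** A lift s of [feval N] to M restricts to r : syz N -> L, and d is induced by r, hence linear by
    construction. Exactness is then checked in coordinates. *)
Lemma Tor1_connect : zero_module (Tor1 M) -> exists d : {linear Tor1 N -> tens L},
  injective d /\ forall w, tens_map a w = 0 <-> exists z, d z = w.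
Proof.
have [T1 [T2 [f [g [p [u [v [q [u2 [v2 [fg uv uv2]]]]]]]]]]] := Tadd.
have [ai ker bs] := ab => /(Tor1_zeroP fg uv uv2 TT) M0.
have [s sP] := flift_lift (feval N) bs.
have [|r rP] := short_factor ab (h := s \o syz_incl N).
  by move=> k; rewrite /= sP feval_syz.
exists (tens_map r \o incl_map (kerm (tens_map (syz_incl N)))).
(* The value at z with coordinates y is the snake: lift y to y1, apply dmap. *)
have dE (z : Tor1 N) y : tor_coord f g u v u2 v2 z y -> exists (y1 : 'I_q -> M) (l : 'I_p -> L),
    [/\ b \o y1 = y, proj2 u2 v2 y1 = y1, a \o l = dmap g v u2 y1
      & tens_map r (incl z) = wsum f u l].
  move=> [y' [k [y'E kE zE ->]]]; exists (s \o y'), (r \o k); split.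
  - by apply/funext => j; rewrite /= sP.
  - by rewrite proj2_nat y'E.
  - by rewrite dmap_nat -kE; apply/funext => i; rewrite /= rP.
  - by rewrite zE wsum_nat.
split=> [|w].
  apply: lin_inj => z; have [y zy] := tor_coord_total fg uv uv2 TT z.
  have [y1 [l [y1y y1E lE rz]]] := dE z y zy.
  rewrite /= -[incl_map _ z]/(incl z) rz => /(wsum_eq0 v fg uv2 TT)[y2 y2E dy2].
  have : y1 - (a \o y2) = 0.
    apply: M0; split; first by rewrite proj2B y1E proj2_nat y2E.
    rewrite dmapB dmap_nat -dy2 -proj1_nat lE (proj1_dmap _ _ uv).
    by rewrite subrr.
  move/eqP; rewrite subr_eq0 => /eqP y1y2.
  by move: zy; rewrite -y1y y1y2 ab_comp => /(tor_coord_inj0 fg uv).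
split=> [|[z <-]]; last first.
  have [y zy] := tor_coord_total fg uv uv2 TT z.
  have [y1 [l [y1y y1E lE rz]]] := dE z y zy.
  by rewrite /= -[incl_map _ z]/(incl z) rz wsum_nat lE (wsum_dmap u2 fg uv).
have [x xE <-] := wsum_surj fg uv uv2 TT w.
rewrite wsum_nat => /(wsum_eq0 v fg uv2 TT)[y0 y0E]; rewrite proj1_nat xE => ax.
have [|z zy] := tor_coord_surj fg uv uv2 (y := b \o y0).
  by split; rewrite ?proj2_nat ?y0E // dmap_nat -ax ab_comp.
have [y1 [l [y1y y1E lE rz]]] := dE z _ zy.
exists z; rewrite /= -[incl_map _ z]/(incl z) rz.
have [|y2 y2E] := @short_family _ (y1 - y0); first by rewrite comp_linB y1y subrr.
apply/eqP; rewrite -subr_eq0 -wsumB; apply/eqP.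
have -> : l - x = dmap g v u2 y2.
  by apply: a_comp_inj; rewrite comp_linB lE ax -dmapB -y2E dmap_nat.
exact: (wsum_dmap u2 fg uv).
Qed.
End Sequence.
End TorSequences.

(** * Universal extensions *)

Section ZeroModules.
Variables (R : pzRingType) (M N : lmodType R) (f : {linear M -> N}).
Lemma zero_inj : injective f -> zero_module N -> zero_module M.
Proof. by move=> fi N0 x; apply: fi; rewrite linear0; apply: N0. Qed.
Lemma zero_surj : surj f -> zero_module M -> zero_module N.
Proof. by move=> fs M0 y; have [x <-] := fs y; rewrite (M0 x) linear0. Qed.
End ZeroModules.

Section Pairs.
Variables (R : pzRingType) (L M N : lmodType R).
Definition pairm (f : {linear L -> M}) (g : {linear L -> N}) (x : L) : (M * N)%type :=
  (f x, g x).
Lemma pairm_linear f g : linear (pairm f g).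
Proof.
by move=> a x y; rewrite -[RHS]/(a *: f x + f y, a *: g x + g y) -!linearP.
Qed.
HB.instance Definition _ f g :=
  GRing.isLinear.Build R L (M * N)%type _ (pairm f g) (pairm_linear f g).
Definition fstm (x : (M * N)%type) : M := x.1.
Lemma fstm_linear : linear fstm. Proof. by []. Qed.
HB.instance Definition _ := GRing.isLinear.Build R (M * N)%type M _ fstm fstm_linear.
Definition sndm (x : (M * N)%type) : N := x.2.
Lemma sndm_linear : linear sndm. Proof. by []. Qed.
HB.instance Definition _ := GRing.isLinear.Build R (M * N)%type N _ sndm sndm_linear.
End Pairs.

Section Unit.
Variables (S : pzRingType) (T : lmodType S) (Y : lmodType (End T)^c).

Lemma tens_pure_linear (y : Y) : linear (@tens_pure S T Y y).
Proof. by move=> a t t'; rewrite tens_pureDr tens_scaleE. Qed.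
HB.instance Definition _ (y : Y) :=
  GRing.isLinear.Build S T (tens Y) _ (@tens_pure S T Y y) (tens_pure_linear y).
(** The unit of the adjunction between - (x) T and Hom(T, -), with counit [eps]. *)
Definition eta (y : Y) : Hom T (tens Y) := @tens_pure S T Y y.
Lemma eta_linear : linear eta.
Proof. by move=> b y y'; apply: Hom_ext => t; rewrite /= tens_pureDl tens_pureA. Qed.
HB.instance Definition _ := GRing.isLinear.Build (End T)^c Y (Hom T (tens Y)) _ eta eta_linear.
Lemma etaE y t : eta y t = tens_pure y t. Proof. by []. Qed.

Lemma act_linear (y : Y) : linear (act y : Hom T T -> Y).
Proof.
move=> b c d; rewrite -[b *: c]/(c \o (b : End T) : End T).
by rewrite [LHS](@scalerDl _ Y) -[_ *: y]/(act y _) -actA.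
Qed.
HB.instance Definition _ (y : Y) :=
  GRing.isLinear.Build (End T)^c (Hom T T) Y _ (act y : Hom T T -> Y) (act_linear y).

(** The free module B^m is written as Hom(T, T^m), the form to which [eps] and the vanishing of Tor
    apply. *)
Lemma free_cover : fin_gen Y ->
  exists m (h : {linear Hom T ('I_m -> T) -> Y}), surj h.
Proof.
move=> [m [x xP]].
pose h : {linear Hom T ('I_m -> T) -> Y} :=
  \sum_i (Hom_comp (act (x i) : {linear Hom T T -> Y}) (Hom_map T (@pow_proj S T m i)) :
    Hom (Hom T ('I_m -> T)) Y).
exists m, h => y; have [c ->] := xP y.
exists (pow_pair (fun i => (c i : End T) : {linear T -> T}) : Hom T ('I_m -> T)).
rewrite /h Hom_sumE; apply: eq_bigr => i _ /=.
by rewrite -[RHS]/(act (x i) (c i : End T)); congr act; apply: Hom_ext.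
Qed.
End Unit.

Section UniversalExtension.
Variables (S : pzRingType) (T M : lmodType S).
Hypotheses (TT : zero_module (Ext1 T T)) (Ef : fin_gen (Ext1 T M)).

(** E is the pushout of the m-th power of the free presentation of T along the sum of the h_i, whose
    classes generate Ext^1(T, M). The connecting map is then onto, so Ext^1(T, M) -> Ext^1(T, E) is
    zero, and Ext^1(T, T^m) = 0 finishes. *)
Lemma universal_extension : exists m (E : lmodType S) (a : {linear M -> E})
    (b : {linear E -> ('I_m -> T)}), short_exact a b /\ zero_module (Ext1 T E).
Proof.
have [m [x xP]] := Ef.
have /choice[h hP] : forall i, exists h : {linear syz T -> M}, Ext1_pi h = x i.
  by move=> i; have [h <-] := Ext1_pi_surj (x i); exists h.
pose W : lmodType S := (M * ('I_m -> freem S T))%type.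
pose sumh : {linear ('I_m -> syz T) -> M} :=
  \sum_i (Hom_comp (h i) (@pow_proj S (syz T) m i) : Hom ('I_m -> syz T) M).
have sumhE k : sumh k = \sum_i h i (k i) by rewrite /sumh Hom_sumE.
pose r : {linear ('I_m -> syz T) -> W} :=
  pairm (- (sumh : Hom _ _)) (pow_pair (fun i => syz_incl T \o @pow_proj S (syz T) m i)).
pose E : lmodType S := quotm (imm r).
pose piE : {linear W -> E} := @quotm_pi S W (imm r).
have pi0 w : piE w = 0 <-> exists k, r k = w.
  by split=> [/quotm_pi_eq0/asboolP|wr] //; apply/quotm_pi_eq0/asboolP.
pose a : {linear M -> E} := piE \o pairm idfun \0.
pose fev : {linear W -> ('I_m -> T)} :=
  pow_pair (fun i => feval T \o @pow_proj S _ m i) \o @sndm S M ('I_m -> freem S T).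
have [|b bP] := factor_surj (f := piE) (h := fev) (@quotm_pi_surj S W (imm r)).
  move=> w /pi0[k <-]; apply/funext => i; exact: feval_syz.
have ab : short_exact a b.
  split.
  - apply: lin_inj => z /pi0[k]; rewrite /r /= /pairm => -[k1 k2].
    have k0 : k = 0.
      apply/funext => i; apply: syz_incl_inj; rewrite linear0.
      exact: (congr1 (fun u : 'I_m -> freem S T => u i) k2).
    by rewrite -[LHS]k1 k0 linear0 oppr0.
  - move=> y; split=> [|[z <-]]; last first.
      by rewrite /a /= bP; apply/funext => i; exact: linear0.
    have [[z p] <-] := @quotm_pi_surj S W (imm r) y.
    rewrite -[quotm_pi _ _]/(piE (z, p)) bP => fp.
    have /choice[k kP] : forall i, exists k, syz_incl T k = p i.
      by move=> i; apply: syz_of; exact: (congr1 (fun u : 'I_m -> T => u i) fp).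
    exists (z + sumh k); apply/eqP; rewrite eq_sym -subr_eq0 -[a _]/(piE (z + sumh k, 0)).
    rewrite -linearB; apply/eqP/pi0; exists k.
    rewrite -[RHS]/(z - (z + sumh k), p - 0) subr0 opprD addrA subrr add0r.
    by rewrite /r /= /pairm; congr (_, _); apply/funext.
  - move=> y; have [p pP] := lift_family y (@feval_surj _ T).
    by exists (piE (0, p)); rewrite bP -pP.
exists m, E, a, b; split=> //.
have [d [_ df dE]] := Hom_connect T ab.
(* The i-th inclusion T -> T^m lifts to the i-th free summand of W, and on syzygies this lift equals
   a h_i by the relations r. *)
have din i : d (@pow_in S T m i) = x i.
  rewrite -hP; apply: (dE _ (piE \o pairm \0 (@pow_in S (freem S T) m i))).
    move=> w; rewrite /= bP; apply/funext => j; rewrite /fev /= /pow_pair /= /pow_proj /pow_in.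
    by case: eqP => // _; rewrite linear0.
  move=> k; apply/eqP; rewrite eq_sym -subr_eq0 -[a _]/(piE (h i k, 0)).
  rewrite -[X in _ - X]/(piE (h i k, 0)) /= -linearB; apply/eqP/pi0; exists (pow_in i k).
  rewrite -[RHS]/(0 - h i k, pow_in i (syz_incl T k) - 0) subr0 sub0r.
  rewrite /r /= /pairm; congr (_, _).
    rewrite /= sumhE (bigD1 i) //= big1 ?addr0 /pow_in ?eqxx //.
    by move=> j ji; rewrite (negbTE ji) linear0.
  apply/funext => j; rewrite -[LHS]/(syz_incl T (pow_in i k j)) /pow_in.
  by case: eqP => // _; rewrite linear0.
have ds q : exists p, d p = q.
  have [c ->] := xP q; exists (\sum_i c i *: (@pow_in S T m i : Hom T _)).
  by rewrite linear_sum; apply: eq_bigr => i _; rewrite linearZ -din.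
move=> q; have /(Ext1_map_exact ab)[q' <-] : Ext1_map T b q = 0.
  by apply: Ext1_zero_pow.
by apply/df; exact: ds.
Qed.
End UniversalExtension.

(** * The tilting equivalences *)

Section SimpleObjects.
Variables (R : pzRingType) (C : lmodType R -> Prop).

Definition iso_closed := forall (M N : lmodType R) (f : {linear M -> N}),
  injective f -> surj f -> C M -> C N.

(** Arbitrary injections replace inclusions of submodules, since the functors produce the former;
    [S_simpleP] compares the two notions for an isomorphism-closed class. *)
Definition S_simple (M : lmodType R) : Prop :=
  [/\ C M, ~ zero_module M & forall (L : lmodType R) (f : {linear L -> M}),
    injective f -> C L -> zero_module L \/ surj f].

Definition Q_simple (M : lmodType R) : Prop :=
  [/\ C M, ~ zero_module M & forall (N : lmodType R) (g : {linear M -> N}),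
    surj g -> C N -> zero_module N \/ injective g].

Hypothesis Ciso : iso_closed.

Lemma S_simpleP M : S_class C M <-> S_simple M.
Proof.
split=> -[CM M0 MS]; split=> //; last first.
  move=> L [x xL x0] [y yL] CL.
  have [L0|fs] := MS _ (incl_map L) (val_inj (sT := subm L)) CL.
    by move/eqP: x0; apply; exact: (congr1 val (L0 (Subm xL))).
  by have [z zy] := fs y; move: yL; rewrite -zy; case/negP; exact: inclP.
move=> L f fi CL.
have [L0|/existsNP[x x0]] := pselect (zero_module L); [by left | right => y].
apply: contrapT => yL; apply: (MS (imm f)).
- exists (f x); first by apply/asboolP; exists x.
  by apply/eqP => fx; apply: x0; apply: fi; rewrite linear0.
- by exists y; apply/negP => /asboolP.
have [|k kP] := factor_inj (f := incl_map (imm f)) (h := f) val_inj.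
  move=> z; have fz : f z \in imm f by apply/asboolP; exists z.
  by exists (Subm fz).
apply: (Ciso (f := k)) CL => [z z' kz|z]; first by apply: fi; rewrite -(kP z) -(kP z') kz.
by have /asboolP[z' z'E] := inclP z; exists z'; apply: val_inj; exact: etrans (kP z') z'E.
Qed.

Lemma Q_simpleP M : Q_class C M <-> Q_simple M.
Proof.
split=> -[CM M0 MQ]; split=> //; last first.
  move=> L [x xL x0] [y yL] CL.
  have [L0|gi] := MQ _ (@quotm_pi R M L) (@quotm_pi_surj R M L) CL.
    by move/negP: yL; apply; apply/quotm_pi_eq0; apply: L0.
  move/eqP: x0; apply; apply: gi; rewrite linear0; exact/quotm_pi_eq0.
move=> N g gs CN; have [N0|/existsNP[z z0]] := pselect (zero_module N); [by left | right].
apply: lin_inj => x gx; apply: contrapT => x0; apply: (MQ (kerm g)).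
- by exists x; [rewrite ker_predE gx | apply/eqP].
- have [y yz] := gs z; exists y; rewrite ker_predE yz; exact/eqP.
have [|k [ki ks]] := iso_of_same_ker gs (@quotm_pi_surj R M (kerm g)).
  move=> y; split=> [gy|/quotm_pi_eq0]; last by rewrite ker_predE => /eqP.
  by apply/quotm_pi_eq0; rewrite ker_predE gy.
exact: (Ciso ki ks CN).
Qed.
End SimpleObjects.

Lemma S_class_iso (R : pzRingType) (C : lmodType R -> Prop) :
  iso_closed C -> iso_closed (S_class C).
Proof.
move=> Ciso M N f fi fs /(S_simpleP Ciso)[CM M0 MS]; have [k [kf fk]] := lin_inv fi fs.
apply/(S_simpleP Ciso); split; first exact: (Ciso _ _ f fi fs CM).
  by move=> N0; apply: M0; exact: zero_inj fi N0.
move=> L h hi CL; have [|L0|hs] := MS L (k \o h) _ CL; [|by left|right=> y].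
  by move=> x y /(can_inj fk)/hi.
by have [x xy] := hs (k y); exists x; apply: (can_inj fk).
Qed.

Lemma Q_class_iso (R : pzRingType) (C : lmodType R -> Prop) :
  iso_closed C -> iso_closed (Q_class C).
Proof.
move=> Ciso M N f fi fs /(Q_simpleP Ciso)[CM M0 MQ]; have [k [kf fk]] := lin_inv fi fs.
apply/(Q_simpleP Ciso); split; first exact: (Ciso _ _ f fi fs CM).
  by move=> N0; apply: M0; exact: zero_inj fi N0.
move=> L h hs CL; have [|L0|hi] := MQ L (h \o f) _ CL; [|by left|right=> x y hxy].
  by move=> y; have [x <-] := hs y; have [z <-] := fs x; exists z.
by apply: (can_inj fk); apply: hi; rewrite /= !fk.
Qed.

Lemma fmor_iso (R S : pzRingType) (F : modFunctor R S) (M N : lmodType R)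
  (f : {linear M -> N}) : injective f -> surj f ->
  injective (fmor F f) /\ surj (fmor F f).
Proof.
move=> fi fs; have [k [kf fk]] := lin_inv fi fs.
have ekf : (k \o f : {linear M -> M}) = (idfun : {linear M -> M}).
  by apply: Hom_ext.
have efk : (f \o k : {linear N -> N}) = (idfun : {linear N -> N}).
  by apply: Hom_ext.
have kfK x : fmor F k (fmor F f x) = x.
  by rewrite -[LHS](fmor_comp (m := F) k f x) ekf fmor_id.
have fkK x : fmor F f (fmor F k x) = x.
  by rewrite -[LHS](fmor_comp (m := F) f k x) efk fmor_id.
by split=> [|y]; [exact: can_inj kfK | exists (fmor F k y)].
Qed.

(** * Unit, counit and the two equivalences *)

Section Core.
Variables (S : pzRingType) (T : lmodType S).
Hypotheses (Sn : noetherian S) (Bn : noetherian (End T)^c).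
Hypothesis homf : forall M : lmodType S, fin_gen M -> fin_gen (Hom T M).
Hypothesis extf : forall M : lmodType S, fin_gen M -> fin_gen (Ext1 T M).
Hypotheses (Tadd : add_coresolved T) (TT : zero_module (Ext1 T T)).
Hypotheses (Tf : fin_gen T) (Tp : projective (syz T)).

Lemma class_iso (Q : pzRingType) (F : modFunctor S Q) :
  iso_closed (fun M => fin_gen M /\ zero_module (F M)).
Proof.
move=> M N f fi fs [Mf M0]; split; first exact: (fin_gen_surj fs Mf).
exact: (zero_surj (fmor_iso F fi fs).2 M0).
Qed.
Lemma class_iso' (F : modFunctor (End T)^c S) :
  iso_closed (fun M => fin_gen M /\ zero_module (F M)).
Proof.
move=> M N f fi fs [Mf M0]; split; first exact: (fin_gen_surj fs Mf).
exact: (zero_surj (fmor_iso F fi fs).2 M0).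
Qed.
Lemma class_T_iso : iso_closed (class_T T). Proof. exact: (class_iso (F := Ext1F T)). Qed.
Lemma class_F_iso : iso_closed (class_F T). Proof. exact: (class_iso (F := HomF T)). Qed.
Lemma class_X_iso : iso_closed (@class_X S T). Proof. exact: (class_iso' (F := tensF T)). Qed.
Lemma class_Y_iso : iso_closed (@class_Y S T). Proof. exact: (class_iso' (F := Tor1F T)). Qed.

Lemma class_T_quot (M N : lmodType S) (g : {linear M -> N}) : surj g ->
  class_T T M -> class_T T N.
Proof.
move=> gs [Mf M0]; split; first exact: (fin_gen_surj gs Mf).
exact: (zero_surj (Ext1_map_surj Tp gs) M0).
Qed.

Lemma class_T_pow m : class_T T ('I_m -> T).
Proof. by split; [exact: fin_gen_pow | exact: Ext1_zero_pow]. Qed.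

Lemma class_X_quot (M N : lmodType (End T)^c) (g : {linear M -> N}) : surj g ->
  class_X M -> class_X N.
Proof.
move=> gs [Mf M0]; split; first exact: (fin_gen_surj gs Mf).
exact: (zero_surj (tens_map_surj gs) M0).
Qed.

Lemma class_F_sub (M N : lmodType S) (f : {linear M -> N}) : injective f ->
  class_F T N -> class_F T M.
Proof.
move=> fi [Nf N0]; split; first exact: (noetherian_inj Sn fi Nf).
exact: (zero_inj (Hom_map_inj fi) N0).
Qed.

(** X (x) T is a quotient of Hom(T, T^m) (x) T, which [eps] identifies with T^m. *)
Lemma tens_class_T (X : lmodType (End T)^c) : fin_gen X -> class_T T (tens X).
Proof.
move=> /free_cover[m [h hs]].
have [k [_ kK]] := lin_inv (@eps_inj _ _ Tadd TT ('I_m -> T))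
  (eps_surj Tadd (class_T_pow m).2).
apply: (class_T_quot (g := tens_map h \o k)) (class_T_pow m) => y.
have [w <-] := tens_map_surj hs y; exists (eps T _ w) => /=; congr (tens_map h _).
by apply: (eps_inj Tadd TT); rewrite kK.
Qed.

Lemma Hom_class_Y (M : lmodType S) : fin_gen M -> class_Y (Hom T M).
Proof. by move=> Mf; split; [exact: homf | exact: Tor1_Hom]. Qed.

Lemma eta_Hom_inj (M : lmodType S) (p : Hom T M) : eta p = 0 -> p = 0.
Proof.
move=> ep; apply: Hom_ext => t; rewrite -(epsE p t) -etaE ep.
exact: linear0.
Qed.

Section Presentation.
Variables (X : lmodType (End T)^c) (m : nat) (h : {linear Hom T ('I_m -> T) -> X}).
Hypothesis hs : surj h.
Let K := subm (kerm h).
Let i : {linear K -> Hom T ('I_m -> T)} := incl_map (kerm h).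

Lemma ker_cover_fin_gen : fin_gen K.
Proof. by apply: Bn; apply: homf; apply: fin_gen_pow. Qed.

(** The kernel of [tens_map h] is a quotient of K (x) T, so Ext^1(T, -) kills it. A map T -> X (x) T
    therefore lifts to Hom(T, T^m) (x) T, and [eps] turns the lift into an element of Hom(T,
    T^m). *)
Lemma eta_surj_cover : surj (@eta S T X).
Proof.
move=> phi; pose N := subm (kerm (tens_map h)).
have [ji kerj _] := short_exact_ker (tens_map_surj (T := T) hs).
have N0 : zero_module (Ext1 T N).
  have [|k kP] := @factor_inj _ _ _ _ (incl_map (kerm (tens_map h))) (tens_map i) ji.
    move=> w; apply/kerj.
    by apply/(tens_exact Tadd TT (short_exact_ker hs)); exists w.
  apply: (class_T_quot (g := k) _ (tens_class_T ker_cover_fin_gen)).2 => n.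
  have [|w wn] := (tens_exact Tadd TT (short_exact_ker hs) (incl_map _ n)).1.
    by apply/kerj; exists n.
  by exists w; apply: ji; rewrite kP.
have [psi psiE] := Hom_map_surj (short_exact_ker (tens_map_surj (T := T) hs)) N0 phi.
exists (h (eps T _ \o psi : Hom T _)); apply: Hom_ext => t.
rewrite etaE -tens_mapE -psiE /=; congr (tens_map h _).
by apply: (eps_inj Tadd TT); rewrite epsE.
Qed.
End Presentation.

Lemma eta_surj (X : lmodType (End T)^c) : fin_gen X -> surj (@eta S T X).
Proof. by move=> /free_cover[m [h hs]]; apply: eta_surj_cover hs. Qed.

(** As Tor_1(X, T) = 0, K (x) T embeds in Hom(T, T^m) (x) T. If [eta] kills h(p), then [eta p] lands
    in K (x) T, where it is [eta l] with l in K; hence p = l and h(p) = 0. *)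
Lemma eta_inj (X : lmodType (End T)^c) : class_Y X -> injective (@eta S T X).
Proof.
move=> [Xf X0]; have [m [h hs]] := free_cover Xf; have ker := short_exact_ker hs.
apply: lin_inj => x; have [p <-] := hs x => ep.
have ii := tens_map_inj Tadd TT ker X0.
have [|k kP] := factor_inj (h := eta p : {linear T -> _}) ii.
  move=> t; apply/(tens_exact Tadd TT ker); rewrite etaE tens_mapE.
  exact: (congr1 (fun r : Hom T (tens X) => r t) ep).
have [l lk] := eta_surj (ker_cover_fin_gen h) k.
suff <- : incl_map (kerm h) l = p by exact: (short_exact_comp0 ker).
apply/eqP; rewrite -subr_eq0; apply/eqP; apply: eta_Hom_inj; rewrite linearB.
apply/eqP; rewrite subr_eq0; apply/eqP; apply: Hom_ext => t.
by rewrite -kP -lk !etaE tens_mapE.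
Qed.

Lemma class_XY_zero (X : lmodType (End T)^c) : class_X X -> class_Y X -> zero_module X.
Proof.
move=> [_ X0] XY x; apply: (eta_inj XY); rewrite linear0; apply: Hom_ext => t.
exact: X0.
Qed.

(** Hom(T, -) turns the universal extension into the presentation 0 -> Hom(T, E) -> Hom(T, T^m) ->
    Ext^1(T, M) -> 0. Tensoring with T gives back E -> T^m, with cokernel 0 and kernel M. *)
Lemma Ext1_class_F (M : lmodType S) : class_F T M ->
  class_X (Ext1 T M) /\ exists k : {linear Tor1 (Ext1 T M) -> M}, injective k /\ surj k.
Proof.
move=> [Mf M0]; have Xf := extf Mf.
have [m [E [a [b [ab E0]]]]] := universal_extension TT Xf.
have [ai ker bs] := ab.
have [d [dg df _]] := Hom_connect T ab.
have sd : short_exact (Hom_map T b) d.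
  split=> //; last by move=> q; apply/df; exact: E0.
  apply: lin_inj => h /(Hom_map_exact ab)[h' <-].
  by rewrite (M0 h') linear0.
have bts : surj (tens_map (Hom_map T b)).
  move=> w; have [x xw] := bs (eps T _ w); have [w' w'x] := eps_surj Tadd E0 x.
  by exists w'; apply: (eps_inj Tadd TT); rewrite eps_nat w'x xw.
split.
  split=> // w; have [w' <-] := tens_map_surj (let: And3 _ _ ds := sd in ds) w.
  have [w'' <-] := bts w'; apply/(tens_exact Tadd TT sd); by exists w''.
have [c [ci cP]] := Tor1_connect Tadd TT sd (Tor1_Hom Tadd TT (M := _)).
have [|k kP] := short_factor ab (h := eps T _ \o c).
  by move=> z; rewrite /= -eps_nat (_ : tens_map _ _ = 0) ?linear0 //; apply/cP; exists z.
exists k; split=> [|x].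
  by apply: lin_inj => z kz; apply: ci; apply: (eps_inj Tadd TT); rewrite -[LHS]kP kz !linear0.
have [w wx] := eps_surj Tadd E0 (a x).
have [|z zw] := (cP w).1.
  by apply: (eps_inj Tadd TT); rewrite eps_nat wx (short_exact_comp0 ab) linear0.
by exists z; apply: ai; rewrite kP /= zw.
Qed.

(** Since X (x) T = 0, a presentation yields 0 -> Tor_1(X, T) -> K (x) T -> Hom(T, T^m) (x) T -> 0.
    Under [eta], applying Hom(T, -) recovers K -> Hom(T, T^m), with kernel 0 and cokernel X. *)
Lemma Tor1_class_X (X : lmodType (End T)^c) : class_X X ->
  class_F T (Tor1 X) /\ exists k : {linear X -> Ext1 T (Tor1 X)}, injective k /\ surj k.
Proof.
move=> [Xf X0]; have [m [h hs]] := free_cover Xf; have ker := short_exact_ker hs.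
have Kf := ker_cover_fin_gen h.
have [d [di dP]] := Tor1_connect Tadd TT ker (Tor1_Hom Tadd TT (M := _)).
have sd : short_exact d (tens_map (incl_map (kerm h))).
  by split=> // w; apply/(tens_exact Tadd TT ker); apply: X0.
have [KT KE] := tens_class_T Kf.
have eta0 (l : subm (kerm h)) :
    tens_map (incl_map (kerm h)) \o eta l = eta (incl_map _ l) :> (T -> _).
  by apply/funext => t; rewrite /= tens_mapE.
split.
  split; first exact: noetherian_inj di KT.
  move=> phi; apply: (Hom_map_inj di); rewrite linear0.
  have [l lE] := eta_surj Kf (Hom_map T d phi); rewrite -lE.
  suff -> : l = 0 by rewrite linear0.
  apply: val_inj; apply: eta_Hom_inj; apply: Hom_ext => t.
  rewrite -[val l]/(incl_map _ l) -eta0 lE /=.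
  by apply/dP; exists (phi t).
have [c [cg cf _]] := Hom_connect T sd.
have cs : surj (c \o @eta S T (Hom T ('I_m -> T))).
  move=> q; have [|r <-] := (cf q).1; first exact: KE.
  have [p <-] := eta_surj (homf (fin_gen_pow m Tf)) r; by exists p.
apply: (iso_of_same_ker hs cs) => p; split=> [hp|/cg[r rE]].
  have [_ kerh _] := ker; have [l <-] := (kerh p).1 hp.
  apply/cg; exists (eta l); apply: Hom_ext => t.
  exact: (congr1 (fun z : T -> _ => z t) (eta0 l)).
have [l lE] := eta_surj Kf r; rewrite -lE in rE.
suff <- : incl_map (kerm h) l = p by exact: (short_exact_comp0 ker).
apply/eqP; rewrite -subr_eq0; apply/eqP; apply: eta_Hom_inj; rewrite linearB -rE.
apply/eqP; rewrite subr_eq0; apply/eqP; apply: Hom_ext => t.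
exact: (esym (congr1 (fun z : T -> _ => z t) (eta0 l))).
Qed.
End Core.

(** * Filtrations *)

Section InducedFiltrations.
Variables (R S : pzRingType) (G : modFunctor R S).
Variables (C E : lmodType R -> Prop) (D : lmodType S -> Prop).

(** What the four functors share: E is an extension-closed class containing C on which G is exact.
    Exactness assumes both outer terms in E because Hom and Tor use the left one, Ext^1 and the
    tensor product the right one. *)
Record filtration_hyp : Prop := {
  sub_ext : forall M, C M -> E M;
  ext_zero : forall M, zero_module M -> E M;
  ext_mid : forall (L M N : lmodType R) (f : {linear L -> M}) (g : {linear M -> N}),
    short_exact f g -> E L -> E N -> E M;
  functor_exact : forall (L M N : lmodType R) (f : {linear L -> M}) (g : {linear M -> N}),
    short_exact f g -> E L -> E N -> short_exact (fmor G f) (fmor G g);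
  functor_zero : forall M, zero_module M -> zero_module (G M);
  functor_simple : forall M, C M -> D (G M);
  target_iso : iso_closed D;
  target_nonzero : forall M, D M -> ~ zero_module M
}.
Hypothesis hyp : filtration_hyp.

Lemma induced_filtration (M : lmodType R) (n : nat) (F : nat -> submodClosed M) :
  filtration C n F -> induces_filtration G D n F.
Proof.
move=> [F0 Fn Fstep].
have step i : (i < n)%N -> exists j : {linear subm (F i) -> subm (F i.+1)},
    (incl_map (F i.+1) \o j = incl_map (F i) :> {linear _ -> _}) /\
    short_exact j (@quotm_pi R _ (preimm (incl_map (F i.+1)) (F i))).
  move=> /Fstep[Fi _ _].
  have [|j jP] := factor_inj (f := incl_map (F i.+1)) (h := incl_map (F i)) val_inj.
    by move=> x; exists (Subm (Fi _ (inclP x))).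
  exists j; split; first exact: Hom_ext.
  split; last exact: quotm_pi_surj.
  - by move=> x y jxy; apply: val_inj; rewrite -[LHS](jP x) jxy; exact: jP.
  - move=> y; split=> [/quotm_pi_eq0|[x <-]].
      rewrite preim_predE => yF; exists (Subm yF); apply: val_inj; exact: jP.
    by apply/quotm_pi_eq0; rewrite preim_predE jP; exact: inclP.
have EF i : (i <= n)%N -> E (subm (F i)).
  elim: i => [_|i IH iltn].
    by apply: (ext_zero hyp) => x; apply: val_inj; exact: (F0 _).1 (inclP x).
  have [j [_ jex]] := step i iltn; have [_ _ CF] := Fstep i iltn.
  exact: (ext_mid hyp jex (IH (ltnW iltn)) (sub_ext hyp CF)).
have Gstep i : (i < n)%N -> exists (j : {linear G (subm (F i)) -> G (subm (F i.+1))})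
    (pi : {linear G (subm (F i.+1)) -> G (subquot (F i.+1) (F i))}),
    (forall x, fmor G (incl_map (F i.+1)) (j x) = fmor G (incl_map (F i)) x) /\
    short_exact j pi.
  move=> iltn; have [j [jE jex]] := step i iltn; have [_ _ CF] := Fstep i iltn.
  exists (fmor G j), (fmor G (@quotm_pi R _ (preimm (incl_map (F i.+1)) (F i)))); split.
    by move=> x; rewrite -jE; exact: (esym (fmor_comp (m := G) _ _ _)).
  exact: (functor_exact hyp jex (EF _ (ltnW iltn)) (sub_ext hyp CF)).
have inclN : injective (fmor G (incl_map (F n))) /\ surj (fmor G (incl_map (F n))).
  by apply: fmor_iso => [|x]; [exact: val_inj | exists (Subm (Fn x))].
(* Downwards from n, where the inclusion is an isomorphism: the map for i is the one for i + 1 after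
   the injection j. *)
have incl_inj i : (i <= n)%N -> injective (fmor G (incl_map (F i))).
  move=> /subnK; move: (n - i)%N => d; elim: d i => [|d IH] i.
    by rewrite add0n => ->; exact: inclN.1.
  rewrite addSnnS => idn; have iltn : (i < n)%N by rewrite -idn leq_addl.
  have [j [pi [jE [ji _ _]]]] := Gstep i iltn.
  by move=> x y; rewrite -!jE => /(IH _ idn)/ji.
split=> //; split.
- move=> x; split=> [/asboolP[z <-]|->]; last exact: rpred0.
  rewrite (_ : z = 0) ?linear0 //; apply: (functor_zero hyp) => y.
  by apply: val_inj; exact: (F0 _).1 (inclP y).
- by move=> x; apply/asboolP; exact: inclN.2.
move=> i iltn; have [j [pi [jE [ji ker pis]]]] := Gstep i iltn.
have [_ _ CF] := Fstep i iltn; have DF := functor_simple hyp CF.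
have kerE z : pi z = 0 <-> fmor G (incl_map (F i.+1)) z \in imm (fmor G (incl_map (F i))).
  split=> [/ker[y <-]|/asboolP[y]]; first by apply/asboolP; exists y; rewrite jE.
  by rewrite -jE => /(incl_inj _ iltn) yz; apply/ker; exists y.
split.
- by move=> _ /asboolP[z <-]; apply/asboolP; exists (j z); rewrite jE.
- have /existsNP[r r0] := target_nonzero hyp DF; have [z zr] := pis r.
  exists (fmor G (incl_map (F i.+1)) z); first by apply/asboolP; exists z.
  by apply/negP => /kerE; rewrite zr.
have [|k kP] := factor_inj (f := incl_map (imm (fmor G (incl_map (F i.+1)))))
    (h := fmor G (incl_map (F i.+1))) val_inj.
  move=> z; have zI : fmor G (incl_map (F i.+1)) z \in imm (fmor G (incl_map (F i.+1))).
    by apply/asboolP; exists z.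
  by exists (Subm zI).
have ks : surj k.
  move=> y; have /asboolP[z zy] := inclP y; exists z; apply: val_inj.
  exact: etrans (kP z) zy.
(* G of the subquotient and the subquotient of the images are quotients of G (F i.+1) with the same
   kernel. *)
have [||r [ri rs]] := iso_of_same_ker (h := @quotm_pi S _ (preimm
  (incl_map (imm (fmor G (incl_map (F i.+1))))) (imm (fmor G (incl_map (F i))))) \o k) pis.
- by move=> y; have [w <-] := quotm_pi_surj y; have [z <-] := ks w; exists z.
- move=> z; rewrite kerE -kP; split=> [zi|/quotm_pi_eq0] //.
  by apply/quotm_pi_eq0; rewrite preim_predE.
exact: (target_iso hyp ri rs).
Qed.

Lemma induced_cofiltration (n : nat) (N : nat -> lmodType R)
    (f : forall i, {linear N i.+1 -> N i}) :
  cofiltration C n f -> induces_cofiltration G D n f.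
Proof.
move=> [N0 Nstep].
have EN i : (i <= n)%N -> E (N i).
  elim: i => [_|i IH iltn]; first exact: (ext_zero hyp).
  have [fs _ CK] := Nstep i iltn.
  exact: (ext_mid hyp (short_exact_ker fs) (sub_ext hyp CK) (IH (ltnW iltn))).
split=> [|i iltn]; first exact: (functor_zero hyp).
have [fs _ CK] := Nstep i iltn; have DK := functor_simple hyp CK.
have [ji ker gs] := functor_exact hyp (short_exact_ker fs) (sub_ext hyp CK) (EN _ (ltnW iltn)).
split=> // [gi|].
  apply: (target_nonzero hyp DK) => x; apply: ji; apply: gi; rewrite !linear0.
  by apply/ker; exists x.
have [|k kP] := factor_inj (f := incl_map (kerm (fmor G (f i))))
    (h := fmor G (incl_map (kerm (f i)))) val_inj.
  move=> z; have zK : fmor G (incl_map (kerm (f i))) z \in kerm (fmor G (f i)).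
    by rewrite ker_predE; apply/eqP/ker; exists z.
  by exists (Subm zK).
apply: (target_iso hyp (f := k)) DK => [x y kxy|y].
  by apply: ji; rewrite -(kP x) -(kP y) kxy.
have /eqP/ker[z zy] : fmor G (f i) (incl y) == 0 := inclP y.
by exists z; apply: val_inj; exact: etrans (kP z) zy.
Qed.
End InducedFiltrations.

(** * Correspondence of the simple objects *)

Section SimpleCorrespondence.
Variables (S : pzRingType) (T : lmodType S).
Hypotheses (Sn : noetherian S) (Bn : noetherian (End T)^c).
Hypothesis homf : forall M : lmodType S, fin_gen M -> fin_gen (Hom T M).
Hypothesis extf : forall M : lmodType S, fin_gen M -> fin_gen (Ext1 T M).
Hypotheses (Tadd : add_coresolved T) (TT : zero_module (Ext1 T T)).
Hypotheses (Tf : fin_gen T) (Tp : projective (syz T)).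

Let XY0 := class_XY_zero Bn homf Tadd TT Tf Tp.

(** For a quotient N in Y with kernel K, the vanishing of Tor_1(N, T) embeds K (x) T in M. If K (x)
    T = 0 then K = 0; if it is all of M then N (x) T = 0, and N = 0 since X and Y meet in zero. *)
Lemma Hom_simple (M : lmodType S) :
  S_class (class_T T) M -> Q_class (@class_Y S T) (Hom T M).
Proof.
move=> /(S_simpleP (@class_T_iso S T))[[Mf ME] M0 MS].
apply/(Q_simpleP (@class_Y_iso S T)); split; first exact: Hom_class_Y.
  by move=> H0; exact: (M0 (Ext1_Hom_zero Tadd ME H0)).
move=> N g gs [Nf N0]; have ker := short_exact_ker gs.
have Kf : fin_gen (subm (kerm g)) by apply/Bn/homf.
pose h : {linear tens (subm (kerm g)) -> M} := eps T M \o tens_map (incl_map (kerm g)).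
have hi : injective h.
  by move=> w w' /(eps_inj Tadd TT)/(tens_map_inj Tadd TT ker N0).
have [K0|hs] := MS _ h hi (tens_class_T Tadd TT Tf Tp Kf).
  right; apply: lin_inj => x gx; have [_ kerP _] := ker; have [l <-] := (kerP x).1 gx.
  suff -> : l = 0 by rewrite linear0.
  apply: val_inj; apply: Hom_ext => t.
  rewrite -[LHS](epsE (incl_map (kerm g) l) t) -tens_mapE.
  by rewrite (K0 (tens_pure l t)) !linear0.
left; apply: XY0 => //; split=> // w.
have [w' <-] := tens_map_surj gs w; apply/(tens_exact Tadd TT ker).
have [r rw] := hs (eps T M w'); exists r; apply: (eps_inj Tadd TT); exact: rw.
Qed.

(** A subobject L in the class T with quotient N makes Hom(T, N) a quotient of Y, through [eta]. If
    it is 0 then N = 0; if Y embeds in it then Hom(T, L) = 0, so L = 0. *)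
Lemma tens_simple (Y : lmodType (End T)^c) :
  Q_class (@class_Y S T) Y -> S_class (class_T T) (tens Y).
Proof.
move=> /(Q_simpleP (@class_Y_iso S T))[YY Y0 YQ]; have [Yf YT] := YY.
apply/(S_simpleP (@class_T_iso S T)); split; first exact: tens_class_T.
  by move=> H0; apply: Y0; apply: XY0.
move=> L f fi LT; have ex := short_exact_coker fi.
pose N := quotm (imm f).
have [Nf NE] : class_T T N.
  exact: (class_T_quot Tp (@quotm_pi_surj S _ (imm f)) (tens_class_T Tadd TT Tf Tp Yf)).
pose g : {linear Y -> Hom T N} := Hom_map T (@quotm_pi S _ (imm f)) \o @eta S T Y.
have gs : surj g.
  move=> h; have [h' <-] := Hom_map_surj ex LT.2 h.
  by have [y <-] := eta_surj Bn homf Tadd TT Tf Tp Yf h'; exists y.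
have [N0|gi] := YQ _ g gs (Hom_class_Y homf Tadd TT Nf).
  right=> y; have [_ ker _] := ex; apply/ker.
  exact: (Ext1_Hom_zero Tadd NE N0).
left; apply: (Ext1_Hom_zero Tadd LT.2) => h.
apply: (Hom_map_inj fi); rewrite linear0.
have [y yE] := eta_surj Bn homf Tadd TT Tf Tp Yf (Hom_map T f h).
rewrite -yE (_ : y = 0) ?linear0 //; apply: gi; rewrite [RHS]linear0.
rewrite /g /= yE; apply/(Hom_map_exact ex); by exists h.
Qed.

(** A subobject L in X gives the quotient Tor_1(Ext^1(T, M) / L, T) of Tor_1(Ext^1(T, M), T), a copy
    of M. Either that quotient or Tor_1(L, T) vanishes, and X and Y meet in zero. *)
Lemma Ext1_simple (M : lmodType S) :
  Q_class (class_F T) M -> S_class (@class_X S T) (Ext1 T M).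
Proof.
move=> /(Q_simpleP (@class_F_iso S T))[MF M0 MQ].
have [EX [k [ki ks]]] := Ext1_class_F extf Tadd TT MF.
apply/(S_simpleP (@class_X_iso S T)); split=> //.
  by move=> H0; apply: M0; apply: (Ext1_Hom_zero Tadd H0 MF.2).
move=> L f fi LX; have ex := short_exact_coker fi; have [_ ker _] := ex.
have NX : class_X (quotm (imm f)) := class_X_quot (@quotm_pi_surj _ _ (imm f)) EX.
have [k' [kk' k'k]] := lin_inv ki ks.
pose g : {linear M -> Tor1 (quotm (imm f))} := Tor1_map (@quotm_pi _ _ (imm f)) \o k'.
have gs : surj g.
  move=> z; have [z' <-] := Tor1_map_surj Tadd TT ex LX.2 z.
  by exists (k z'); rewrite /g /= kk'.
have [NF _] := Tor1_class_X Sn Bn homf Tadd TT Tf Tp NX.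
have [N0|gi] := MQ _ g gs NF.
  right=> y; apply/ker; apply: XY0 => //; split=> //; exact: NX.1.
left; apply: XY0 => //; split=> [|z]; first exact: LX.1.
apply: (Tor1_map_inj Tadd TT fi); rewrite linear0.
apply: ki; rewrite linear0; apply: gi; rewrite [RHS]linear0 /g /= kk'.
by apply/(Tor1_exact Tadd TT ex); exists z.
Qed.

(** For a quotient N in F with kernel K, Ext^1(T, K) embeds in a copy of X because Hom(T, N) = 0. It
    is 0 or everything; accordingly K or N lies in both T and F. *)
Lemma Tor1_simple (X : lmodType (End T)^c) :
  S_class (@class_X S T) X -> Q_class (class_F T) (Tor1 X).
Proof.
move=> /(S_simpleP (@class_X_iso S T))[XX X0 XS].
have [TF [k [ki ks]]] := Tor1_class_X Sn Bn homf Tadd TT Tf Tp XX.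
apply/(Q_simpleP (@class_F_iso S T)); split=> //.
  by move=> H0; apply: X0; apply: XY0 => //; split=> //; exact: XX.1.
move=> N g gs NF; have ex := short_exact_ker gs; have [ii ker _] := ex.
have LF : class_F T (subm (kerm g)) := class_F_sub Sn ii TF.
have [LX _] := Ext1_class_F extf Tadd TT LF.
have [k' [kk' k'k]] := lin_inv ki ks.
pose f : {linear Ext1 T (subm (kerm g)) -> X} := k' \o Ext1_map T (incl_map (kerm g)).
have fi : injective f.
  by move=> x y /(can_inj k'k)/(Ext1_map_inj ex NF.2).
have [L0|fs] := XS _ f fi LX.
  right; apply: lin_inj => x /ker[l <-].
  by rewrite (Ext1_Hom_zero Tadd L0 LF.2 l) linear0.
left; apply: (Ext1_Hom_zero Tadd _ NF.2) => q.
have [q' <-] := Ext1_map_surj Tp gs q; apply/(Ext1_map_exact ex).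
by have [r rq] := fs (k' q'); exists r; apply: (can_inj k'k).
Qed.

Lemma Hom_filtration_hyp :
  filtration_hyp (HomF T) (S_class (class_T T)) (class_T T) (Q_class (@class_Y S T)).
Proof.
split.
- by move=> M [].
- by move=> M M0; apply: (class_T_quot Tp (g := \0)) (conj Tf TT) => x; exists 0; rewrite (M0 x).
- move=> L M N f g fg [Lf LE] [Nf NE].
  by split; [exact: fin_gen_ext fg Lf Nf | exact: Ext1_zero_mid fg LE NE].
- move=> L M N f g fg LE _; have [fi _ _] := fg; split; first exact: Hom_map_inj.
    exact: Hom_map_exact.
  exact: (Hom_map_surj fg LE.2).
- by move=> M M0 h; apply: Hom_ext => t; apply: M0.
- exact: Hom_simple.
- exact: (Q_class_iso (@class_Y_iso S T)).
- by move=> M [].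
Qed.

Lemma tens_filtration_hyp :
  filtration_hyp (tensF T) (Q_class (@class_Y S T)) (@class_Y S T) (S_class (class_T T)).
Proof.
split.
- by move=> M [].
- move=> M M0; split; first by exists 0, (fun=> 0) => x; exists (fun=> 0); rewrite big_ord0 (M0 x).
  (* The zero module embeds in Hom(T, T), on which Tor_1 vanishes. *)
  apply: (Tor1_zero_sub Tadd TT (h := \0 : {linear M -> Hom T T})); last exact: Tor1_Hom.
  by move=> x y _; rewrite (M0 x) (M0 y).
- move=> L M N f g fg [Lf L0] [Nf N0].
  by split; [exact: fin_gen_ext fg Lf Nf | exact: (Tor1_zero_mid Tadd TT fg L0 N0)].
- move=> L M N f g fg _ N0; have [_ _ gs] := fg; split.
  + exact: (tens_map_inj Tadd TT fg N0.2).
  + exact: (tens_exact Tadd TT fg).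
  + exact: tens_map_surj.
- move=> M M0; elim/tens_ind => [|p q -> ->|x t] //; first by rewrite subrr.
  by rewrite (M0 x) tens_pure0l.
- exact: tens_simple.
- exact: (S_class_iso (@class_T_iso S T)).
- by move=> M [].
Qed.

Lemma Ext1_filtration_hyp :
  filtration_hyp (Ext1F T) (Q_class (class_F T)) (class_F T) (S_class (@class_X S T)).
Proof.
split.
- by move=> M [].
- move=> M M0; split; first by exists 0, (fun=> 0) => x; exists (fun=> 0); rewrite big_ord0 (M0 x).
  by move=> h; apply: Hom_ext => t; apply: M0.
- move=> L M N f g fg [Lf L0] [Nf N0]; split; first exact: fin_gen_ext fg Lf Nf.
  by move=> h; have /(Hom_map_exact fg)[h' <-] := N0 (Hom_map T g h); rewrite (L0 h') linear0.
- move=> L M N f g fg _ N0; have [_ _ gs] := fg; split.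
  + exact: (Ext1_map_inj fg N0.2).
  + exact: (Ext1_map_exact fg).
  + exact: Ext1_map_surj.
- by move=> M M0; apply/Ext1_zeroP => h; exists \0 => k; rewrite (M0 (h k)).
- exact: Ext1_simple.
- exact: (S_class_iso (@class_X_iso S T)).
- by move=> M [].
Qed.

Lemma Tor1_filtration_hyp :
  filtration_hyp (Tor1F T) (S_class (@class_X S T)) (@class_X S T) (Q_class (class_F T)).
Proof.
split.
- by move=> M [].
- move=> M M0; split; first by exists 0, (fun=> 0) => x; exists (fun=> 0); rewrite big_ord0 (M0 x).
  elim/tens_ind => [|p q -> ->|x t] //; first by rewrite subrr.
  by rewrite (M0 x) tens_pure0l.
- move=> L M N f g fg [Lf L0] [Nf N0]; split; first exact: fin_gen_ext fg Lf Nf.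
  move=> w; have /(tens_exact Tadd TT fg)[w' <-] := N0 (tens_map g w).
  by rewrite (L0 w') linear0.
- move=> L M N f g fg L0 _; have [fi _ _] := fg; split.
  + exact: (Tor1_map_inj Tadd TT fi).
  + exact: (Tor1_exact Tadd TT fg).
  + exact: (Tor1_map_surj Tadd TT fg L0.2).
- move=> M M0; apply: (Tor1_zero_sub Tadd TT (h := \0 : {linear M -> Hom T T})).
    by move=> x y _; rewrite (M0 x) (M0 y).
  exact: Tor1_Hom.
- exact: Tor1_simple.
- exact: (Q_class_iso (@class_F_iso S T)).
- by move=> M [].
Qed.
End SimpleCorrespondence.

Lemma tilting_add_coresolved (A : pzRingType) (T : lmodType A^c) :
  tilting T -> add_coresolved T.
Proof.
move=> [_ _ _ [T1 [T2 [f [g [fg /in_add_dual_basis[p [u [v uv]]]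
  /in_add_dual_basis[q [u2 [v2 uv2]]]]]]]]].
by exists T1, T2, f, g, p, u, v, q, u2, v2.
Qed.

Theorem theorem3p2p4 (A : pzRingType) (T : lmodType A^c) :
  artin_algebra A -> tilting T ->
  (* a *)
  ((forall (M : lmodType A^c) (n : nat) (F : nat -> submodClosed M),
      class_T T M -> filtration (S_class (class_T T)) n F ->
      induces_filtration (HomF T) (Q_class (@class_Y _ T)) n F) /\
   (forall (n : nat) (N : nat -> lmodType A^c) (f : forall i, {linear N i.+1 -> N i}),
      class_T T (N n) -> cofiltration (S_class (class_T T)) n f ->
      induces_cofiltration (HomF T) (Q_class (@class_Y _ T)) n f)) /\
  (* b *)
  ((forall (M : lmodType (End T)^c) (n : nat) (F : nat -> submodClosed M),
      class_Y M -> filtration (Q_class (@class_Y _ T)) n F ->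
      induces_filtration (tensF T) (S_class (class_T T)) n F) /\
   (forall (n : nat) (N : nat -> lmodType (End T)^c)
      (f : forall i, {linear N i.+1 -> N i}),
      class_Y (N n) -> cofiltration (Q_class (@class_Y _ T)) n f ->
      induces_cofiltration (tensF T) (S_class (class_T T)) n f)) /\
  (* c *)
  ((forall (M : lmodType A^c) (n : nat) (F : nat -> submodClosed M),
      class_F T M -> filtration (Q_class (class_F T)) n F ->
      induces_filtration (Ext1F T) (S_class (@class_X _ T)) n F) /\
   (forall (n : nat) (N : nat -> lmodType A^c) (f : forall i, {linear N i.+1 -> N i}),
      class_F T (N n) -> cofiltration (Q_class (class_F T)) n f ->
      induces_cofiltration (Ext1F T) (S_class (@class_X _ T)) n f)) /\
  (* d *)
  ((forall (M : lmodType (End T)^c) (n : nat) (F : nat -> submodClosed M),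
      class_X M -> filtration (S_class (@class_X _ T)) n F ->
      induces_filtration (Tor1F T) (Q_class (class_F T)) n F) /\
   (forall (n : nat) (N : nat -> lmodType (End T)^c)
      (f : forall i, {linear N i.+1 -> N i}),
      class_X (N n) -> cofiltration (S_class (@class_X _ T)) n f ->
      induces_cofiltration (Tor1F T) (Q_class (class_F T)) n f)).
Proof.
move=> Aart Ttilt; have Tadd := tilting_add_coresolved Ttilt.
have [Tf Tpd TT _] := Ttilt.
have [An Bn homf extf] := artin_finiteness Aart Tf Tpd.
have Tp := projective_syz Tpd.
have ha := Hom_filtration_hyp Bn homf Tadd TT Tf Tp.
have hb := tens_filtration_hyp Bn homf Tadd TT Tf Tp.
have hc := Ext1_filtration_hyp An Bn homf extf Tadd TT Tf Tp.
have hd := Tor1_filtration_hyp An Bn homf extf Tadd TT Tf Tp.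
split; [split | split; [split | split; split]].
- by move=> M n F _; exact: (induced_filtration ha).
- by move=> n N f _; exact: (induced_cofiltration ha).
- by move=> M n F _; exact: (induced_filtration hb).
- by move=> n N f _; exact: (induced_cofiltration hb).
- by move=> M n F _; exact: (induced_filtration hc).
- by move=> n N f _; exact: (induced_cofiltration hc).
- by move=> M n F _; exact: (induced_filtration hd).
- by move=> n N f _; exact: (induced_cofiltration hd).
Qed.
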